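(* The problem $4$-SAT/1-FLIP with lexicographic payoffs is PLS-complete.
   Context: PLS (Polynomial Local Search) is the class of local optimization problems in which a starting feasible solution and the neighborhood of a solution are computable in polynomial time, feasibility is recognizable in polynomial time, and one must output a local optimum (a feasible solution with no strictly better neighbor). PLS-completeness is with respect to PLS-reductions: a pair of polynomial-time functions $(f,g)$ where $f$ maps instances $I$ of $P$ to instances $f(I)$ of $Q$ and $g$ maps any local optimum $s$ of $f(I)$ to a local optimum $g(I,s)$ of $I$. The problem $k$-SAT/$d$-FLIP with lexicographic payoffs: the input is a CNF formula $F=C_1\wedge\dots\wedge C_t$ in which every clause has at most $k$ literals, with clauses listed in order of priority; clause $C_i$ has weight $2^{t-i}$. The payoff of a truth assignment $\alpha$ is the total weight of the clauses it satisfies. The task is to find an assignment $\alpha$ such that no assignment obtained from $\alpha$ by changing the values of at most $d$ variables has strictly larger payoff. *)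

(* Defs.v *)
From HB Require Import structures.
From mathcomp Require Import all_boot.

Set Implicit Arguments.
Unset Strict Implicit.
Unset Printing Implicit Defensive.

Inductive move := MoveLeft | Stay | MoveRight.

(* [None] is the blank, [Some (inl b)] an input/output bit, and [Some (inr a)]
   an auxiliary symbol of the machine's own working alphabet. *)
Definition symbol (aux : finType) : finType := option (bool + aux)%type.

Record turing_machine := TuringMachine {
  tm_extra_tapes : nat;  (* the machine has [tm_extra_tapes.+1] tapes *)
  tm_state : finType;
  tm_aux : finType;
  tm_start : tm_state;
  tm_halt : pred tm_state;
  tm_trans : tm_state -> {ffun 'I_tm_extra_tapes.+1 -> symbol tm_aux} ->
    tm_state * {ffun 'I_tm_extra_tapes.+1 -> symbol tm_aux * move}
}.

(* A two-way infinite tape: the cells left of the head (nearest first), the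
   scanned cell, and the cells to its right; all cells not listed are blank. *)
Record tape (aux : finType) := Tape {
  tape_left : seq (symbol aux);
  tape_head : symbol aux;
  tape_right : seq (symbol aux)
}.

Definition tape_of (aux : finType) (u : seq (symbol aux)) : tape aux :=
  Tape [::] (head None u) (behead u).

Definition tape_write_move (aux : finType) (t : tape aux)
    (am : symbol aux * move) : tape aux :=
  let: Tape l _ r := t in
  let: (a, m) := am in
  match m with
  | MoveLeft => Tape (behead l) (head None l) (a :: r)
  | Stay => Tape l a r
  | MoveRight => Tape (a :: l) (head None r) (behead r)
  end.

Definition config (M : turing_machine) : Type :=
  (tm_state M * {ffun 'I_(tm_extra_tapes M).+1 -> tape (tm_aux M)})%type.

Definition tm_init (M : turing_machine) (w : seq bool) : config M :=
  (tm_start M,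
   [ffun i => tape_of (if i == ord0 then [seq Some (inl b) | b <- w]
                       else [::])]).

(* A halting configuration is a fixed point of [tm_step]. *)
Definition tm_step (M : turing_machine) (c : config M) : config M :=
  let: (q, ts) := c in
  if tm_halt q then c else
  let: (q', acts) := tm_trans q [ffun i => tape_head (ts i)] in
  (q', [ffun i => tape_write_move (ts i) (acts i)]).

Fixpoint leading_bits (aux : finType) (u : seq (symbol aux)) : seq bool :=
  if u is Some (inl b) :: u' then b :: leading_bits u' else [::].

(* The output is the maximal bit string starting at the head of tape 0. *)
Definition tm_output (M : turing_machine) (c : config M) : seq bool :=
  let t := c.2 ord0 in leading_bits (tape_head t :: tape_right t).

Definition computes_within (M : turing_machine) (T : nat)
    (w v : seq bool) : Prop :=
  let c := iter T (@tm_step M) (tm_init M w) in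
  tm_halt c.1 /\ tm_output c = v.

Definition enc_str (w : seq bool) : seq bool :=
  rcons (flatten [seq [:: true; b] | b <- w]) false.

Definition enc_seq (ws : seq (seq bool)) : seq bool :=
  flatten [seq enc_str w | w <- ws].

Definition enc_bool (b : bool) : seq bool := [:: b].

(* Binary notation without leading zeros, least significant bit first. *)
Definition enc_nat (n : nat) : seq bool :=
  mkseq (fun i => odd (n %/ 2 ^ i)) (up_log 2 n.+1).

Lemma enc_str_cat_inj (v w r s : seq bool) :
  enc_str v ++ r = enc_str w ++ s -> v = w /\ r = s.
Proof.
by elim: v w => [|a v IHv] [|b w] //= => [[->]|[-> /IHv[-> ->]]].
Qed.

Lemma enc_seq_inj : injective enc_seq.
Proof.
elim=> [|v vs IHv] [|w ws] //=; rewrite /enc_seq /=.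
- by case: w.
- by case: v.
by move=> /enc_str_cat_inj[-> /IHv ->].
Qed.

Definition polytime (A B : Type) (encA : A -> seq bool) (encB : B -> seq bool)
    (D : A -> Prop) (f : A -> B) : Prop :=
  exists (M : turing_machine) (c k : nat), forall a : A, D a ->
    computes_within M (c * size (encA a) ^ k + c) (encA a) (encB (f a)).

(* Solutions are bit strings throughout; the payoff is to be maximized if
   [maximize] holds and minimized otherwise. *)
Record local_search := LocalSearch {
  instance : Type;
  enc_instance : instance -> seq bool;
  feasible : instance -> pred (seq bool);
  payoff : instance -> seq bool -> nat;
  neighbor : instance -> seq bool -> pred (seq bool);
  maximize : bool;
  enc_instance_inj : injective enc_instance;
  neighbor_feasible : forall x s s',
    feasible x s -> neighbor x s s' -> feasible x s'
}.

Definition better (P : local_search) (x : instance P) (s' s : seq bool) : bool :=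
  if maximize P then payoff x s < payoff x s' else payoff x s' < payoff x s.

Definition local_optimum (P : local_search) (x : instance P) (s : seq bool) :
    Prop :=
  feasible x s /\ forall s', neighbor x s s' -> ~~ better x s' s.

Definition enc_pair (P : local_search) (xs : instance P * seq bool) : seq bool :=
  enc_seq [:: enc_instance xs.1; xs.2].

(* The polynomial bound on the length of solutions and the recognizability of
   encoded instances are part of the standard definition of PLS (Johnson,
   Papadimitriou and Yannakakis). The neighborhood is a set; what is computed
   is some list enumerating it. *)
Record in_PLS (P : local_search) : Prop := InPLS {
  PLS_instance : exists2 r : pred (seq bool),
    (forall w, r w <-> exists x : instance P, enc_instance x = w)
    & polytime id enc_bool (fun=> True) r;
  PLS_solution_size : exists c k : nat, forall (x : instance P) s,
    feasible x s -> size s <= c * size (enc_instance x) ^ k + c;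
  PLS_feasible :
    polytime (@enc_pair P) enc_bool (fun=> True) (fun xs => feasible xs.1 xs.2);
  PLS_start : exists2 init : instance P -> seq bool,
    (forall x, feasible x (init x))
    & polytime (@enc_instance P) id (fun=> True) init;
  PLS_payoff :
    polytime (@enc_pair P) enc_nat (fun xs => feasible xs.1 xs.2)
      (fun xs => payoff xs.1 xs.2);
  PLS_neighborhood : exists2 nbrs : instance P * seq bool -> seq (seq bool),
    (forall x s, feasible x s -> nbrs (x, s) =i neighbor x s)
    & polytime (@enc_pair P) enc_seq (fun xs => feasible xs.1 xs.2) nbrs
}.

Definition PLS_reducible (P Q : local_search) : Prop :=
  exists (f : instance P -> instance Q)
         (g : instance P * seq bool -> seq bool),
  [/\ polytime (@enc_instance P) (@enc_instance Q) (fun=> True) f,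
      polytime (@enc_pair P) id (fun xs => feasible (f xs.1) xs.2) g
    & forall x s, local_optimum (f x) s -> local_optimum x (g (x, s))].

Definition PLS_complete (Q : local_search) : Prop :=
  in_PLS Q /\ forall P : local_search, in_PLS P -> PLS_reducible P Q.

(* [(v, true)] is the variable number [v] and [(v, false)] its negation. *)
Definition literal := (nat * bool)%type.
Definition clause := seq literal.
Definition cnf := seq clause.

Definition kcnf (k : nat) (F : cnf) : bool := all (fun C => size C <= k) F.

(* The variables of [F] are numbered from 0 to [nvars F - 1]; a truth
   assignment is the bit string of length [nvars F] listing their values. *)
Definition nvars (F : cnf) : nat := \max_(C <- F) \max_(l <- C) l.1.+1.

Definition lit_sat (s : seq bool) (l : literal) : bool := nth false s l.1 == l.2.
Definition clause_sat (s : seq bool) (C : clause) : bool := has (lit_sat s) C.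

Definition lex_payoff (F : cnf) (s : seq bool) : nat :=
  \sum_(i < size F | clause_sat s (nth [::] F i)) 2 ^ (size F - i.+1).

Definition hamming (s s' : seq bool) : nat :=
  count (fun p => p.1 != p.2) (zip s s').

Definition flip_neighbor (d : nat) (s s' : seq bool) : bool :=
  (size s' == size s) && (hamming s s' <= d).

(* Variable numbers are written in unary, so that the length of an assignment
   is bounded by the length of the formula. *)
Definition enc_lit (l : literal) : seq bool := l.2 :: nseq l.1 true.
Definition enc_clause (C : clause) : seq bool := enc_seq [seq enc_lit l | l <- C].
Definition enc_cnf (F : cnf) : seq bool := enc_seq [seq enc_clause C | C <- F].

Lemma enc_lit_inj : injective enc_lit.
Proof.
by move=> [v b] [w c] /= [-> /(congr1 size)]; rewrite !size_nseq => ->.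
Qed.

Lemma enc_cnf_inj : injective enc_cnf.
Proof.
by move=> F G /enc_seq_inj/inj_map; apply=> C D /enc_seq_inj/(inj_map enc_lit_inj).
Qed.

Definition kcnf_formula (k : nat) : Type := {F : cnf | kcnf k F}.

Lemma enc_kcnf_inj (k : nat) :
  injective (fun F : kcnf_formula k => enc_cnf (val F)).
Proof. by move=> F G /enc_cnf_inj/val_inj. Qed.

Lemma flip_neighbor_feasible (k d : nat) (F : kcnf_formula k) (s s' : seq bool) :
  size s == nvars (val F) -> flip_neighbor d s s' -> size s' == nvars (val F).
Proof. by move=> /eqP <- /andP[]. Qed.

Definition sat_flip (k d : nat) : local_search := {|
  instance := kcnf_formula k;
  enc_instance := fun F => enc_cnf (val F);
  feasible := fun F s => size s == nvars (val F);
  payoff := fun F s => lex_payoff (val F) s;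
  neighbor := fun _ s s' => flip_neighbor d s s';
  maximize := true;
  enc_instance_inj := @enc_kcnf_inj k;
  neighbor_feasible := @flip_neighbor_feasible k d
|}.

(* Main.v *)
(** Every problem P in PLS is reduced directly to 4-SAT/1-FLIP.  By preprocessing, local search
on an instance of P becomes a step function on registers of m bits: a valid register holds the
value of a solution, most significant bit first, followed by the solution itself, and one step
either moves to a lexicographically larger valid register or stays put, exactly at the local optima.

In a stable assignment each variable takes the value demanded by the first clause, in order of
priority, whose other literals are all false.  The formula has two registers A and B, each read by
a copy of the circuit of the step function, with control bits a and b.  The clauses defining a gate
occur once at high priority, guarded by the negation of the control bit, and once at low priority
without guard: so an idle circuit does not block its register but is already evaluated when its
control bit is switched on.  With a on and b off, B copies the successor of A; if that is larger
than A, then b is switched on, then a off, then A is raised to B one bit at a time (unit clauses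
for the bits of A, and a comparison that keeps A below B), then a is switched on and b off again.
Only the raising of A needs high priority, hence all other moves of the cycle can be made improving
by low-priority clauses, and a stable assignment has a on, b off, and A at a fixed point.

The circuits are tableaux of Turing machines, with the cells numbered relative to the heads.
Polynomial-time computability is handled by a calculus of functions between types encoded as
binary trees, closed under composition, pairing, case distinction and bounded iteration, which is
compiled to multi-tape machines and can in turn simulate them. *)

From HB Require Import structures.
From mathcomp Require Import all_boot zify.
From Stdlib Require Import FunctionalExtensionality.
Require Import Defs.

Set Implicit Arguments.
Unset Strict Implicit.
Unset Printing Implicit Defensive.

(** * Stack programs and their compilation to Turing machines *)

(** A gate that selects between two inputs has clauses with three literals, so four literals leave
    room for exactly one guard; this is why each circuit is controlled by a single bit. No sequence
    of flips is ever followed: a stable assignment is examined for each of the four settings of [a]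
    and [b], and three settings are excluded by naming one flip that keeps all clauses of higher
    priority and repairs the next block. A stable assignment might hold arbitrary bits in the
    registers, so each circuit also outputs a validity bit, and a control bit may be on only if its
    register is valid. With both bits off [B] is loaded with the encoded starting solution, the only
    source of validity that presupposes none; [A] becomes valid by becoming equal to [B]. The value
    stands in front of the solution because the comparison bits see only the order of bit strings;
    for minimization its bits are complemented. All circuits come from one fixed machine for the
    step function, so the tables for its cells have constant size, however large. *)

(* [Case] and [Loop] pop the stack they test. *)
Inductive prog :=
| Skip
| Push of nat & bool
| Seq of prog & prog
| Case of nat & prog & prog & prog
| Loop of nat & prog & prog.

Definition store := nat -> seq bool.

Definition upd (s : store) (r : nat) (w : seq bool) : store :=
  fun i => if i == r then w else s i.

(** The number counts steps of the compiled machine exactly: a push takes two, since the head first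
    moves left and then writes, while sequencing is free because every instruction carries the
    address of its successor. *)
Inductive exec : prog -> store -> nat -> store -> Prop :=
| ExSkip s : exec Skip s 1 s
| ExPush r b s : exec (Push r b) s 2 (upd s r (b :: s r))
| ExSeq p q s t s1 t' s2 :
    exec p s t s1 -> exec q s1 t' s2 -> exec (Seq p q) s (t + t') s2
| ExCase0 r p pf pt s t s1 :
    s r = [::] -> exec p s t s1 -> exec (Case r p pf pt) s t.+1 s1
| ExCase r p pf pt s b w t s1 :
    s r = b :: w -> exec (if b then pt else pf) (upd s r w) t s1 ->
    exec (Case r p pf pt) s t.+1 s1
| ExLoop0 r pf pt s : s r = [::] -> exec (Loop r pf pt) s 1 s
| ExLoop r pf pt s b w t s1 t' s2 :
    s r = b :: w -> exec (if b then pt else pf) (upd s r w) t s1 ->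
    exec (Loop r pf pt) s1 t' s2 -> exec (Loop r pf pt) s (t + t').+1 s2.

Fixpoint regs (p : prog) : nat :=
  match p with
  | Skip => 0
  | Push r _ => r.+1
  | Seq p q => maxn (regs p) (regs q)
  | Case r p0 pf pt => maxn r.+1 (maxn (regs p0) (maxn (regs pf) (regs pt)))
  | Loop r pf pt => maxn r.+1 (maxn (regs pf) (regs pt))
  end.

Definition frame (B : nat) (s u : store) : store :=
  fun r => if r < B then s r else u r.

Lemma frame_upd B s u r w :
  r < B -> frame B (upd s r w) u = upd (frame B s u) r w.
Proof.
move=> rB; apply: functional_extensionality => i; rewrite /frame /upd.
by case: eqP => // ->; rewrite rB.
Qed.

(** A program acts only on registers below [regs p], so whatever is stored above survives a run.
    This protects saved inputs, partial results and loop counters when an arbitrary program is used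
    as a subroutine. *)
Lemma exec_frame p s t s' B u :
  exec p s t s' -> regs p <= B -> exec p (frame B s u) t (frame B s' u).
Proof.
have frE s0 r : r < B -> frame B s0 u r = s0 r by rewrite /frame => ->.
elim=> {p s t s'} /=.
- by move=> s _; exact: ExSkip.
- by move=> r b s rB; rewrite frame_upd // -(frE s r rB); exact: ExPush.
- move=> p q s t s1 t' s2 _ IH1 _ IH2; rewrite geq_max => /andP[p1 p2].
  exact: ExSeq (IH1 p1) (IH2 p2).
- move=> r p pf pt s t s1 s0 _ IH; rewrite !geq_max => /and4P[rB p1 _ _].
  by apply: ExCase0; [rewrite frE | exact: IH].
- move=> r p pf pt s b w t s1 sr _ IH; rewrite !geq_max => /and4P[rB _ p1 p2].
  apply: (@ExCase _ _ _ _ _ b w); first by rewrite frE.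
  by rewrite -frame_upd //; apply: IH; case: (b).
- by move=> r pf pt s s0; rewrite !geq_max => /and3P[rB _ _]; apply: ExLoop0; rewrite frE.
- move=> r pf pt s b w t s1 t' s2 sr _ IH1 _ IH2 le.
  move: (le); rewrite !geq_max => /and3P[rB p1 p2].
  apply: (@ExLoop _ _ _ _ b w); first by rewrite frE.
  + by rewrite -frame_upd //; apply: IH1; case: (b).
  + exact: IH2.
Qed.

Lemma exec_size p s t s' : exec p s t s' -> forall r, size (s' r) <= size (s r) + t.
Proof.
elim=> {p s t s'}.
- by move=> s r; lia.
- by move=> r b s r'; rewrite /upd; case: eqP => [->|_] /=; lia.
- by move=> p q s t s1 t' s2 _ IH1 _ IH2 r; move: (IH1 r) (IH2 r); lia.
- by move=> r p pf pt s t s1 _ _ IH r'; move: (IH r'); lia.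
- move=> r p pf pt s b w t s1 sr _ IH r'; move: (IH r'); rewrite /upd.
  by case: eqP => [->|_]; rewrite ?sr /=; lia.
- by move=> r pf pt s _ r'; lia.
- move=> r pf pt s b w t s1 t' s2 sr _ IH1 _ IH2 r'; move: (IH1 r') (IH2 r').
  by rewrite /upd; case: eqP => [->|_]; rewrite ?sr /=; lia.
Qed.

Inductive instr :=
| INop of nat
| IPush of nat & bool & nat
| ICase of nat & nat & nat & nat.

Fixpoint csize (p : prog) : nat :=
  match p with
  | Skip => 1
  | Push _ _ => 1
  | Seq p q => csize p + csize q
  | Case _ p0 pf pt => (csize p0 + csize pf + csize pt).+1
  | Loop _ pf pt => (csize pf + csize pt).+1
  end.

(* [o] is the address of the first instruction, [k] that of the continuation. *)
Fixpoint compile (p : prog) (o k : nat) : seq instr :=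
  match p with
  | Skip => [:: INop k]
  | Push r b => [:: IPush r b k]
  | Seq p q => compile p o (o + csize p) ++ compile q (o + csize p) k
  | Case r p0 pf pt =>
      ICase r o.+1 (o.+1 + csize p0) (o.+1 + csize p0 + csize pf) ::
      compile p0 o.+1 k ++ compile pf (o.+1 + csize p0) k ++
      compile pt (o.+1 + csize p0 + csize pf) k
  | Loop r pf pt =>
      ICase r k o.+1 (o.+1 + csize pf) ::
      compile pf o.+1 o ++ compile pt (o.+1 + csize pf) o
  end.

Lemma size_compile p o k : size (compile p o k) = csize p.
Proof.
elim: p o k => //= [p IHp q IHq|r p0 IH0 pf IHf pt IHt|r pf IHf pt IHt] o k.
- by rewrite size_cat IHp IHq.
- by rewrite !size_cat IH0 IHf IHt addnA.
- by rewrite size_cat IHf IHt.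
Qed.

Section StackMachine.

Variables (R : nat) (c : seq instr).

(** The stack grows to the left with its top under the head. The Boolean in the state marks the
    second half of a push; a pop blanks the cell it leaves. *)
Definition sm_trans (q : 'I_(size c).+1 * bool)
    (rd : {ffun 'I_R.+1 -> symbol void}) :
    ('I_(size c).+1 * bool) * {ffun 'I_R.+1 -> symbol void * move} :=
  let stay := [ffun i => (rd i, Stay)] in
  match nth (INop 0) c q.1 with
  | INop n => ((inord n, false), stay)
  | IPush r b n =>
      if q.2 then
        ((inord n, false),
         [ffun i : 'I_R.+1 => if i == r :> nat then (Some (inl b), Stay)
                              else (rd i, Stay)])
      else ((q.1, true),
            [ffun i : 'I_R.+1 => if i == r :> nat then (rd i, MoveLeft)
                                 else (rd i, Stay)])
  | ICase r n0 nf nt =>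
      match rd (inord r) with
      | Some (inl b) =>
          ((inord (if b then nt else nf), false),
           [ffun i : 'I_R.+1 => if i == r :> nat then (None, MoveRight)
                                else (rd i, Stay)])
      | _ => ((inord n0, false), stay)
      end
  end.

Definition stack_machine : turing_machine :=
  @TuringMachine R ('I_(size c).+1 * bool)%type void (ord0, false)
    (fun q => q.1 == size c :> nat) sm_trans.

Definition tape_rep (t : tape void) (w : seq bool) : Prop :=
  all (pred1 None) (tape_left t) /\
  exists k, tape_head t :: tape_right t =
            [seq Some (inl b) | b <- w] ++ nseq k (None : symbol void).

Definition config_rep (o : nat) (s : store) (cf : config stack_machine) : Prop :=
  cf.1 = (inord o, false) /\ forall i : 'I_R.+1, tape_rep (cf.2 i) (s i).

Let step := @tm_step stack_machine.

Lemma tape_rep_head t w : tape_rep t w ->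
  tape_head t = if w is b :: _ then Some (inl b) else None.
Proof. by case: t => l h r [_ [k /=]]; case: w => [|b w]; case: k => [|k] //= []. Qed.

Lemma tape_rep_same t w : tape_rep t w ->
  tape_rep (tape_write_move t (tape_head t, Stay)) w.
Proof. by case: t. Qed.

Lemma tape_rep_pop t b w : tape_rep t (b :: w) ->
  tape_rep (tape_write_move t (None, MoveRight)) w.
Proof.
case: t => l h r [/= bl [k [_ ->]]]; split=> //=.
case: w => [|b' w] /=; last by exists k.
by case: k => [|k]; [exists 1 | exists k.+1].
Qed.

Lemma tape_rep_push t b w : tape_rep t w ->
  tape_rep (tape_write_move (tape_write_move t (tape_head t, MoveLeft))
              (Some (inl b), Stay)) (b :: w).
Proof.
case: t => l h r [/= bl [k e]]; split=> /=; first by case: (l) bl => //= ? ? /andP[].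
by exists k; rewrite e.
Qed.

Lemma not_halt o s cf : o < size c -> config_rep o s cf ->
  step cf = let: (q', acts) := sm_trans (inord o, false)
                  [ffun i => tape_head (cf.2 i)] in
            (q', [ffun i => tape_write_move (cf.2 i) (acts i)]).
Proof.
case: cf => q ts oc [/= -> _]; rewrite /step /= /tm_step.
by rewrite /= inordK ?ltn_eqF // ltnS ltnW.
Qed.

Lemma step_nop o s cf n : o < size c -> nth (INop 0) c o = INop n ->
  config_rep o s cf -> config_rep n s (step cf).
Proof.
move=> oc co rep; rewrite (not_halt oc rep) /sm_trans /= inordK ?ltnS ?(ltnW oc) // co.
case: rep => _ rep; split=> //= i; rewrite !ffunE; exact: tape_rep_same.
Qed.

Lemma step_push o s cf r b n : o < size c -> nth (INop 0) c o = IPush r b n ->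
  config_rep o s cf -> config_rep n (upd s r (b :: s r)) (step (step cf)).
Proof.
move=> oc co rep; rewrite (not_halt oc rep) /sm_trans /= inordK ?ltnS ?(ltnW oc) // co.
case: rep => _ rep.
rewrite /step /= /tm_step /= inordK ?ltnS ?(ltnW oc) // ltn_eqF //.
rewrite /sm_trans /= inordK ?ltnS ?(ltnW oc) // co /=.
split=> //= i; rewrite !ffunE /upd; case: eqP => [ir|_].
  by have := rep i; rewrite ir; exact: tape_rep_push.
by do 2!apply: tape_rep_same.
Qed.

Lemma step_case o s cf r n0 nf nt : o < size c -> r <= R ->
  nth (INop 0) c o = ICase r n0 nf nt -> config_rep o s cf ->
  match s r with
  | [::] => config_rep n0 s (step cf)
  | b :: w => config_rep (if b then nt else nf) (upd s r w) (step cf)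
  end.
Proof.
move=> oc rR co rep; rewrite (not_halt oc rep) /sm_trans /= inordK ?ltnS ?(ltnW oc) // co.
case: rep => _ rep; rewrite ffunE (tape_rep_head (rep _)) inordK //.
case sr: (s r) => [|b w] /=.
  split=> //= i; rewrite !ffunE; exact: tape_rep_same.
split=> //= i; rewrite !ffunE /upd; case: eqP => [ir|_]; last exact: tape_rep_same.
by apply: (tape_rep_pop (b := b)); rewrite -sr -ir.
Qed.

Definition code_at (d : seq instr) (o : nat) : Prop :=
  o + size d <= size c /\ forall i, i < size d -> nth (INop 0) c (o + i) = nth (INop 0) d i.

Lemma code_at_cat d e o : code_at (d ++ e) o -> code_at d o /\ code_at e (o + size d).
Proof.
case; rewrite size_cat => le H; split; split; rewrite -?addnA ?addnA //.
- by apply: leq_trans le; rewrite addnA leq_addr.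
- by move=> i lt; rewrite H ?nth_cat ?lt // (leq_trans lt) ?leq_addr.
- by rewrite -addnA.
- by move=> i lt; rewrite -addnA H ?ltn_add2l // nth_cat ltnNge leq_addr /= addKn.
Qed.

Lemma code_at_cons x d o :
  code_at (x :: d) o -> [/\ o < size c, nth (INop 0) c o = x & code_at d o.+1].
Proof.
case=> /= le H; split; first by apply: leq_trans le; rewrite addnS ltnS leq_addr.
  by have := H 0 isT; rewrite addn0.
by split=> [|i lt]; [rewrite addSnnS | rewrite addSnnS H].
Qed.

(** The induction is on the execution rather than on the program: a loop runs its own code again
    from the same address, which is smaller only as an execution. *)
Lemma compile_correct p s t s' : exec p s t s' ->
  forall o k cf, regs p <= R.+1 -> code_at (compile p o k) o ->
  config_rep o s cf -> config_rep k s' (iter t step cf).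
Proof.
elim=> {p s t s'} /=.
- by move=> s o k cf _ /code_at_cons[oc co _]; exact: step_nop.
- by move=> r b s o k cf _ /code_at_cons[oc co _]; exact: step_push.
- move=> p q s t s1 t' s2 _ IH1 _ IH2 o k cf; rewrite geq_max => /andP[r1 r2].
  move=> /code_at_cat[]; rewrite size_compile => c1 c2 rep.
  by rewrite addnC iterD; apply: (IH2 (o + csize p)) => //; exact: IH1 rep.
- move=> r p pf pt s t s1 s0 _ IH o k cf; rewrite !geq_max => /and4P[rR r1 _ _].
  move=> /code_at_cons[oc co /code_at_cat[c1 _]] rep.
  rewrite -iterS iterSr; apply: (IH o.+1) => //.
  by have := step_case oc rR co rep; rewrite s0.
- move=> r p pf pt s b w t s1 sr _ IH o k cf; rewrite !geq_max => /and4P[rR _ r1 r2].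
  move=> /code_at_cons[oc co /code_at_cat[_ /code_at_cat[]]].
  rewrite !size_compile => c1 c2 rep.
  have := step_case oc rR co rep; rewrite sr -iterS iterSr.
  by case: (b) IH => IH rep'; apply: IH rep'.
- move=> r pf pt s s0 o k cf; rewrite !geq_max => /and3P[rR _ _].
  move=> /code_at_cons[oc co _] rep.
  by have := step_case oc rR co rep; rewrite s0.
- move=> r pf pt s b w t s1 t' s2 sr _ IH1 _ IH2 o k cf le H rep.
  move: (le); rewrite !geq_max => /and3P[rR r1 r2].
  move: (H) => /code_at_cons[oc co /code_at_cat[]].
  rewrite !size_compile => c1 c2.
  rewrite -iterS iterSr addnC iterD; apply: (IH2 o) => //.
  have := step_case oc rR co rep; rewrite sr.
  by case: (b) IH1 => IH1 rep'; apply: IH1 rep'.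
Qed.

End StackMachine.

Definition input_store (w : seq bool) : store := fun r => if r == 0 then w else [::].

Lemma leading_bits_map (w : seq bool) k :
  leading_bits ([seq Some (inl b) | b <- w] ++ nseq k (None : symbol void)) = w.
Proof. by elim: w => [|b w IH] /=; [case: k | rewrite IH]. Qed.

Lemma tm_halt_iter (M : turing_machine) (cf : config M) n :
  tm_halt cf.1 -> iter n (@tm_step M) cf = cf.
Proof. by move=> h; elim: n => //= n ->; case: cf h => q ts /= h; rewrite /tm_step h. Qed.

Lemma exec_polytime (A B : Type) (encA : A -> seq bool) (encB : B -> seq bool)
    (D : A -> Prop) (f : A -> B) (p : prog) (c k : nat) :
  (forall a, D a -> exists2 t, t <= c * size (encA a) ^ k + c &
     exists2 s, exec p (input_store (encA a)) t s & s 0 = encB (f a)) ->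
  polytime encA encB D f.
Proof.
move=> H; pose L := compile p 0 (csize p).
exists (stack_machine (regs p) L), c, k => a Da; have [t le [s ex s0]] := H a Da.
have Lsz : size L = csize p by rewrite size_compile.
have rep0 : config_rep 0 (input_store (encA a))
              (tm_init (stack_machine (regs p) L) (encA a)).
  split; first by congr (_, _); apply: val_inj; rewrite /= inordK.
  move=> i; rewrite ffunE /input_store; case: eqP => [->|/eqP/negbTE ni].
    by case: (encA a) => [|b w]; split=> //=; [exists 1 | exists 0; rewrite cats0].
  by rewrite -(inj_eq val_inj) /= in ni; rewrite ni; split=> //=; exists 1.
have [e1 e2] : config_rep (csize p) s
    (iter t (@tm_step (stack_machine (regs p) L)) (tm_init _ (encA a))).
  apply: (compile_correct (c := L) ex (o := 0) (k := csize p)) => //.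
have h : tm_halt (iter t (@tm_step (stack_machine (regs p) L)) (tm_init _ (encA a))).1.
  by rewrite e1 /= inordK ?Lsz.
(* The run may end before the prescribed number of steps; a halting configuration is fixed, so the
   remaining steps change nothing. *)
rewrite /computes_within -(subnK le) iterD tm_halt_iter //; split=> //.
rewrite /tm_output; have [_ [j ->]] := e2 ord0.
by rewrite leading_bits_map -s0.
Qed.

(** * Polynomially bounded functions *)

Definition poly_le (g : nat -> nat) : Prop := exists c k, forall n, g n <= c * n ^ k + c.

Lemma poly_le_trans g h : (forall n, g n <= h n) -> poly_le h -> poly_le g.
Proof. by move=> gh [c [k H]]; exists c, k => n; exact: leq_trans (gh n) (H n). Qed.

Lemma poly_le_const a : poly_le (fun=> a).
Proof. by exists a, 0 => n; rewrite leq_addl. Qed.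

Lemma poly_le_id : poly_le id.
Proof. by exists 1, 1 => n; rewrite expn1 mul1n leq_addr. Qed.

Lemma leq_exp_addr n k l : 0 < n -> n ^ k <= n ^ (k + l).
Proof. by move=> n0; rewrite expnD leq_pmulr // expn_gt0 n0. Qed.

(** The summand 1 covers [n = 0], where [n ^ 0 = 1] exceeds every positive power. *)
Lemma expn_le_add n k l : n ^ k <= n ^ (k + l) + 1.
Proof.
rewrite addn1; case: n => [|n]; first by case: k => // k; rewrite exp0n.
by rewrite leqW // leq_exp_addr.
Qed.

Lemma poly_le_add g h : poly_le g -> poly_le h -> poly_le (fun n => g n + h n).
Proof.
move=> [c [k H]] [d [l H']]; exists (2 * (c + d)), (k + l) => n.
have := expn_le_add n k l; have := expn_le_add n l k; rewrite (addnC l k).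
by move: (H n) (H' n); nia.
Qed.

Lemma poly_le_mul g h : poly_le g -> poly_le h -> poly_le (fun n => g n * h n).
Proof.
move=> [c [k H]] [d [l H']]; exists (3 * c * d), (k + l) => n.
apply: leq_trans (leq_mul (H n) (H' n)) _.
have e1 := expn_le_add n k l; have e2 := expn_le_add n l k.
rewrite (addnC l k) in e2.
have -> : (c * n ^ k + c) * (d * n ^ l + d) =
  c * d * (n ^ (k + l) + n ^ k + n ^ l + 1) by rewrite expnD; nia.
have -> : 3 * c * d * n ^ (k + l) + 3 * c * d = c * d * (3 * n ^ (k + l) + 3) by nia.
by rewrite leq_mul2l; apply/orP; right; lia.
Qed.

Lemma poly_le_exp g k : poly_le g -> poly_le (fun n => g n ^ k).
Proof.
move=> pg; elim: k => [|k IH]; first exact: poly_le_const.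
by apply: poly_le_trans (poly_le_mul pg IH) => n; rewrite expnS.
Qed.

Lemma poly_le_comp g h : poly_le g -> poly_le h -> poly_le (fun n => g (h n)).
Proof.
move=> [c [k H]] ph; apply: (@poly_le_trans _ (fun n => c * (h n) ^ k + c)) => //.
apply: poly_le_add (poly_le_const _).
exact: poly_le_mul (poly_le_const _) (poly_le_exp _ ph).
Qed.

(** Under composition a time bound is evaluated at an upper estimate of a size, which requires it to
    be monotone. *)
Lemma poly_le_mono g : poly_le g ->
  exists2 h, poly_le h & {homo h : m n / m <= n} /\ forall n, g n <= h n.
Proof.
move=> [c [k H]]; exists (fun n => c * n ^ k + c); first by exists c, k.
split=> // m n le; rewrite leq_add2r leq_mul2l; apply/orP; right.
by case: k {H} => // k; rewrite leq_exp2r.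
Qed.

Ltac polyle := repeat first
  [ assumption | exact: poly_le_id | apply: poly_le_const
  | apply: poly_le_add | apply: poly_le_mul | apply: poly_le_exp ].

(** * Programs on binary trees *)

Inductive tree := Leaf | Node of tree & tree.

(** Preorder, one bit per node or leaf. The code is self-delimiting, so a pair needs no separator
    and a concatenation can be split by counting pending subtrees. *)
Fixpoint tree_bits (t : tree) : seq bool :=
  if t is Node a b then true :: tree_bits a ++ tree_bits b else [:: false].

Definition tfst (t : tree) := if t is Node a _ then a else Leaf.
Definition tsnd (t : tree) := if t is Node _ b then b else Leaf.
Definition is_node (t : tree) := if t is Node _ _ then true else false.

Definition exec_le (p : prog) (s : store) (T : nat) (s' : store) : Prop :=
  exists2 t, t <= T & exec p s t s'.

Lemma exec_le_weak p s T T' s' : exec_le p s T s' -> T <= T' -> exec_le p s T' s'.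
Proof. by move=> [t le ex] le'; exists t => //; exact: leq_trans le'. Qed.

Lemma exec_le_seq p q s T s1 T' s2 :
  exec_le p s T s1 -> exec_le q s1 T' s2 -> exec_le (Seq p q) s (T + T') s2.
Proof.
by move=> [t le ex] [t' le' ex']; exists (t + t'); [exact: leq_add | exact: ExSeq ex'].
Qed.

Lemma exec_le_skip s : exec_le Skip s 1 s.
Proof. by exists 1 => //; exact: ExSkip. Qed.

Lemma exec_le_push r b s s' : s' = upd s r (b :: s r) -> exec_le (Push r b) s 2 s'.
Proof. by move=> ->; exists 2 => //; exact: ExPush. Qed.

Lemma exec_le_case r p pf pt s b w T s' : s r = b :: w ->
  exec_le (if b then pt else pf) (upd s r w) T s' -> exec_le (Case r p pf pt) s T.+1 s'.
Proof. by move=> sr [t le ex]; exists t.+1 => //; exact: ExCase sr ex. Qed.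

Lemma exec_le_case0 r p pf pt s T s' : s r = [::] ->
  exec_le p s T s' -> exec_le (Case r p pf pt) s T.+1 s'.
Proof. by move=> sr [t le ex]; exists t.+1 => //; exact: ExCase0 sr ex. Qed.

Arguments exec_le_case {r p pf pt s b w T s'}.
Arguments exec_le_case0 {r p pf pt s T s'}.

Lemma exec_le_loop0 r pf pt s : s r = [::] -> exec_le (Loop r pf pt) s 1 s.
Proof. by move=> sr; exists 1 => //; exact: ExLoop0. Qed.

Lemma exec_le_loop r pf pt s b w T s1 T' s2 : s r = b :: w ->
  exec_le (if b then pt else pf) (upd s r w) T s1 ->
  exec_le (Loop r pf pt) s1 T' s2 -> exec_le (Loop r pf pt) s (T + T').+1 s2.
Proof.
move=> sr [t le ex] [t' le' ex']; exists (t + t').+1; first by rewrite ltnS leq_add.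
exact: ExLoop sr ex ex'.
Qed.

Lemma exec_le_frame p s T s' B u : exec_le p s T s' -> regs p <= B ->
  exec_le p (frame B s u) T (frame B s' u).
Proof. by move=> [t le ex] rB; exists t => //; exact: exec_frame. Qed.

Ltac store_eq :=
  apply: functional_extensionality => i; rewrite /upd /=;
  repeat (case: eqP => [?|?] //=; try subst; try lia).

Definition clear (r : nat) := Loop r Skip Skip.
Definition mv (a b : nat) := Loop a (Push b false) (Push b true).
Definition mv2 (a b c : nat) :=
  Loop a (Seq (Push b false) (Push c false)) (Seq (Push b true) (Push c true)).
Definition push_all (r : nat) (w : seq bool) := foldr (fun b p => Seq p (Push r b)) Skip w.

Lemma exec_clear r s s' : s' = upd s r [::] -> exec_le (clear r) s (2 * size (s r)).+1 s'.
Proof.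
move=> ->; move e: (s r) => w; elim: w s e => [|b w IH] s e.
  rewrite (_ : upd s r [::] = s); first exact: exec_le_loop0.
  by store_eq.
apply: exec_le_weak; first apply: (exec_le_loop e (T := 1) (s1 := upd s r w)).
- by case: (b); exact: exec_le_skip.
- rewrite (_ : upd s r [::] = upd (upd s r w) r [::]); last by store_eq.
  by apply: IH; rewrite /upd eqxx.
by rewrite /=; lia.
Qed.

Lemma exec_mv a b s s' : a != b ->
  s' = upd (upd s a [::]) b (rev (s a) ++ s b) ->
  exec_le (mv a b) s (3 * size (s a)).+1 s'.
Proof.
move=> ab ->; move e: (s a) => w; elim: w s e => [|x w IH] s e.
  rewrite (_ : upd _ _ _ = s); first exact: exec_le_loop0.
  by store_eq.
apply: exec_le_weak.
  apply: (exec_le_loop e (T := 2) (s1 := upd (upd s a w) b (x :: s b))).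
  - have -> : s b = upd s a w b by rewrite /upd eq_sym (negbTE ab).
    by case: (x); exact: exec_le_push.
  - set s1 := (X in exec_le _ X).
    rewrite (_ : upd (upd s a [::]) b (rev (x :: w) ++ s b) =
                 upd (upd s1 a [::]) b (rev w ++ s1 b)).
      by apply: IH; rewrite /s1 /upd (negbTE ab) eqxx.
    rewrite /s1; apply: functional_extensionality => i; rewrite /upd.
    case: (eqVneq i b) => _; first by rewrite eqxx rev_cons cat_rcons.
    by case: eqP.
by rewrite /=; lia.
Qed.

Lemma exec_mv2 a b c s s' : a != b -> a != c -> b != c ->
  s' = upd (upd (upd s a [::]) b (rev (s a) ++ s b)) c (rev (s a) ++ s c) ->
  exec_le (mv2 a b c) s (5 * size (s a)).+1 s'.
Proof.
move=> ab ac bc ->; move e: (s a) => w; elim: w s e => [|x w IH] s e.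
  rewrite (_ : upd _ _ _ = s); first exact: exec_le_loop0.
  by store_eq.
apply: exec_le_weak.
  apply: (exec_le_loop e (T := 4) (s1 := upd (upd (upd s a w) b (x :: s b)) c (x :: s c))).
  - have eb : s b = upd s a w b by rewrite /upd eq_sym (negbTE ab).
    have ec : s c = upd (upd s a w) b (x :: s b) c.
      by rewrite /upd eq_sym (negbTE bc) eq_sym (negbTE ac).
    by rewrite ec eb; case: (x); apply: (exec_le_seq (T := 2) (T' := 2)); exact: exec_le_push.
  - set s1 := (X in exec_le _ X).
    rewrite (_ : upd (upd (upd s a [::]) b (rev (x :: w) ++ s b)) c (rev (x :: w) ++ s c) =
                 upd (upd (upd s1 a [::]) b (rev w ++ s1 b)) c (rev w ++ s1 c)).
      by apply: IH; rewrite /s1 /upd (negbTE ac) (negbTE ab) eqxx.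
    rewrite /s1; apply: functional_extensionality => i; rewrite /upd.
    case: (eqVneq i c) => _; first by rewrite eqxx rev_cons cat_rcons.
    case: (eqVneq i b) => _; first by rewrite eqxx (negbTE bc) rev_cons cat_rcons.
    by case: eqP.
by rewrite /=; lia.
Qed.

Lemma exec_push_all r w s s' : s' = upd s r (w ++ s r) ->
  exec_le (push_all r w) s (2 * size w).+1 s'.
Proof.
move=> ->; elim: w => [|b w IH] /=.
  by rewrite (_ : upd _ _ _ = s); [exact: exec_le_skip | store_eq].
apply: exec_le_weak; first apply: exec_le_seq IH (exec_le_push _) => //.
- by rewrite /upd eqxx; apply: functional_extensionality => i; case: eqP.
by lia.
Qed.

Definition st4 (w0 w1 w2 w3 : seq bool) : store :=
  fun r => match r with 0 => w0 | 1 => w1 | 2 => w2 | 3 => w3 | _ => [::] end.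

Ltac st4_eq := apply: functional_extensionality => -[|[|[|[|?]]]]; rewrite /upd //=.

Lemma input_store_st4 w : input_store w = st4 w [::] [::] [::].
Proof. by apply: functional_extensionality => -[|[|[|[|i]]]]. Qed.

(** * Splitting the code of a pair into its components *)

Definition split_body :=
  Loop 0 (Case 1 (Push 3 false) Skip (Push 2 false))
         (Case 1 (Push 3 true) Skip (Seq (Push 1 true) (Seq (Push 1 true) (Push 2 true)))).

(* Register 1 counts, in unary, the subtrees still to be read into register 2. *)
Definition split_tree :=
  Case 0 Skip (Seq (Push 2 false) (Push 3 false)) (Seq (Push 1 true) split_body).

(** A leaf bit closes one pending subtree, a node bit replaces one by two. The rest of the run is a
    hypothesis, so that the induction on [t] can treat the two children one after the other. *)
Lemma exec_split_body t rest j u v T s' :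
  exec_le split_body (st4 rest (nseq j true) (rev (tree_bits t) ++ u) v) T s' ->
  exec_le split_body (st4 (tree_bits t ++ rest) (nseq j.+1 true) u v)
    (T + 8 * size (tree_bits t)) s'.
Proof.
elim: t rest j u v T s' => [|a IHa b IHb] rest j u v T s' H /=.
  apply: exec_le_weak.
    apply: (exec_le_loop (b := false) (w := rest) (T := 3) _ _ H) => //=.
    apply: (exec_le_case (b := true) (w := nseq j true)) => //=.
    by apply: exec_le_push; st4_eq.
  by lia.
apply: exec_le_weak.
  apply: (exec_le_loop (b := true) (w := (tree_bits a ++ tree_bits b) ++ rest) (T := 7)
     (s1 := st4 (tree_bits a ++ tree_bits b ++ rest) (nseq j.+2 true) (true :: u) v)) => //=.
    apply: (exec_le_case (b := true) (w := nseq j true)) => //=.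
    apply: (exec_le_seq (T := 2)); first exact: exec_le_push.
    apply: (exec_le_seq (T := 2)); first exact: exec_le_push.
    by apply: exec_le_push; st4_eq; rewrite catA.
  apply: (IHa _ j.+1); apply: (IHb _ j).
  by move: H; rewrite /= rev_cons rev_cat -cats1 -!catA; exact.
by rewrite size_cat; lia.
Qed.

Lemma exec_split_rest w u v :
  exec_le split_body (st4 w [::] u v) (4 * size w).+1 (st4 [::] [::] u (rev w ++ v)).
Proof.
elim: w v => [|b w IH] v; first exact: exec_le_loop0.
apply: exec_le_weak.
  apply: (exec_le_loop (b := b) (w := w) (T := 3) (s1 := st4 w [::] u (b :: v))) => //=.
    case: b; apply: exec_le_case0 => //; apply: exec_le_push; st4_eq.
  by rewrite rev_cons cat_rcons; exact: IH.
by rewrite /=; lia.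
Qed.

Lemma exec_split t :
  exec_le split_tree (input_store (tree_bits t)) (8 * size (tree_bits t) + 10)
    (st4 [::] [::] (rev (tree_bits (tfst t))) (rev (tree_bits (tsnd t)))).
Proof.
rewrite input_store_st4; case: t => [|a b].
  apply: (@exec_le_weak _ _ 5); last by rewrite /=; lia.
  apply: (exec_le_case (b := false) (w := [::])) => //=.
  by apply: (exec_le_seq (T := 2)) (exec_le_push _); [exact: exec_le_push | st4_eq].
apply: exec_le_weak.
  apply: (exec_le_case (b := true) (w := tree_bits a ++ tree_bits b)) => //=.
  apply: (exec_le_seq (T := 2) (s1 := st4 (tree_bits a ++ tree_bits b) [:: true] [::] [::])).
    by apply: exec_le_push; st4_eq.
  apply: (exec_split_body (j := 0)); rewrite cats0.
  by have := exec_split_rest (tree_bits b) (rev (tree_bits a)) [::]; rewrite cats0; exact.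
by rewrite /= size_cat; lia.
Qed.

(** * Polynomial-time functions between encoded types *)

Class Enc (A : Type) := { encode : A -> tree; dflt : A }.

Definition enc_size (A : Type) (EA : Enc A) (a : A) : nat := size (tree_bits (encode a)).

Definition enc_store (A : Type) (EA : Enc A) (a : A) : store :=
  input_store (tree_bits (encode a)).

(** Input and output sit in register 0 and all other registers are empty before and after the run,
    so composition is plain sequencing. Time is measured in the length of the tree code. *)
Definition Poly (A B : Type) (EA : Enc A) (EB : Enc B) (f : A -> B) : Prop :=
  exists p, exists2 T, poly_le T &
    forall a, exec_le p (enc_store EA a) (T (enc_size EA a)) (enc_store EB (f a)).
Arguments Poly {A B EA EB} f.
Arguments enc_size {A EA} a.
Arguments enc_store {A EA} a.

#[global] Instance Enc_tree : Enc tree := {| encode := id; dflt := Leaf |}.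
#[global] Instance Enc_bool : Enc bool :=
  {| encode b := if b then Node Leaf Leaf else Leaf; dflt := false |}.
(** Unary, with the same code as a list of [n] leaves: successor is pairing with a leaf, and a
    number can drive a loop directly. Exponentially large numbers therefore have to be handled as
    bit strings. *)
#[global] Instance Enc_nat : Enc nat :=
  {| encode n := iter n (Node Leaf) Leaf; dflt := 0 |}.
#[global] Instance Enc_prod (A B : Type) (EA : Enc A) (EB : Enc B) : Enc (A * B) :=
  {| encode p := Node (encode p.1) (encode p.2); dflt := (dflt, dflt) |}.
#[global] Instance Enc_list (A : Type) (EA : Enc A) : Enc (seq A) :=
  {| encode l := foldr (fun a t => Node (encode a) t) Leaf l; dflt := [::] |}.

Lemma size_tree_bits_gt0 t : 0 < size (tree_bits t).
Proof. by case: t. Qed.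

Lemma sz_gt0 A (EA : Enc A) (a : A) : 0 < enc_size a.
Proof. exact: size_tree_bits_gt0. Qed.
Arguments sz_gt0 {A EA} a.
Ltac sz_pos a := pose proof (sz_gt0 a).

Lemma sz_pair A B (EA : Enc A) (EB : Enc B) (a : A) (b : B) :
  enc_size (a, b) = (enc_size a + enc_size b).+1.
Proof. by rewrite /enc_size /= size_cat. Qed.

Lemma sz_cons A (EA : Enc A) (a : A) (l : seq A) :
  enc_size (a :: l) = (enc_size a + enc_size l).+1.
Proof. by rewrite /enc_size /= size_cat. Qed.

Lemma sz_nil A (EA : Enc A) : enc_size (@nil A) = 1.
Proof. by []. Qed.

Lemma sz_nat (n : nat) : enc_size n = (2 * n).+1.
Proof.
by rewrite /enc_size /=; elim: n => //= n IH; move: IH; lia.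
Qed.

Lemma sz_bool (b : bool) : enc_size b <= 3.
Proof. by case: b. Qed.

Lemma Poly_mono (A B : Type) (EA : Enc A) (EB : Enc B) (f : A -> B) : Poly f -> exists p T,
  [/\ poly_le T, {homo T : m n / m <= n}
    & forall a, exec_le p (enc_store a) (T (enc_size a)) (enc_store (f a))].
Proof.
move=> [p [T pT H]]; have [h ph [mh Th]] := poly_le_mono pT.
by exists p, h; split=> // a; exact: exec_le_weak (H a) (Th _).
Qed.

Lemma Poly_size (A B : Type) (EA : Enc A) (EB : Enc B) (f : A -> B) : Poly f ->
  exists T, [/\ poly_le T, {homo T : m n / m <= n}
              & forall a, enc_size (f a) <= T (enc_size a)].
Proof.
move=> /Poly_mono[p [T [pT mT H]]]; exists (fun n => n + T n); split.
- by polyle.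
- by move=> m n le; rewrite leq_add // mT.
move=> a; have [t le ex] := H a; have := exec_size ex 0.
by rewrite /enc_store /input_store /= -!/(enc_size _); lia.
Qed.

Section Combinators.

Variables (A B C : Type) (EA : Enc A) (EB : Enc B) (EC : Enc C).

Lemma Poly_ext (f g : A -> B) : f =1 g -> Poly f -> Poly g.
Proof. by move=> fg [p [T pT H]]; exists p, T => // a; rewrite -fg. Qed.

Lemma Poly_id : Poly (fun a : A => a).
Proof. exists Skip, (fun=> 1); [exact: poly_le_const | by move=> a; exact: exec_le_skip]. Qed.

Lemma Poly_comp (f : A -> B) (g : B -> C) : Poly f -> Poly g -> Poly (fun a => g (f a)).
Proof.
move=> pf /Poly_mono[q [U [pU mU Hq]]].
have [S [pS mS HS]] := Poly_size pf; move: pf => /Poly_mono[p [T [pT mT Hp]]].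
exists (Seq p q), (fun n => T n + U (S n)).
  by apply: poly_le_add => //; exact: poly_le_comp.
move=> a; apply: exec_le_weak (exec_le_seq (Hp a) (Hq _)) _.
by rewrite leq_add2l mU.
Qed.

Lemma Poly_const (b : B) : Poly (fun _ : A => b).
Proof.
exists (Seq (clear 0) (push_all 0 (tree_bits (encode b)))),
  (fun n => (2 * n + 1) + (2 * enc_size b + 1)); first by polyle.
move=> a; apply: exec_le_weak.
  apply: exec_le_seq (exec_clear (erefl _)) (exec_push_all _).
  by rewrite /enc_store /input_store; apply: functional_extensionality => -[|i] //=; rewrite cats0.
by rewrite /enc_store /enc_size /input_store /= !addn1.
Qed.

(** A program sees codes only, so functions with equal codes share it. This transports results
    between lists, pairs, records and finite functions at no cost. *)
Lemma Poly_encode (f : A -> B) (g : A -> C) :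
  (forall a, encode (f a) = encode (g a)) -> Poly f -> Poly g.
Proof. by move=> e [p [T pT H]]; exists p, T => // a; have := H a; rewrite /enc_store -e. Qed.

End Combinators.

(* Registers above [B] keep data out of reach of the program run on register 0. *)
Definition st_hi (B : nat) (w u v z : seq bool) : store :=
  frame B (input_store w)
    (fun r => if r == B then u else if r == B.+1 then v
              else if r == B.+2 then z else [::]).

Ltac st_hi_eq := apply: functional_extensionality => i; rewrite /upd /st_hi /frame /input_store;
  repeat (case: eqP => [?|?] //=; try subst);
  repeat (case: ltnP => ? //=); rewrite ?cats0 //; try lia.

Lemma st_hi0 B w u v z : 0 < B -> st_hi B w u v z 0 = w.
Proof. by rewrite /st_hi /frame => ->. Qed.
Lemma st_hi1 B w u v z : st_hi B w u v z B = u.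
Proof. by rewrite /st_hi /frame ltnn eqxx. Qed.
Lemma st_hi2 B w u v z : st_hi B w u v z B.+1 = v.
Proof. by rewrite /st_hi /frame ltnNge leqnSn /= eqxx gtn_eqF. Qed.
Lemma st_hi3 B w u v z : st_hi B w u v z B.+2 = z.
Proof.
rewrite /st_hi /frame; case: ltnP => ?; first lia.
by case: eqP => ?; [lia | case: eqP => ?; [lia | rewrite eqxx]].
Qed.

Lemma exec_st_hi p B w T w' u v z : exec_le p (input_store w) T (input_store w') ->
  regs p <= B -> exec_le p (st_hi B w u v z) T (st_hi B w' u v z).
Proof. exact: exec_le_frame. Qed.

Lemma input_store_st_hi B w : 0 < B -> input_store w = st_hi B w [::] [::] [::].
Proof. by move=> B0; st_hi_eq. Qed.

(** Every [mv] reverses a word. The copy of the input kept in [B.+1] passes through [B.+2] to regain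
    its orientation before [q] runs; the result of [p] waits reversed in [B], and the last move puts
    it in front of the result of [q]. *)
Definition pair_prog (B : nat) (p q : prog) : prog :=
  Seq (mv 0 B) (Seq (mv2 B 0 B.+1) (Seq p (Seq (mv 0 B) (Seq (mv B.+1 B.+2)
  (Seq (mv B.+2 0) (Seq q (Seq (mv B 0) (Push 0 true)))))))).

Lemma exec_pair_prog B p q w w1 w2 T1 T2 : 0 < B -> regs p <= B -> regs q <= B ->
  exec_le p (input_store w) T1 (input_store w1) ->
  exec_le q (input_store w) T2 (input_store w2) ->
  exec_le (pair_prog B p q) (input_store w)
    (14 * size w + 6 * size w1 + T1 + T2 + 8) (input_store (true :: w1 ++ w2)).
Proof.
move=> B0 rp rq H1 H2; have ? : 0 != B by rewrite eq_sym -lt0n.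
have l0 := @st_hi0 B _ _ _ _ B0.
rewrite !(input_store_st_hi _ B0); apply: exec_le_weak.
  apply: (exec_le_seq (s1 := st_hi B [::] (rev w) [::] [::])).
    by apply: exec_mv => //; rewrite l0 st_hi1; st_hi_eq.
  apply: (exec_le_seq (s1 := st_hi B w [::] w [::])).
    apply: exec_mv2; [lia | lia | lia |].
    by rewrite l0 st_hi1 st_hi2 revK; st_hi_eq.
  apply: (exec_le_seq (s1 := st_hi B w1 [::] w [::])); first exact: exec_st_hi H1 rp.
  apply: (exec_le_seq (s1 := st_hi B [::] (rev w1) w [::])).
    by apply: exec_mv => //; rewrite l0 st_hi1; st_hi_eq.
  apply: (exec_le_seq (s1 := st_hi B [::] (rev w1) [::] (rev w))).
    by apply: exec_mv; [lia | rewrite st_hi2 st_hi3; st_hi_eq].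
  apply: (exec_le_seq (s1 := st_hi B w (rev w1) [::] [::])).
    by apply: exec_mv => //; rewrite st_hi3 l0 revK; st_hi_eq.
  apply: (exec_le_seq (s1 := st_hi B w2 (rev w1) [::] [::])); first exact: exec_st_hi H2 rq.
  apply: (exec_le_seq (s1 := st_hi B (w1 ++ w2) [::] [::] [::])).
    by apply: exec_mv; [lia | rewrite l0 st_hi1 revK; st_hi_eq].
  by apply: exec_le_push; rewrite l0; st_hi_eq.
by rewrite !l0 !st_hi1 !st_hi2 !st_hi3 !size_rev; lia.
Qed.

Lemma Poly_pair A B C (EA : Enc A) (EB : Enc B) (EC : Enc C) (f : A -> B) (g : A -> C) :
  Poly f -> Poly g -> Poly (fun a => (f a, g a)).
Proof.
move=> pf pg; have [S [pS mS HS]] := Poly_size pf.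
move: pf pg => [p [T pT Hp]] [q [U pU Hq]].
exists (pair_prog (maxn 1 (maxn (regs p) (regs q))) p q),
  (fun n => 14 * n + 6 * S n + T n + U n + 8); first by polyle.
move=> a; apply: exec_le_weak.
  by apply: exec_pair_prog (Hp a) (Hq a); rewrite ?leq_max ?leqnn ?orbT.
by have := HS a; rewrite /enc_size; lia.
Qed.

Lemma Poly_tfst : Poly tfst.
Proof.
exists (Seq split_tree (Seq (clear 3) (mv 2 0))), (fun n => 13 * n + 12); first by polyle.
move=> t; apply: exec_le_weak.
  apply: exec_le_seq (exec_split t) _.
  apply: (exec_le_seq (s1 := st4 [::] [::] (rev (tree_bits (tfst t))) [::])).
    by apply: exec_clear; st4_eq.
  by apply: exec_mv => //; rewrite /enc_store input_store_st4 /= revK; st4_eq; rewrite cats0.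
rewrite /enc_size /= !size_rev; case: t => [|a b] //=; rewrite size_cat; lia.
Qed.

Lemma Poly_tsnd : Poly tsnd.
Proof.
exists (Seq split_tree (Seq (clear 2) (mv 3 0))), (fun n => 13 * n + 12); first by polyle.
move=> t; apply: exec_le_weak.
  apply: exec_le_seq (exec_split t) _.
  apply: (exec_le_seq (s1 := st4 [::] [::] [::] (rev (tree_bits (tsnd t))))).
    by apply: exec_clear; st4_eq.
  by apply: exec_mv => //; rewrite /enc_store input_store_st4 /= revK; st4_eq; rewrite cats0.
rewrite /enc_size /= !size_rev; case: t => [|a b] //=; rewrite size_cat; lia.
Qed.

Lemma Poly_is_node : Poly is_node.
Proof.
exists (Seq (Case 0 Skip (Push 1 false) (Push 1 true)) (Seq (clear 0)
   (Case 1 Skip (Push 0 false) (push_all 0 [:: true; false; false])))),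
  (fun n => 2 * n + 20); first by polyle.
move=> t; rewrite /enc_store !input_store_st4; case: t => [|a b].
  apply: exec_le_weak.
    apply: (exec_le_seq (s1 := st4 [::] [:: false] [::] [::]) (T := 3)).
      by apply: (exec_le_case (b := false)) => //=; apply: exec_le_push; st4_eq.
    apply: (exec_le_seq (s1 := st4 [::] [:: false] [::] [::])).
      by apply: exec_clear; st4_eq.
    by apply: (exec_le_case (b := false) (T := 2)) => //=; apply: exec_le_push; st4_eq.
  by rewrite /=; lia.
apply: exec_le_weak.
  apply: (exec_le_seq (s1 := st4 (tree_bits a ++ tree_bits b) [:: true] [::] [::]) (T := 3)).
    by apply: (exec_le_case (b := true)) => //=; apply: exec_le_push; st4_eq.
  apply: (exec_le_seq (s1 := st4 [::] [:: true] [::] [::])).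
    by apply: exec_clear; st4_eq.
  apply: (exec_le_case (b := true)) => //=.
  by apply: (@exec_push_all 0 [:: true; false; false]); st4_eq.
by rewrite /enc_size /=; lia.
Qed.

(** The code of [(c a, a)] starts with the node bit of the pair, followed by [false] or by [true],
    [false], [false] for the condition. The nested [Case] tests strip exactly this prefix and leave
    the code of [a] to the chosen program. *)
Lemma Poly_if A B (EA : Enc A) (EB : Enc B) (c : A -> bool) (f g : A -> B) :
  Poly c -> Poly f -> Poly g -> Poly (fun a => if c a then f a else g a).
Proof.
move=> pc [p [T pT Hp]] [q [U pU Hq]].
have [r [V pV Hr]] := Poly_pair pc (@Poly_id A EA).
exists (Seq r (Case 0 Skip Skip (Case 0 Skip q
          (Case 0 Skip (Case 0 Skip p Skip) Skip)))), (fun n => V n + (T n + U n + 4)).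
  by polyle.
move=> a; apply: exec_le_seq (Hr a) _.
rewrite /enc_store /=.
set w := tree_bits (encode a).
have upd0 x y : upd (input_store x) 0 y = input_store y.
  by apply: functional_extensionality => -[|i].
case: (c a) => /=.
- apply: (@exec_le_weak _ _ (T (enc_size a)).+4); last by lia.
  do 2!(apply: (exec_le_case (b := true)); first by []); rewrite !upd0.
  do 2!(apply: (exec_le_case (b := false)); first by []); rewrite !upd0.
  exact: Hp.
- apply: (@exec_le_weak _ _ (U (enc_size a)).+2); last by lia.
  apply: (exec_le_case (b := true)); first by []; rewrite !upd0.
  apply: (exec_le_case (b := false)); first by []; rewrite !upd0.
  exact: Hq.
Qed.

Definition nodes (t : tree) : nat := count id (tree_bits t).

Lemma exec_iter A (EA : Enc A) (f : A -> A) p T S B w a : 0 < B -> regs p <= B ->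
  {homo T : m n / m <= n} ->
  (forall a, exec_le p (enc_store a) (T (enc_size a)) (enc_store (f a))) ->
  (forall i, i <= count id w -> enc_size (iter i f a) <= S) ->
  exec_le (Loop B Skip p) (st_hi B (tree_bits (encode a)) w [::] [::])
    (size w * (T S + 2)).+1
    (st_hi B (tree_bits (encode (iter (count id w) f a))) [::] [::] [::]).
Proof.
move=> B0 rp mT H; have ? : 0 != B by rewrite eq_sym -lt0n.
elim: w a => [|b w IH] a HS; first by apply: exec_le_loop0; rewrite st_hi1.
have eupd : upd (st_hi B (tree_bits (encode a)) (b :: w) [::] [::]) B w =
         st_hi B (tree_bits (encode a)) w [::] [::] by st_hi_eq.
case: b HS eupd => HS eupd.
  apply: (@exec_le_weak _ _ (T S + (size w * (T S + 2)).+1).+1); last by rewrite /=; nia.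
  apply: (exec_le_loop (b := true) (w := w)); first by rewrite st_hi1.
    rewrite eupd; apply: exec_st_hi rp.
    by apply: exec_le_weak (H a) _; apply: mT; exact: (HS 0).
  have -> : count id (true :: w) = (count id w).+1 by [].
  by rewrite iterSr; apply: IH => i le; rewrite -iterSr; exact: HS.
apply: (@exec_le_weak _ _ (1 + (size w * (T S + 2)).+1).+1); last by rewrite /=; nia.
apply: (exec_le_loop (b := false) (w := w)); first by rewrite st_hi1.
  by rewrite eupd; exact: exec_le_skip.
exact: IH.
Qed.

(** The code of any value can serve as counter, one round per node bit. The bound [S] on
    intermediate values is a hypothesis because a polynomial-time function may double its argument
    in every round. *)
Lemma Poly_iter_nodes X A C (EX : Enc X) (EA : Enc A) (EC : Enc C)
    (cnt : X -> C) (f : A -> A) (init : X -> A) (S : nat -> nat) :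
  Poly cnt -> Poly f -> Poly init -> poly_le S ->
  (forall x i, i <= nodes (encode (cnt x)) ->
     enc_size (iter i f (init x)) <= S (enc_size x)) ->
  Poly (fun x => iter (nodes (encode (cnt x))) f (init x)).
Proof.
move=> pc /Poly_mono[p [T [pT mT Hp]]] pi pS HS.
have [Uc [pUc _ HUc]] := Poly_size pc; have [Ui [pUi _ HUi]] := Poly_size pi.
have [r [V pV Hr]] := Poly_pair pc pi.
pose B := maxn 4 (regs p); have B4 : 3 < B by rewrite leq_max.
exists (Seq r (Seq split_tree (Seq (mv 3 0) (Seq (mv 2 B) (Loop B Skip p))))),
  (fun n => V n + (11 * Uc n + 11 * Ui n + 30 + Uc n * (T (S n) + 2))).
  by polyle; apply: poly_le_comp.
move=> x; apply: exec_le_seq (Hr x) _; apply: exec_le_weak.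
  apply: exec_le_seq (exec_split _) _ => /=.
  set u := tree_bits _; set v := tree_bits _.
  apply: (exec_le_seq (s1 := st4 v [::] (rev u) [::])).
    by apply: exec_mv => //; rewrite /= revK; st4_eq; rewrite cats0.
  apply: (exec_le_seq (s1 := st_hi B v u [::] [::])).
    apply: exec_mv; first by rewrite ltn_eqF // ltnW.
    rewrite /= (_ : st4 _ _ _ _ B = [::]); last by case: (B) B4 => [|[|[|[]]]].
    rewrite revK cats0; apply: functional_extensionality => i.
    rewrite /st_hi /frame /input_store /upd.
    case: (eqVneq i B) => [->|/eqP iB]; first by rewrite ltnn.
    by case: i iB => [|[|[|[|i]]]] iB //=; repeat (case: ifP => //= ?); lia.
  have B0 : 0 < B by exact: leq_trans B4.
  rewrite [enc_store (iter _ _ _)](input_store_st_hi _ B0).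
  apply: (exec_iter (S := S (enc_size x)) B0 _ mT Hp); last by move=> i le; exact: HS.
  by rewrite leq_max leqnn orbT.
rewrite /= !size_rev size_cat; have l1 := HUc x; have l2 := HUi x.
have : enc_size (cnt x) * (T (S (enc_size x)) + 2) <= Uc (enc_size x) * (T (S (enc_size x)) + 2).
  by rewrite leq_mul2r l1 orbT.
move: l1 l2; rewrite /enc_size.
by move: (Uc _ * _) (size (tree_bits (encode (cnt x))) * _) => a b; lia.
Qed.

(** * Conversion between bit strings and their tree codes *)

Definition encode_bits_prog : prog :=
  Seq (mv 0 1) (Seq (Push 0 false)
    (Loop 1 (push_all 0 [:: true; false]) (push_all 0 [:: true; true; false; false]))).

Lemma exec_encode_bits (w : seq bool) :
  exec_le encode_bits_prog (input_store w) (15 * size w + 5) (enc_store w).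
Proof.
rewrite /enc_store !input_store_st4.
have loop v u : exec_le
    (Loop 1 (push_all 0 [:: true; false]) (push_all 0 [:: true; true; false; false]))
    (st4 (tree_bits (encode u)) v [::] [::]) (12 * size v + 1)
    (st4 (tree_bits (encode (rev v ++ u))) [::] [::] [::]).
  elim: v u => [|b v IH] u; first exact: exec_le_loop0.
  apply: (@exec_le_weak _ _ (9 + (12 * size v + 1)).+1); last by rewrite /=; lia.
  apply: (exec_le_loop (b := b) (w := v) (s1 := st4 (tree_bits (encode (b :: u))) v [::] [::])).
  - by [].
  - case: b.
      by apply: (@exec_push_all 0 [:: true; true; false; false]); st4_eq.
    apply: (@exec_le_weak _ _ 5) => //.
    by apply: (@exec_push_all 0 [:: true; false]); st4_eq.
  - by rewrite rev_cons cat_rcons; exact: IH.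
apply: exec_le_weak.
  apply: (exec_le_seq (s1 := st4 [::] (rev w) [::] [::])).
    by apply: exec_mv => //; st4_eq; rewrite cats0.
  apply: (exec_le_seq (s1 := st4 [:: false] (rev w) [::] [::]) (T := 2)).
    by apply: exec_le_push; st4_eq.
  by have := loop (rev w) [::]; rewrite revK cats0; exact.
by rewrite /= size_rev; lia.
Qed.

Definition decode_bits_body : prog :=
  Case 0 Skip Skip (Case 0 Skip (Push 1 false)
    (Case 0 Skip (Case 0 Skip (Push 1 true) Skip) Skip)).

(** Register 2 holds a copy of the code as fuel for the loop, since an item takes several bits of
    register 0. The copy is longer than the list; the surplus rounds find register 0 empty and do
    nothing. *)
Definition decode_bits_prog : prog :=
  Seq (mv 0 1) (Seq (mv2 1 0 2) (Seq (Loop 2 decode_bits_body decode_bits_body) (mv 1 0))).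

Lemma size_enc_bits (w : seq bool) : 2 * size w + 1 <= enc_size w <= 4 * size w + 1.
Proof.
elim: w => //= b w; rewrite sz_cons; have := sz_bool b; sz_pos b.
by lia.
Qed.

Lemma exec_decode_bits (w : seq bool) :
  exec_le decode_bits_prog (enc_store w) (25 * enc_size w + 10) (input_store w).
Proof.
rewrite /enc_store !input_store_st4.
have stop v u : exec_le (Loop 2 decode_bits_body decode_bits_body)
    (st4 [::] u v [::]) (3 * size v + 1) (st4 [::] u [::] [::]).
  elim: v => [|b v IH]; first exact: exec_le_loop0.
  apply: (@exec_le_weak _ _ (2 + (3 * size v + 1)).+1); last by rewrite /=; lia.
  apply: (exec_le_loop (b := b) (w := v) (s1 := st4 [::] u v [::])) => //.
  rewrite if_same; apply: exec_le_case0 => //.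
  by rewrite (_ : upd _ _ _ = st4 [::] u v [::]); [exact: exec_le_skip | st4_eq].
have loop v u l : size l < size v -> exec_le (Loop 2 decode_bits_body decode_bits_body)
    (st4 (tree_bits (encode l)) u v [::]) (10 * size v + 1) (st4 [::] (rev l ++ u) [::] [::]).
  elim: l v u => [|b l IH] [|c v] u //= lt.
    apply: (@exec_le_weak _ _ (2 + (3 * size v + 1)).+1); last by lia.
    apply: (exec_le_loop (b := c) (w := v) (s1 := st4 [::] u v [::])) => //.
    rewrite if_same; apply: (exec_le_case (b := false) (w := [::])) => //.
    by rewrite (_ : upd _ _ _ = st4 [::] u v [::]); [exact: exec_le_skip | st4_eq].
  apply: (@exec_le_weak _ _ (6 + (10 * size v + 1)).+1); last by lia.
  apply: (exec_le_loop (b := c) (w := v) (s1 := st4 (tree_bits (encode l)) (b :: u) v [::])) => //.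
    rewrite if_same; case: b => /=.
      do 2!apply: (exec_le_case (b := true)) => //=.
      do 2!apply: (exec_le_case (b := false)) => //=.
      by apply: exec_le_push; st4_eq.
    apply: (@exec_le_weak _ _ 4) => //.
    apply: (exec_le_case (b := true)) => //=; apply: (exec_le_case (b := false)) => //=.
    by apply: exec_le_push; st4_eq.
  by rewrite rev_cons cat_rcons; exact: IH.
have /andP[l1 _] := size_enc_bits w.
apply: exec_le_weak.
  apply: (exec_le_seq (s1 := st4 [::] (rev (tree_bits (encode w))) [::] [::])).
    by apply: exec_mv => //; st4_eq; rewrite cats0.
  apply: (exec_le_seq (s1 := st4 (tree_bits (encode w)) [::] (tree_bits (encode w)) [::])).
    by apply: exec_mv2 => //; rewrite /= revK; st4_eq; rewrite cats0.
  apply: (exec_le_seq (s1 := st4 [::] (rev w) [::] [::])).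
    have := @loop (tree_bits (encode w)) [::] w; rewrite cats0; apply.
    by move: l1; rewrite /enc_size; lia.
  by apply: exec_mv => //; rewrite /= revK; st4_eq; rewrite cats0.
by move: l1; rewrite /enc_size /= !size_rev; lia.
Qed.

(** [A] and [B] carry no tree code here: all work is done by a total function on bit strings that
    agrees with [f] on the encoded elements of [D]. The bound [4 * n + 1] in the time estimate is
    the length of a bit string written as a tree. *)
Lemma Poly_polytime (A B : Type) (encA : A -> seq bool) (encB : B -> seq bool)
    (D : A -> Prop) (f : A -> B) (F : seq bool -> seq bool) :
  Poly F -> (forall a, D a -> F (encA a) = encB (f a)) -> polytime encA encB D f.
Proof.
move=> pF HF; have [S [pS mS HS]] := Poly_size pF.
have [p [T [pT mT Hp]]] := Poly_mono pF.
have [c [k Hck]] : poly_le (fun n => (15 * n + 5) + (T (4 * n + 1) + (25 * S (4 * n + 1) + 10))).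
  by polyle; apply: poly_le_comp => //; polyle.
apply: (@exec_polytime _ _ _ _ _ _ (Seq encode_bits_prog (Seq p decode_bits_prog)) c k) => a Da.
have [t le ex] : exec_le (Seq encode_bits_prog (Seq p decode_bits_prog))
    (input_store (encA a)) (c * size (encA a) ^ k + c) (input_store (encB (f a))).
  apply: exec_le_weak (Hck _); rewrite -HF //.
  have /andP[_ l2] := size_enc_bits (encA a).
  apply: exec_le_seq (exec_encode_bits _) _; apply: exec_le_seq.
    exact: exec_le_weak (Hp _) (mT _ _ l2).
  apply: exec_le_weak (exec_decode_bits _) _.
  by rewrite leq_add2r leq_mul2l /=; exact: leq_trans (HS _) (mS _ _ l2).
by exists t => //; exists (input_store (encB (f a))).
Qed.

(** * A library of polynomial-time functions *)

Section Basic.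

Context {X : Type} {EX : Enc X}.

Lemma Poly_tree A B (EA : Enc A) (EB : Enc B) (g : tree -> tree) (f : X -> A) (h : X -> B) :
  Poly g -> (forall x, encode (h x) = g (encode (f x))) -> Poly f -> Poly h.
Proof.
move=> pg e pf.
have pt : Poly (fun x => encode (f x)) by exact: (Poly_encode (f := f)).
by apply: (Poly_encode (f := fun x => g (encode (f x)))) (Poly_comp pt pg).
Qed.

Lemma Poly_fst A B (EA : Enc A) (EB : Enc B) (f : X -> A * B) :
  Poly f -> Poly (fun x => (f x).1).
Proof. exact: (Poly_tree Poly_tfst). Qed.

Lemma Poly_snd A B (EA : Enc A) (EB : Enc B) (f : X -> A * B) :
  Poly f -> Poly (fun x => (f x).2).
Proof. exact: (Poly_tree Poly_tsnd). Qed.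

Lemma Poly_app2 A B C (EA : Enc A) (EB : Enc B) (EC : Enc C) (F : A -> B -> C)
    (f : X -> A) (g : X -> B) :
  Poly (fun p : A * B => F p.1 p.2) -> Poly f -> Poly g -> Poly (fun x => F (f x) (g x)).
Proof. by move=> pF pf pg; exact: (Poly_comp (Poly_pair pf pg) pF). Qed.

Lemma Poly_app3 A B C D (EA : Enc A) (EB : Enc B) (EC : Enc C) (ED : Enc D)
    (F : A -> B -> C -> D) (f : X -> A) (g : X -> B) (h : X -> C) :
  Poly (fun p : A * (B * C) => F p.1 p.2.1 p.2.2) -> Poly f -> Poly g -> Poly h ->
  Poly (fun x => F (f x) (g x) (h x)).
Proof. by move=> pF pf pg ph; exact: (Poly_comp (Poly_pair pf (Poly_pair pg ph)) pF). Qed.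

Lemma Poly_cons A (EA : Enc A) (f : X -> A) (g : X -> seq A) :
  Poly f -> Poly g -> Poly (fun x => f x :: g x).
Proof. by move=> pf pg; exact: (Poly_encode _ (Poly_pair pf pg)). Qed.

Lemma Poly_behead A (EA : Enc A) (f : X -> seq A) : Poly f -> Poly (fun x => behead (f x)).
Proof. by apply: (Poly_tree Poly_tsnd) => x; case: (f x). Qed.

Lemma Poly_negb (c : X -> bool) : Poly c -> Poly (fun x => ~~ c x).
Proof.
move=> pc; apply: (Poly_ext (f := fun x => if c x then false else true)) => [x|].
  by case: (c x).
by apply: Poly_if => //; exact: Poly_const.
Qed.

Lemma Poly_andb (c d : X -> bool) : Poly c -> Poly d -> Poly (fun x => c x && d x).
Proof. by move=> pc pd; apply: Poly_if => //; exact: Poly_const. Qed.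

Lemma Poly_orb (c d : X -> bool) : Poly c -> Poly d -> Poly (fun x => c x || d x).
Proof. by move=> pc pd; apply: Poly_if => //; exact: Poly_const. Qed.

Lemma Poly_eqb (c d : X -> bool) : Poly c -> Poly d -> Poly (fun x => c x == d x).
Proof.
move=> pc pd; apply: (Poly_ext (f := fun x => if c x then d x else ~~ d x)) => [x|].
  by case: (c x); case: (d x).
by apply: Poly_if => //; exact: Poly_negb.
Qed.

Lemma Poly_bool B (EB : Enc B) (c : X -> bool) (f : bool -> X -> B) :
  Poly c -> Poly (f true) -> Poly (f false) -> Poly (fun x => f (c x) x).
Proof.
move=> pc pt pf; apply: (Poly_ext (f := fun x => if c x then f true x else f false x)).
  by move=> x; case: (c x).
exact: Poly_if.
Qed.

Lemma Poly_is_nil A (EA : Enc A) (f : X -> seq A) : Poly f -> Poly (fun x => nilp (f x)).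
Proof.
move=> pf.
have pt : Poly (fun x => is_node (encode (f x))).
  by apply: (Poly_comp _ Poly_is_node); exact: (Poly_encode (f := f)).
by apply: (Poly_ext _ (Poly_negb pt)) => x; case: (f x).
Qed.

Lemma Poly_head A (EA : Enc A) (d : A) (f : X -> seq A) :
  Poly f -> Poly (fun x => head d (f x)).
Proof.
move=> pf.
apply: (Poly_encode (f := fun x => if nilp (f x) then encode d else tfst (encode (f x)))).
  by move=> x; case: (f x).
apply: Poly_if; [exact: Poly_is_nil | exact: Poly_const |].
by apply: (Poly_comp _ Poly_tfst); exact: (Poly_encode (f := f)).
Qed.

Lemma Poly_succ (f : X -> nat) : Poly f -> Poly (fun x => (f x).+1).
Proof.
move=> pf; exact: (Poly_encode _ (Poly_pair (Poly_const _ _ Leaf) pf)).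
Qed.

Lemma Poly_predn (f : X -> nat) : Poly f -> Poly (fun x => (f x).-1).
Proof. by apply: (Poly_tree Poly_tsnd) => x; case: (f x). Qed.

Lemma Poly_eq0 (f : X -> nat) : Poly f -> Poly (fun x => f x == 0).
Proof.
move=> pf.
have pt : Poly (fun x => is_node (encode (f x))).
  by apply: (Poly_comp _ Poly_is_node); exact: (Poly_encode (f := f)).
by apply: (Poly_ext _ (Poly_negb pt)) => x; case: (f x).
Qed.

End Basic.

Lemma nodes_nat (n : nat) : nodes (encode n) = n.
Proof. by rewrite /nodes /=; elim: n => //= n ->. Qed.

Lemma nodes_list A (EA : Enc A) (l : seq A) : size l <= nodes (encode l).
Proof.
rewrite /nodes; elim: l => //= a l IH; rewrite count_cat.
by rewrite (leq_ltn_trans IH) // ltnS leq_addl.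
Qed.

Lemma sz_cat A (EA : Enc A) (l1 l2 : seq A) :
  enc_size (l1 ++ l2) = enc_size l1 + enc_size l2 - 1.
Proof.
elim: l1 => [|a l1 IH] /=; first by rewrite sz_nil; lia.
by rewrite !sz_cons IH; sz_pos l1; sz_pos l2; lia.
Qed.

Lemma sz_drop A (EA : Enc A) (l : seq A) i : enc_size (drop i l) <= enc_size l.
Proof.
elim: l i => [|a l IH] [|i] //=; rewrite sz_cons; move: (IH i); lia.
Qed.

Lemma sz_mem (A : Type) (EA : Enc A) (l1 l2 : seq A) a :
  enc_size a < enc_size (l1 ++ a :: l2).
Proof.
rewrite sz_cat sz_cons; sz_pos l1; sz_pos l2; lia.
Qed.

Lemma size_le_sz A (EA : Enc A) (l : seq A) : size l < enc_size l.
Proof. by elim: l => //= a l IH; rewrite sz_cons; lia. Qed.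

Lemma sz_rev A (EA : Enc A) (l : seq A) : enc_size (rev l) = enc_size l.
Proof.
elim: l => //= a l IH; rewrite rev_cons -cats1 sz_cat !sz_cons sz_nil IH.
by sz_pos l; lia.
Qed.

Section Iteration.

Context {X : Type} {EX : Enc X}.

Lemma Poly_iter S (ES : Enc S) (n : X -> nat) (F : X -> S -> S) (init : X -> S) (B : nat -> nat) :
  Poly n -> Poly (fun p : X * S => F p.1 p.2) -> Poly init -> poly_le B ->
  (forall x i, i <= n x -> enc_size (iter i (F x) (init x)) <= B (enc_size x)) ->
  Poly (fun x => iter (n x) (F x) (init x)).
Proof.
move=> pn pF pi pB HB; pose f (p : X * S) := (p.1, F p.1 p.2).
have iterE i x : iter i f (x, init x) = (x, iter i (F x) (init x)).
  by elim: i => //= i ->.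
apply: (Poly_ext (f := fun x => (iter (nodes (encode (n x))) f (x, init x)).2)).
  by move=> x; rewrite nodes_nat iterE.
apply: Poly_snd; apply: (Poly_iter_nodes (S := fun n => (n + B n).+1)) => //.
- by apply: Poly_pair => //; apply: Poly_fst; exact: Poly_id.
- by apply: Poly_pair => //; exact: Poly_id.
- by apply: (@poly_le_trans _ (fun n => n + B n + 1)); [move=> m; lia | polyle].
move=> x i; rewrite nodes_nat iterE sz_pair => /HB.
by have := HB x i; lia.
Qed.

(** The code of the list drives the loop and gives at least as many rounds as the list has items;
    once the list is exhausted the rounds are idle. Intermediate values are folds over prefixes,
    hence the form of the size bound. *)
Lemma Poly_foldl S A (ES : Enc S) (EA : Enc A) (l : X -> seq A)
    (F : X -> S -> A -> S) (init : X -> S) (B : nat -> nat) :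
  Poly (fun p : X * (S * A) => F p.1 p.2.1 p.2.2) -> Poly init -> Poly l -> poly_le B ->
  (forall x l1 l2, l x = l1 ++ l2 ->
     enc_size (foldl (F x) (init x) l1) <= B (enc_size x)) ->
  Poly (fun x => foldl (F x) (init x) (l x)).
Proof.
move=> pF pi pl pB HB; have [U [pU _ HU]] := Poly_size pl.
pose f (p : X * (seq A * S)) :=
  if nilp p.2.1 then p else (p.1, (behead p.2.1, F p.1 p.2.2 (head (@dflt A EA) p.2.1))).
have iterE i x : iter i f (x, (l x, init x)) =
    (x, (drop i (l x), foldl (F x) (init x) (take i (l x)))).
  elim: i => [|i IH] /=; first by rewrite drop0 take0.
  rewrite IH /f /=; case: (ltnP i (size (l x))) => [lt|le].
    rewrite (drop_nth (@dflt A EA) lt) /= (take_nth (@dflt A EA) lt) foldl_rcons.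
    by [].
  by rewrite !drop_oversize ?take_oversize //; exact: leqW.
apply: (Poly_ext (f := fun x => (iter (nodes (encode (l x))) f (x, (l x, init x))).2.2)).
  by move=> x; rewrite iterE /= take_oversize // nodes_list.
do 2!apply: Poly_snd.
apply: (Poly_iter_nodes (S := fun n => (n + (U n + B n).+1).+1)) => //.
- have p1 : Poly (fun p : X * (seq A * S) => p.2.1).
    by apply: Poly_fst; apply: Poly_snd; exact: Poly_id.
  apply: Poly_if; [exact: Poly_is_nil | exact: Poly_id |].
  apply: Poly_pair; first by apply: Poly_fst; exact: Poly_id.
  apply: Poly_pair; first exact: Poly_behead.
  apply: (Poly_app3 pF); [|  | exact: Poly_head].
    by apply: Poly_fst; exact: Poly_id.
  by do 2!apply: Poly_snd; exact: Poly_id.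
- by apply: Poly_pair; [exact: Poly_id | exact: Poly_pair].
- by apply: (@poly_le_trans _ (fun n => n + U n + B n + 2)); [move=> m; lia | polyle].
move=> x i _; rewrite iterE !sz_pair.
have := HB x (take i (l x)) (drop i (l x)); rewrite cat_take_drop => /(_ erefl).
by have := sz_drop EA (l x) i; have := HU x; lia.
Qed.

Lemma Poly_catrev A (EA : Enc A) (f g : X -> seq A) :
  Poly f -> Poly g -> Poly (fun x => catrev (f x) (g x)).
Proof.
move=> pf pg; have [U [pU _ HU]] := Poly_size pf; have [V [pV _ HV]] := Poly_size pg.
have foldlE (s t : seq A) : foldl (fun acc a => a :: acc) t s = catrev s t.
  by elim: s t => //= a s IH t.
apply: (Poly_ext (f := fun x => foldl (fun acc a => a :: acc) (g x) (f x))) => //.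
apply: (Poly_foldl (B := fun n => U n + V n)) => //; last 2 first.
- by polyle.
- move=> x l1 l2 e; rewrite foldlE catrevE sz_cat sz_rev.
  have := HU x; rewrite e sz_cat; have := HV x.
  sz_pos l2; lia.
apply: Poly_cons; first by do 2!apply: Poly_snd; exact: Poly_id.
by apply: Poly_fst; apply: Poly_snd; exact: Poly_id.
Qed.

End Iteration.

Ltac poly_var := repeat first [exact: Poly_id | apply: Poly_fst | apply: Poly_snd].

Lemma Poly_on_fst X (EX : Enc X) A B (EA : Enc A) (EB : Enc B) (f : X -> B) :
  Poly f -> Poly (fun p : X * A => f p.1).
Proof. by move=> pf; apply: (@Poly_comp _ _ _ _ _ _ fst f) => //; poly_var. Qed.

Arguments Poly_on_fst {X EX A B EA EB f}.

Ltac poly_hyp := match goal with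
  | H : @Poly ?A ?B ?EA ?EB ?f |- @Poly ?X _ ?EX _ (fun x => ?f (@?g x)) =>
      refine (@Poly_comp X A B EX EA EB g f _ H)
  | H : @Poly _ _ _ _ (fun p => ?F p.1 p.2) |- @Poly _ _ _ _ (fun x => ?F (@?f x) (@?g x)) =>
      refine (@Poly_app2 _ _ _ _ _ _ _ _ F f g H _ _)
  end.

Lemma map_const_nseq A B (b : B) (s : seq A) : [seq b | _ <- s] = nseq (size s) b.
Proof. by elim: s => //= a s ->. Qed.

Lemma Poly_rev X (EX : Enc X) A (EA : Enc A) (f : X -> seq A) : Poly f -> Poly (fun x => rev (f x)).
Proof. by move=> pf; apply: Poly_catrev => //; exact: Poly_const. Qed.

Lemma Poly_cat X (EX : Enc X) A (EA : Enc A) (f g : X -> seq A) :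
  Poly f -> Poly g -> Poly (fun x => f x ++ g x).
Proof.
move=> pf pg; apply: (Poly_ext (f := fun x => catrev (rev (f x)) (g x))) => [x|].
  by rewrite catrevE revK.
by apply: Poly_catrev => //; exact: Poly_rev.
Qed.

Lemma Poly_length X (EX : Enc X) A (EA : Enc A) (f : X -> seq A) : Poly f -> Poly (fun x => size (f x)).
Proof.
move=> pf; have [U [pU _ HU]] := Poly_size pf.
have foldlE (s : seq A) n : foldl (fun (m : nat) (_ : A) => m.+1) n s = size s + n.
  by elim: s n => //= a s IH n; rewrite IH addSnnS.
apply: (Poly_ext (f := fun x => foldl (fun (m : nat) (_ : A) => m.+1) 0 (f x))) => [x|].
  by rewrite foldlE addn0.
apply: (Poly_foldl (F := fun (_ : X) m _ => m.+1) (B := fun n => 2 * U n + 1)) => //.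
- by apply: Poly_succ; poly_var.
- exact: Poly_const.
- by polyle.
move=> x l1 l2 e; rewrite foldlE addn0 sz_nat.
have := HU x; have := size_le_sz EA (f x); rewrite {1}e size_cat; lia.
Qed.

Lemma Poly_addn X (EX : Enc X) (f g : X -> nat) : Poly f -> Poly g -> Poly (fun x => f x + g x).
Proof.
move=> pf pg; have [U [pU _ HU]] := Poly_size pf; have [V [pV _ HV]] := Poly_size pg.
apply: (Poly_ext (f := fun x => iter (f x) S (g x))) => [x|].
  by elim: (f x) => //= n ->.
apply: (Poly_iter (F := fun (_ : X) => S) (B := fun n => U n + V n)) => //.
- by apply: Poly_succ; poly_var.
- by polyle.
move=> x i le; rewrite iter_succn sz_nat; move: (HU x) (HV x); rewrite !sz_nat; lia.
Qed.

Lemma Poly_subn X (EX : Enc X) (f g : X -> nat) : Poly f -> Poly g -> Poly (fun x => f x - g x).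
Proof.
move=> pf pg; have [U [pU _ HU]] := Poly_size pf.
apply: (Poly_ext (f := fun x => iter (g x) predn (f x))) => [x|].
  by rewrite iter_predn.
apply: (Poly_iter (F := fun (_ : X) => predn) (B := U)) => //.
- by apply: Poly_predn; poly_var.
move=> x i le; rewrite iter_predn sz_nat; move: (HU x); rewrite !sz_nat; lia.
Qed.

Lemma Poly_leq X (EX : Enc X) (f g : X -> nat) : Poly f -> Poly g -> Poly (fun x => f x <= g x).
Proof. by move=> pf pg; apply: Poly_eq0; exact: Poly_subn. Qed.

Lemma Poly_eqn X (EX : Enc X) (f g : X -> nat) : Poly f -> Poly g -> Poly (fun x => f x == g x).
Proof.
move=> pf pg; apply: (Poly_ext (f := fun x => (f x <= g x) && (g x <= f x))) => [x|].
  by rewrite eqn_leq.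
by apply: Poly_andb; exact: Poly_leq.
Qed.

Lemma Poly_maxn X (EX : Enc X) (f g : X -> nat) : Poly f -> Poly g -> Poly (fun x => maxn (f x) (g x)).
Proof. by move=> pf pg; apply: Poly_if => //; apply: Poly_leq => //; exact: Poly_succ. Qed.

Lemma Poly_minn X (EX : Enc X) (f g : X -> nat) : Poly f -> Poly g -> Poly (fun x => minn (f x) (g x)).
Proof. by move=> pf pg; apply: Poly_if => //; apply: Poly_leq => //; exact: Poly_succ. Qed.

Lemma Poly_drop X (EX : Enc X) A (EA : Enc A) (n : X -> nat) (f : X -> seq A) :
  Poly n -> Poly f -> Poly (fun x => drop (n x) (f x)).
Proof.
move=> pn pf; have [U [pU _ HU]] := Poly_size pf.
have iterE (l : seq A) i : iter i behead l = drop i l.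
  by elim: i => [|i IH]; rewrite ?drop0 //= IH -drop1 drop_drop add1n.
apply: (Poly_ext (f := fun x => iter (n x) behead (f x))) => [x|]; first exact: iterE.
apply: (Poly_iter (F := fun (_ : X) => behead) (B := U)) => //.
- by apply: Poly_behead; poly_var.
by move=> x i le; rewrite iterE; exact: leq_trans (sz_drop _ _ _) (HU x).
Qed.

Lemma Poly_nth X (EX : Enc X) A (EA : Enc A) (d : A) (f : X -> seq A) (n : X -> nat) :
  Poly f -> Poly n -> Poly (fun x => nth d (f x) (n x)).
Proof.
move=> pf pn; apply: (Poly_ext (f := fun x => head d (drop (n x) (f x)))) => [x|].
  by rewrite -nth0 nth_drop addn0.
by apply: Poly_head; exact: Poly_drop.
Qed.

Lemma Poly_take X (EX : Enc X) A (EA : Enc A) (n : X -> nat) (f : X -> seq A) :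
  Poly n -> Poly f -> Poly (fun x => take (n x) (f x)).
Proof.
move=> pn pf.
apply: (Poly_ext (f := fun x => rev (drop (size (f x) - n x) (rev (f x))))) => [x|].
  rewrite drop_rev revK; case: (leqP (n x) (size (f x))) => le; first by rewrite subKn.
  by rewrite (eqP (ltnW le : size (f x) - n x == 0)) subn0 !take_oversize // ltnW.
by apply: Poly_rev; apply: Poly_drop; [apply: Poly_subn => //; exact: Poly_length | exact: Poly_rev].
Qed.

Lemma Poly_map X (EX : Enc X) A B (EA : Enc A) (EB : Enc B) (l : X -> seq A) (F : X -> A -> B) :
  Poly (fun p : X * A => F p.1 p.2) -> Poly l -> Poly (fun x => [seq F x a | a <- l x]).
Proof.
move=> pF pl; have [U [pU mU HU]] := Poly_size pl; have [V [pV mV HV]] := Poly_size pF.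
have foldlE x s t : foldl (fun acc a => F x a :: acc) t s = rev [seq F x a | a <- s] ++ t.
  by elim: s t => //= a s IH t; rewrite IH rev_cons cat_rcons.
apply: (Poly_ext (f := fun x => rev (foldl (fun acc a => F x a :: acc) [::] (l x)))) => [x|].
  by rewrite foldlE cats0 revK.
apply: Poly_rev.
apply: (Poly_foldl (F := fun x acc a => F x a :: acc)
          (B := fun n => U n * (V (n + U n) + 1) + 1)) => //.
- apply: Poly_cons; last by poly_var.
  by apply: (Poly_app2 pF); poly_var.
- exact: Poly_const.
- by polyle; apply: poly_le_comp => //; polyle.
move=> x l1 l2 e; rewrite foldlE cats0 sz_rev.
have le a s1 s2 : l x = s1 ++ a :: s2 -> enc_size (F x a) <= V (enc_size x + U (enc_size x)).
  move=> es; apply: leq_trans (HV (x, a)) _; apply: mV; rewrite sz_pair.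
  by have := HU x; have := sz_mem EA s1 s2 a; rewrite -es; lia.
set v := V _ in le *.
have {}le : forall s, l x = s ++ l1 ++ l2 -> enc_size [seq F x a | a <- l1] <= size l1 * (v + 1) + 1.
  elim: l1 {e} => [|a l1 IH] s e; first by rewrite sz_nil.
  rewrite /= sz_cons; have := le a s (l1 ++ l2) e.
  by have := IH (rcons s a); rewrite cat_rcons => /(_ e); lia.
apply: leq_trans (le [::] e) _; rewrite leq_add2r leq_mul2r; apply/orP; right.
by have := HU x; have := size_le_sz EA (l x); rewrite {1}e size_cat; lia.
Qed.

Lemma Poly_flatten X (EX : Enc X) A (EA : Enc A) (f : X -> seq (seq A)) :
  Poly f -> Poly (fun x => flatten (f x)).
Proof.
move=> pf; have [U [pU mU HU]] := Poly_size pf.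
have foldlE (s : seq (seq A)) t : foldl (fun acc a => acc ++ a) t s = t ++ flatten s.
  by elim: s t => [|a s IH] t /=; rewrite ?cats0 // IH catA.
apply: (Poly_ext (f := fun x => foldl (fun acc a => acc ++ a) [::] (f x))) => [x|].
  by rewrite foldlE.
apply: (Poly_foldl (F := fun (_ : X) acc a => acc ++ a) (B := U)) => //.
- by cbv beta; apply: Poly_cat; poly_var.
- exact: Poly_const.
move=> x l1 l2 e; rewrite foldlE; apply: leq_trans (HU x); rewrite e.
have le (s : seq (seq A)) : enc_size (flatten s) <= enc_size s.
  elim: s => //= a s IH; rewrite sz_cat sz_cons; lia.
by rewrite cat0s sz_cat; apply: leq_trans (le _) _; sz_pos l2; lia.
Qed.

Lemma Poly_muln X (EX : Enc X) (f g : X -> nat) : Poly f -> Poly g -> Poly (fun x => f x * g x).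
Proof.
move=> pf pg.
apply: (Poly_ext (f := fun x => size (flatten [seq iter (g x) (fun l => false :: l) [::]
  | _ <- iter (f x) (fun l => false :: l) [::] ]))).
  have sz (n : nat) : size (iter n (fun l => false :: l) [::]) = n by elim: n => //= n ->.
  move=> x; rewrite size_flatten /shape -map_comp.
  rewrite (eq_map (_ : _ =1 (fun=> g x))) => [|b]; last exact: sz.
  by rewrite map_const_nseq sz sumn_nseq mulnC.
have pn (h : X -> nat) : Poly h -> Poly (fun x => iter (h x) (fun l => false :: l) [::]).
  move=> ph; have [U [pU mU HU]] := Poly_size ph.
  apply: (Poly_iter (F := fun (_ : X) l => false :: l) (B := U)) => //.
  - by apply: Poly_cons; [exact: Poly_const | poly_var].
  - exact: Poly_const.
  move=> x i le; apply: leq_trans (HU x); rewrite sz_nat.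
  have -> : enc_size (iter i (fun l => false :: l) [::]) = (2 * i).+1.
    elim: (i) => // j IH; rewrite iterS sz_cons IH /enc_size /=; lia.
  by lia.
apply: Poly_length; apply: Poly_flatten.
apply: (Poly_map (F := fun x (_ : bool) => iter (g x) (fun l => false :: l) [::])); last exact: pn.
by apply: (Poly_on_fst (f := fun x => iter (g x) _ _)); exact: pn.
Qed.

Lemma Poly_expn X (EX : Enc X) (f : X -> nat) k : Poly f -> Poly (fun x => f x ^ k).
Proof.
move=> pf; elim: k => [|k IH]; first exact: Poly_const.
apply: (Poly_ext (f := fun x => f x * f x ^ k)) => [x|]; first by rewrite expnS.
exact: Poly_muln.
Qed.

Lemma Poly_iota0 X (EX : Enc X) (f : X -> nat) : Poly f -> Poly (fun x => iota 0 (f x)).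
Proof.
move=> pf; have [U [pU mU HU]] := Poly_size pf.
have iterE n : iter n (fun l => size l :: l) [::] = rev (iota 0 n).
  by elim: n => // n IH; rewrite iterS IH size_rev size_iota -[n.+1]addn1 iotaD rev_cat.
apply: (Poly_ext (f := fun x => rev (iter (f x) (fun l => size l :: l) [::]))) => [x|].
  by rewrite iterE revK.
apply: Poly_rev.
apply: (Poly_iter (F := fun (_ : X) l => size l :: l) (B := fun n => U n * (U n * 2 + 2) + 1)) => //.
- by apply: Poly_cons; [apply: Poly_length|]; poly_var.
- exact: Poly_const.
- by polyle.
move=> x i le; have := HU x; rewrite sz_nat => le2.
have : enc_size (iter i (fun l => size l :: l) [::]) <= i * (2 * i + 2) + 1.
  elim: (i) => // j IH; rewrite iterS sz_cons {1}iterE size_rev size_iota sz_nat.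
  by move: IH; nia.
move=> /leq_trans; apply; rewrite leq_add2r; apply: leq_mul; lia.
Qed.

Lemma Poly_iota X (EX : Enc X) (f g : X -> nat) : Poly f -> Poly g -> Poly (fun x => iota (f x) (g x)).
Proof.
move=> pf pg; apply: (Poly_ext (f := fun x => [seq f x + i | i <- iota 0 (g x)])) => [x|].
  by rewrite -iotaDl addn0.
apply: (Poly_map (F := fun x i => f x + i)); last exact: Poly_iota0.
apply: Poly_addn; last by poly_var.
exact: Poly_on_fst.
Qed.

Lemma Poly_nseq X (EX : Enc X) A (EA : Enc A) (n : X -> nat) (f : X -> A) :
  Poly n -> Poly f -> Poly (fun x => nseq (n x) (f x)).
Proof.
move=> pn pf; apply: (Poly_ext (f := fun x => [seq f x | _ <- iota 0 (n x)])) => [x|].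
  by rewrite map_const_nseq size_iota.
apply: (Poly_map (F := fun x (_ : nat) => f x)); last exact: Poly_iota0.
exact: Poly_on_fst.
Qed.

Lemma Poly_filter X (EX : Enc X) A (EA : Enc A) (l : X -> seq A) (P : X -> A -> bool) :
  Poly (fun p : X * A => P p.1 p.2) -> Poly l -> Poly (fun x => [seq a <- l x | P x a]).
Proof.
move=> pP pl.
apply: (Poly_ext (f := fun x => flatten [seq if P x a then [:: a] else [::] | a <- l x])) => [x|].
  by elim: (l x) => //= a s ->; case: ifP.
apply: Poly_flatten; apply: (Poly_map (F := fun x a => if P x a then [:: a] else [::])) => //.
apply: Poly_if => //; last exact: Poly_const.
by apply: Poly_cons; [poly_var | exact: Poly_const].
Qed.

Lemma Poly_all X (EX : Enc X) A (EA : Enc A) (l : X -> seq A) (P : X -> A -> bool) :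
  Poly (fun p : X * A => P p.1 p.2) -> Poly l -> Poly (fun x => all (P x) (l x)).
Proof.
move=> pP pl.
apply: (Poly_ext (f := fun x => nilp [seq a <- l x | ~~ P x a])) => [x|].
  by elim: (l x) => //= a s <-; case: (P x a).
apply: Poly_is_nil; apply: (Poly_filter (P := fun x a => ~~ P x a)) => //.
exact: Poly_negb.
Qed.

Lemma Poly_has X (EX : Enc X) A (EA : Enc A) (l : X -> seq A) (P : X -> A -> bool) :
  Poly (fun p : X * A => P p.1 p.2) -> Poly l -> Poly (fun x => has (P x) (l x)).
Proof.
move=> pP pl.
apply: (Poly_ext (f := fun x => ~~ nilp [seq a <- l x | P x a])) => [x|].
  by elim: (l x) => //= a s <-; case: (P x a).
by apply: Poly_negb; apply: Poly_is_nil; exact: Poly_filter.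
Qed.

Lemma Poly_eq_bits X (EX : Enc X) (f g : X -> seq bool) : Poly f -> Poly g -> Poly (fun x => f x == g x).
Proof.
move=> pf pg; apply: (Poly_ext (f := fun x => (size (f x) == size (g x)) &&
  all (fun i => nth false (f x) i == nth false (g x) i) (iota 0 (size (f x))))) => [x|].
  apply/andP/eqP => [[/eqP e /allP H]|->]; last by rewrite eqxx; split=> //; apply/allP.
  by apply: (eq_from_nth (x0 := false)) => // i lt; apply/eqP; apply: H; rewrite mem_iota.
apply: Poly_andb; first by apply: Poly_eqn; exact: Poly_length.
apply: (Poly_all (P := fun x i => nth false (f x) i == nth false (g x) i)).
  by apply: Poly_eqb; apply: Poly_nth; try exact: Poly_on_fst; poly_var.
by apply: Poly_iota0; exact: Poly_length.
Qed.

(** The list is fixed and the function varies with its items, so the program contains separate code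
    for every item. *)
Lemma Poly_map_seq X (EX : Enc X) A B (EB : Enc B) (s : seq A) (F : A -> X -> B) :
  (forall a, Poly (F a)) -> Poly (fun x => [seq F a x | a <- s]).
Proof.
by move=> pF; elim: s => [|a s IH] /=; [exact: Poly_const | exact: Poly_cons].
Qed.

Ltac poly_step := first [ assumption | lazymatch goal with
  | |- @Poly _ _ _ _ (fun x => x) => exact: Poly_id
  | |- @Poly _ _ _ _ (fun _ => ?c) => exact: Poly_const
  | |- @Poly _ _ _ _ (fun x => (@?f x, @?g x)) => apply: Poly_pair
  | |- @Poly _ _ _ _ (fun x => fst (@?f x)) => apply: Poly_fst
  | |- @Poly _ _ _ _ (fun x => snd (@?f x)) => apply: Poly_snd
  | |- @Poly _ _ _ _ (fun x => cons (@?f x) (@?g x)) => apply: Poly_cons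
  | |- @Poly _ _ _ _ (fun x => behead (@?f x)) => apply: Poly_behead
  | |- @Poly _ _ _ _ (fun x => head _ (@?f x)) => apply: Poly_head
  | |- @Poly _ _ _ _ (fun x => nth _ (@?f x) (@?g x)) => apply: Poly_nth
  | |- @Poly _ _ _ _ (fun x => drop (@?f x) (@?g x)) => apply: Poly_drop
  | |- @Poly _ _ _ _ (fun x => take (@?f x) (@?g x)) => apply: Poly_take
  | |- @Poly _ _ _ _ (fun x => rev (@?f x)) => apply: Poly_rev
  | |- @Poly _ _ _ _ (fun x => cat (@?f x) (@?g x)) => apply: Poly_cat
  | |- @Poly _ _ _ _ (fun x => size (@?f x)) => apply: Poly_length
  | |- @Poly _ _ _ _ (fun x => map (@?f x) (@?g x)) => apply: Poly_map
  | |- @Poly _ _ _ _ (fun x => flatten (@?f x)) => apply: Poly_flatten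
  | |- @Poly _ _ _ _ (fun x => filter (@?f x) (@?g x)) => apply: Poly_filter
  | |- @Poly _ _ _ _ (fun x => all (@?f x) (@?g x)) => apply: Poly_all
  | |- @Poly _ _ _ _ (fun x => has (@?f x) (@?g x)) => apply: Poly_has
  | |- @Poly _ _ _ _ (fun x => iota (@?f x) (@?g x)) => apply: Poly_iota
  | |- @Poly _ _ _ _ (fun x => nseq (@?f x) (@?g x)) => apply: Poly_nseq
  | |- @Poly _ _ _ _ (fun x => nilp (@?f x)) => apply: Poly_is_nil
  | |- @Poly _ _ _ _ (fun x => negb (@?f x)) => apply: Poly_negb
  | |- @Poly _ _ _ _ (fun x => andb (@?f x) (@?g x)) => apply: Poly_andb
  | |- @Poly _ _ _ _ (fun x => orb (@?f x) (@?g x)) => apply: Poly_orb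
  | |- @Poly _ _ _ _ (fun x => maxn (@?f x) (@?g x)) => apply: Poly_maxn
  | |- @Poly _ _ _ _ (fun x => minn (@?f x) (@?g x)) => apply: Poly_minn
  | |- @Poly _ _ _ _ (fun x => expn (@?f x) _) => apply: Poly_expn
  | |- @Poly _ _ _ _ (fun x => muln (@?f x) (@?g x)) => apply: Poly_muln
  | |- @Poly _ _ _ _ (fun x => addn (@?f x) (@?g x)) => apply: Poly_addn
  | |- @Poly _ _ _ _ (fun x => subn (@?f x) (@?g x)) => apply: Poly_subn
  | |- @Poly _ _ _ _ (fun x => leq (@?f x) (@?g x)) => apply: Poly_leq
  | |- @Poly _ _ _ _ (fun x => S (@?f x)) => apply: Poly_succ
  | |- @Poly _ _ _ _ (fun x => predn (@?f x)) => apply: Poly_predn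
  | |- @Poly _ _ _ _ (fun x => eq_op (@?f x) (@?g x)) =>
      first [apply: Poly_eqn | apply: Poly_eqb | apply: Poly_eq_bits]
  | |- @Poly _ _ _ _ (fun x => _) => fail
  | |- @Poly ?A ?B ?EA ?EB ?f => change (@Poly A B EA EB (fun x => f x))
  end | poly_hyp | apply: Poly_if ].
Ltac poly := repeat (cbv beta; poly_step).

(** * Finite types and functions given by tables *)

Fixpoint tree_eq (c t : tree) : bool :=
  match c, t with
  | Leaf, Leaf => true
  | Node a b, Node a' b' => tree_eq a a' && tree_eq b b'
  | _, _ => false
  end.

Lemma tree_eqP c t : reflect (c = t) (tree_eq c t).
Proof.
elim: c t => [|a IHa b IHb] [|a' b'] /=; try by constructor.
by apply: (iffP andP) => [[/IHa-> /IHb->]|[<- <-]] //; split; [apply/IHa | apply/IHb].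
Qed.

Lemma Poly_tree_eq c : Poly (tree_eq c).
Proof.
have pn := Poly_is_node; have p1 := Poly_tfst; have p2 := Poly_tsnd.
elim: c => [|a IHa b IHb].
  by apply: (Poly_ext (f := fun t => ~~ is_node t)) => [[]|] //; poly.
apply: (Poly_ext (f := fun t => is_node t && (tree_eq a (tfst t) && tree_eq b (tsnd t)))).
  by case.
by poly.
Qed.

(** The program is a table: it compares the code of the argument with the code of each element in
    turn. In this way an arbitrary transition function enters the calculus. *)
Lemma Poly_finite (A : finType) B (EA : Enc A) (EB : Enc B) (f : A -> B) :
  injective (@encode A EA) -> Poly f.
Proof.
move=> inj.
apply: (Poly_ext (f := fun a => foldr (fun c acc =>
  if tree_eq (encode c) (encode a) then f c else acc) (@dflt B EB) (enum A))).
  move=> a; have : a \in enum A by rewrite mem_enum.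
  elim: (enum A) => //= c s IH; rewrite in_cons; case: tree_eqP => [/inj-> //|ne] /orP[/eqP e|].
    by rewrite e in ne.
  exact: IH.
elim: (enum A) => [|c s IH] /=; first exact: Poly_const.
apply: Poly_if => //; last exact: Poly_const.
have pc := Poly_tree_eq (encode c).
apply: (@Poly_comp _ _ _ _ _ _ encode (tree_eq (encode c))) => //.
exact: (Poly_encode (f := id) _ (@Poly_id A EA)).
Qed.

Lemma encode_bool_inj : injective (@encode bool Enc_bool).
Proof. by case=> [] []. Qed.

Lemma encode_nat_inj : injective (@encode nat Enc_nat).
Proof. by elim=> [|m IH] [|n] //= [/IH->]. Qed.

Lemma encode_list_inj A (EA : Enc A) : injective (@encode A EA) ->
  injective (@encode (seq A) (Enc_list EA)).
Proof. by move=> inj; elim=> [|a s IH] [|b t] //= [/inj-> /IH->]. Qed.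

Definition Enc_fin (A : finType) (a : A) : Enc A :=
  {| encode x := @encode nat Enc_nat (enum_rank x); dflt := a |}.

Lemma encode_fin_inj (A : finType) (a : A) : injective (@encode A (Enc_fin a)).
Proof. by move=> x y /encode_nat_inj/val_inj/enum_rank_inj. Qed.

Lemma sz_fin (A : finType) (a x : A) : @enc_size A (Enc_fin a) x <= 2 * #|A| + 1.
Proof.
have -> : @enc_size A (Enc_fin a) x = @enc_size nat Enc_nat (enum_rank x) by [].
by rewrite sz_nat addn1 ltnS leq_mul2l ltnW ?orbT //; exact: ltn_ord.
Qed.

Section FiniteFunctions.

Variables (k : nat) (B : Type) (EB : Enc B).

#[global] Instance Enc_ffun : Enc {ffun 'I_k -> B} :=
  {| encode (g : {ffun 'I_k -> B}) := encode [seq g i | i <- enum 'I_k];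
     dflt := [ffun=> dflt] |}.

Lemma Poly_ffun X (EX : Enc X) (F : 'I_k -> X -> B) :
  (forall i, Poly (F i)) -> Poly (fun x => [ffun i => F i x]).
Proof.
move=> pF; apply: (Poly_encode (f := fun x => [seq F i x | i <- enum 'I_k])).
  by move=> x /=; congr foldr; apply: eq_map => i; rewrite ffunE.
exact: Poly_map_seq.
Qed.

Lemma Poly_ffun_app X (EX : Enc X) (g : X -> {ffun 'I_k -> B}) i :
  Poly g -> Poly (fun x => g x i).
Proof.
move=> pg.
apply: (Poly_ext (f := fun x => nth (@dflt B EB) [seq g x i | i <- enum 'I_k] i)).
  by move=> x; rewrite (nth_map i) ?size_enum_ord ?ltn_ord // nth_ord_enum.
apply: Poly_nth; last exact: Poly_const.
exact: (Poly_encode _ pg).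
Qed.

Lemma encode_ffun_inj : injective (@encode B EB) -> injective (@encode _ Enc_ffun).
Proof.
move=> inj g h /(encode_list_inj inj) e; apply/ffunP => i.
have nthE (f : {ffun 'I_k -> B}) : nth (g i) [seq f j | j <- enum 'I_k] i = f i.
  by rewrite (nth_map i) ?size_enum_ord ?ltn_ord // nth_ord_enum.
by rewrite -nthE e nthE.
Qed.

End FiniteFunctions.

Lemma encode_prod_inj A B (EA : Enc A) (EB : Enc B) : injective (@encode A EA) ->
  injective (@encode B EB) -> injective (@encode _ (Enc_prod EA EB)).
Proof. by move=> iA iB [a b] [c d] /= [/iA-> /iB->]. Qed.

(** * Simulation of Turing machines *)

Section Simulation.

Variable M : turing_machine.

Let k := (tm_extra_tapes M).+1.
Local Notation sym := (symbol (tm_aux M)).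

#[local] Instance Enc_state : Enc (tm_state M) := Enc_fin (tm_start M).
#[local] Instance Enc_sym : Enc (symbol (tm_aux M)) := @Enc_fin (symbol (tm_aux M)) None.
#[local] Instance Enc_tape : Enc (tape (tm_aux M)) :=
  {| encode t := encode (tape_left t, (tape_head t, tape_right t)); dflt := Tape [::] None [::] |}.

Lemma Poly_mk_tape X (EX : Enc X) (l r : X -> seq (symbol (tm_aux M))) (h : X -> symbol (tm_aux M)) :
  Poly l -> Poly h -> Poly r -> Poly (fun x => Tape (l x) (h x) (r x)).
Proof.
by move=> pl ph pr; exact: (Poly_encode _ (Poly_pair pl (Poly_pair ph pr))).
Qed.

Lemma Poly_tape_parts X (EX : Enc X) (t : X -> tape (tm_aux M)) : Poly t ->
  [/\ Poly (fun x => tape_left (t x)), Poly (fun x => tape_head (t x))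
    & Poly (fun x => tape_right (t x))].
Proof.
move=> pt.
have p : Poly (fun x => (tape_left (t x), (tape_head (t x), tape_right (t x)))).
  exact: (Poly_encode _ pt).
by split; [exact: (Poly_fst p) | exact: (Poly_fst (Poly_snd p)) | exact: (Poly_snd (Poly_snd p))].
Qed.

Let view : finType := (tm_state M * {ffun 'I_k -> sym})%type.
#[local] Instance Enc_view : Enc view := Enc_prod Enc_state (@Enc_ffun k sym Enc_sym).

Lemma encode_view_inj : injective (@encode view Enc_view).
Proof.
apply: encode_prod_inj; first exact: encode_fin_inj.
by apply: encode_ffun_inj; exact: encode_fin_inj.
Qed.

(** The part of a configuration that determines the next action. It ranges over a finite type, so
    the transition function is a table on it. *)
Definition config_view (c : config M) : view := (c.1, [ffun i => tape_head (c.2 i)]).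

#[local] Instance Enc_config : Enc (config M) :=
  Enc_prod Enc_state (@Enc_ffun k (tape (tm_aux M)) Enc_tape).

Lemma Poly_config_view : Poly config_view.
Proof.
have p1 : Poly (fun c : config M => c.1) by poly_var.
have p2 : Poly (fun c : config M => c.2) by poly_var.
apply: Poly_pair => //; apply: Poly_ffun => i.
by have [_ ? _] := Poly_tape_parts (Poly_ffun_app i p2).
Qed.

Definition is_left (m : move) := if m is MoveLeft then true else false.
Definition is_right (m : move) := if m is MoveRight then true else false.

Lemma Poly_write_move X (EX : Enc X) (t : X -> tape (tm_aux M)) (v : X -> view) i :
  Poly t -> Poly v ->
  Poly (fun x => tape_write_move (t x) ((tm_trans (v x).1 (v x).2).2 i)).
Proof.
move=> pt pv; have [pl ph pr] := Poly_tape_parts pt.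
pose act (u : view) := (tm_trans u.1 u.2).2 i.
have pL : Poly (fun u : view => is_left (act u).2) by apply: Poly_finite; exact: encode_view_inj.
have pR : Poly (fun u : view => is_right (act u).2) by apply: Poly_finite; exact: encode_view_inj.
have pW : Poly (fun u : view => (act u).1) by apply: Poly_finite; exact: encode_view_inj.
have {}pL := Poly_comp pv pL; have {}pR := Poly_comp pv pR; have {}pW := Poly_comp pv pW.
apply: (Poly_ext (f := fun x =>
  if is_left (act (v x)).2
  then Tape (behead (tape_left (t x))) (head None (tape_left (t x)))
            ((act (v x)).1 :: tape_right (t x))
  else if is_right (act (v x)).2
  then Tape ((act (v x)).1 :: tape_left (t x)) (head None (tape_right (t x)))
            (behead (tape_right (t x)))
  else Tape (tape_left (t x)) (act (v x)).1 (tape_right (t x)))).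
  by move=> x; rewrite -/(act (v x)); case: (t x) => l h r; case: (act (v x)) => a [].
apply: Poly_if => //; [|apply: Poly_if => //]; apply: Poly_mk_tape => //; poly.
Qed.

Lemma Poly_tm_step : Poly (@tm_step M).
Proof.
have pv := Poly_config_view.
have p1 : Poly (fun c : config M => c.1) by poly_var.
have p2 : Poly (fun c : config M => c.2) by poly_var.
have ph : Poly (fun q : tm_state M => tm_halt q) by apply: Poly_finite; exact: encode_fin_inj.
have pq : Poly (fun u : view => (tm_trans u.1 u.2).1).
  by apply: Poly_finite; exact: encode_view_inj.
apply: (Poly_ext (f := fun c : config M => if tm_halt c.1 then c else
  ((tm_trans (config_view c).1 (config_view c).2).1,
   [ffun i => tape_write_move (c.2 i) ((tm_trans (config_view c).1 (config_view c).2).2 i)]))).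
  by case=> q ts; rewrite /= /tm_step; case: ifP => // _; case: (tm_trans _ _).
apply: Poly_if; [exact: (Poly_comp p1 ph) | exact: Poly_id |].
apply: Poly_pair; first exact: (Poly_comp pv pq).
by apply: Poly_ffun => i; apply: Poly_write_move => //; exact: Poly_ffun_app.
Qed.

Lemma sz_map_le A B (EB : Enc B) (f g : A -> B) C (s : seq A) :
  (forall a, enc_size (f a) <= enc_size (g a) + C) ->
  enc_size [seq f a | a <- s] <= enc_size [seq g a | a <- s] + size s * C.
Proof.
move=> H; elim: s => [|a s IH] /=; first by rewrite addn0.
by rewrite !sz_cons; have := H a; lia.
Qed.

Let smax := 2 * #|sym| + 1.

Lemma sz_tape_write_move (t : tape (tm_aux M)) a :
  enc_size (tape_write_move t a) <= enc_size t + (2 * smax + 2).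
Proof.
have tE (l r : seq sym) (h : sym) : 
      @enc_size _ Enc_tape (@Tape (tm_aux M) l h r) = (enc_size l + (enc_size h + enc_size r).+1).+1.
  by rewrite -!sz_pair.
have hs (x : symbol (tm_aux M)) : enc_size x <= smax by exact: (@sz_fin sym).
have hb (l : seq sym) : enc_size (behead l) <= enc_size l.
  by case: l => // x l; rewrite /= sz_cons; lia.
case: t a => l h r [a []].
- suff: @enc_size _ Enc_tape (@Tape (tm_aux M) (behead l : seq sym) (head (None : sym) l) (a :: r)) <=
        @enc_size _ Enc_tape (@Tape (tm_aux M) l h r) + (2 * smax + 2) by [].
  rewrite !tE sz_cons; move: (hs a) (hs (head (None : sym) l)) (hb l); lia.
- suff: @enc_size _ Enc_tape (@Tape (tm_aux M) l a r) <= @enc_size _ Enc_tape (@Tape (tm_aux M) l h r) + (2 * smax + 2) by [].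
  rewrite !tE; move: (hs a); lia.
- suff: @enc_size _ Enc_tape (@Tape (tm_aux M) (a :: l) (head (None : sym) r) (behead r : seq sym)) <=
        @enc_size _ Enc_tape (@Tape (tm_aux M) l h r) + (2 * smax + 2) by [].
  rewrite !tE sz_cons; move: (hs a) (hs (head (None : sym) r)) (hb r); lia.
Qed.

(** A step lengthens each tape by at most one listed cell, so the growth is linear in [n]; the state
    contributes a constant that is added only once. *)
Lemma sz_tm_iter n (c : config M) :
  enc_size (iter n (@tm_step M) c) <=
  enc_size c + n * (k * (2 * smax + 2)) + (2 * #|tm_state M| + 1).
Proof.
have cE (c' : config M) : enc_size c' = (enc_size c'.1 + enc_size c'.2).+1.
  by case: c' => q ts; exact: sz_pair.
have step (c' : config M) :
    enc_size (tm_step c').2 <= enc_size c'.2 + k * (2 * smax + 2).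
  case: c' => q ts; rewrite /tm_step; case: ifP => _; first by rewrite leq_addr.
  case: (tm_trans _ _) => q' acts /=.
  have := @sz_map_le _ _ Enc_tape (fun i => [ffun i => tape_write_move (ts i) (acts i)] i) ts
            (2 * smax + 2) (enum 'I_k).
  rewrite size_enum_ord; apply=> i; rewrite ffunE; exact: sz_tape_write_move.
have iter_le : enc_size (iter n (@tm_step M) c).2 <= enc_size c.2 + n * (k * (2 * smax + 2)).
  elim: n => [|n IH]; first by rewrite addn0.
  by rewrite iterS; have := step (iter n (@tm_step M) c); rewrite mulSn; lia.
have : @enc_size _ Enc_state (iter n (@tm_step M) c).1 <= 2 * #|tm_state M| + 1.
  exact: sz_fin.
by rewrite !cE; lia.
Qed.

Lemma Poly_leading_bits : Poly (@leading_bits (tm_aux M)).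
Proof.
pose bit (a : sym) : seq bool := if a is Some (inl b) then [:: b] else [::].
have pb : Poly bit by apply: Poly_finite; exact: encode_fin_inj.
(* The flag records that only bits have been met so far; the first other symbol clears it for
   good. *)
pose st (s : bool * seq bool) (a : sym) :=
  if s.1 && ~~ nilp (bit a) then (true, bit a ++ s.2) else (false, s.2).
have foldlF u v : (foldl st (false, v) u).2 = v by elim: u v => //= a u IH v; rewrite /st /= IH.
have foldlE u v : (foldl st (true, v) u).2 = rev (leading_bits u) ++ v.
  elim: u v => //= a u IH v; rewrite /st /= /bit; case: a => [[b|a]|] /=.
  - by rewrite IH rev_cons cat_rcons.
  - exact: foldlF.
  - exact: foldlF.
apply: (Poly_ext (f := fun u => rev (foldl st (true, [::]) u).2)) => [u|].
  by rewrite foldlE cats0 revK.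
apply: Poly_rev; apply: Poly_snd.
apply: (Poly_foldl (F := fun (_ : seq sym) => st) (B := fun n => 4 * n + 8)).
- by rewrite /st; poly.
- exact: Poly_const.
- exact: Poly_id.
- by polyle.
move=> u l1 l2 e.
have bound : forall v b, enc_size (foldl st (b, v) l1).2 <= enc_size v + 4 * size l1.
  elim: l1 {e} => [|a l1 IH] v b; first by rewrite addn0.
  have -> : foldl st (b, v) (a :: l1) = foldl st (st (b, v) a) l1 by [].
  have -> : size (a :: l1) = (size l1).+1 by [].
  have [->|->] : st (b, v) a = (true, bit a ++ v) \/ st (b, v) a = (false, v).
  - by rewrite /st; case: ifP; [left | right].
  - have := IH (bit a ++ v) true; rewrite sz_cat.
    have : enc_size (bit a) <= 5 by rewrite /bit; case: (a) => [[[]|]|].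
    by lia.
  - by have := IH v false; lia.
have b2 := @size_le_sz _ Enc_sym u.
have b3 : size l1 <= size u by rewrite e size_cat leq_addr.
move: (bound [::] true); move: (foldl st (true, [::]) l1) => [b v] b1.
have {b1} : enc_size v <= enc_size (@nil bool) + 4 * size l1 by exact: b1.
by rewrite sz_pair sz_nil; have := sz_bool b; lia.
Qed.

Definition tm_run (c e : nat) (w : seq bool) : seq bool :=
  tm_output (iter (c * size w ^ e + c) (@tm_step M) (tm_init M w)).

Lemma Poly_tm_run c e : Poly (tm_run c e).
Proof.
have pn : Poly (fun w : seq bool => c * size w ^ e + c) by poly.
pose bt (b : bool) : sym := Some (inl b).
have pbit : Poly bt by apply: Poly_finite; exact: encode_bool_inj.
have pu : Poly (fun w : seq bool => [seq bt b | b <- w]) by poly.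
have pi : Poly (tm_init M).
  apply: Poly_pair; first exact: Poly_const.
  apply: Poly_ffun => i; apply: Poly_mk_tape; first exact: Poly_const.
    by apply: Poly_head; case: (i == ord0); [exact: pu | exact: Poly_const].
  by apply: Poly_behead; case: (i == ord0); [exact: pu | exact: Poly_const].
have [U [pU _ HU]] := Poly_size pi; have [V [pV _ HV]] := Poly_size pn.
have pc : Poly (fun w => iter (c * size w ^ e + c) (@tm_step M) (tm_init M w)).
  apply: (Poly_iter (F := fun (_ : seq bool) => @tm_step M)
    (B := fun n => U n + V n * (k * (2 * smax + 2)) + (2 * #|tm_state M| + 1))) => //.
  - apply: (@Poly_comp _ _ _ _ _ _ snd (@tm_step M)); [poly_var | exact: Poly_tm_step].
  - by polyle.
  move=> w i le; apply: leq_trans (sz_tm_iter _ _) _; rewrite leq_add2r leq_add // leq_mul2r.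
  by apply/orP; right; apply: leq_trans le _; apply: leq_trans (HV w); rewrite sz_nat; lia.
have p2 : Poly (fun w => (iter (c * size w ^ e + c) (@tm_step M) (tm_init M w)).2 ord0).
  by apply: Poly_ffun_app; apply: Poly_snd.
have [_ ph pr] := Poly_tape_parts p2.
by apply: (@Poly_comp _ _ _ _ _ _ _ (@leading_bits (tm_aux M))) Poly_leading_bits; exact: Poly_cons.
Qed.

End Simulation.

(** Simulating the machine for its time bound defines a function on all bit strings, with arbitrary
    values outside the encoded elements of [D]. Together with [Poly_polytime] it makes machines and
    the calculus interchangeable. *)
Lemma polytime_Poly (A B : Type) (encA : A -> seq bool) (encB : B -> seq bool)
    (D : A -> Prop) (f : A -> B) : polytime encA encB D f ->
  exists2 F : seq bool -> seq bool, Poly F & forall a, D a -> F (encA a) = encB (f a).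
Proof.
move=> [M [c [e H]]]; exists (tm_run M c e); first exact: Poly_tm_run.
by move=> a Da; have [_ <-] := H a Da.
Qed.

(** * Parsing and printing *)

(* The state is (inside a doubled bit?, current string reversed, strings reversed). *)
Definition dec_step (s : bool * (seq bool * seq (seq bool))) (b : bool) :=
  if s.1 then (false, (b :: s.2.1, s.2.2))
  else if b then (true, s.2) else (false, ([::], rev s.2.1 :: s.2.2)).

Definition dec_seq (w : seq bool) : seq (seq bool) :=
  rev (foldl dec_step (false, ([::], [::])) w).2.2.

Lemma foldl_dec_step v r c acc :
  foldl dec_step (false, (c, acc)) (enc_str v ++ r) =
  foldl dec_step (false, ([::], rev (catrev v c) :: acc)) r.
Proof. by elim: v c => //= b v IH c; rewrite /dec_step /= IH. Qed.

Lemma dec_seqK : cancel enc_seq dec_seq.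
Proof.
move=> ws; rewrite /dec_seq.
suff H acc : (foldl dec_step (false, ([::], acc)) (enc_seq ws)).2.2 = catrev ws acc.
  by rewrite H -/(rev ws) revK.
elim: ws acc => //= w ws IH acc; rewrite /enc_seq /= foldl_dec_step -/(rev w) revK.
exact: IH.
Qed.

Lemma Poly_dec_seq : Poly dec_seq.
Proof.
apply: Poly_rev; do 2!apply: Poly_snd.
apply: (Poly_foldl (F := fun (_ : seq bool) => dec_step) (B := fun n => 4 * n + 20)).
- by rewrite /dec_step; poly.
- exact: Poly_const.
- exact: Poly_id.
- by polyle.
move=> w l1 l2 e; have H : forall b c acc,
    enc_size (foldl dec_step (b, (c, acc)) l1) <= 5 + enc_size c + enc_size acc + 4 * size l1.
  elim: l1 {e} => [|x l1 IH] b c acc /=.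
    by rewrite !sz_pair; have := sz_bool b; lia.
  rewrite /dec_step /= -/dec_step; case: b => /=.
    by have := IH false (x :: c) acc; rewrite sz_cons; have := sz_bool x; lia.
  case: x; first by have := IH true c acc; lia.
  by have := IH false [::] (rev c :: acc); rewrite sz_cons sz_rev sz_nil; lia.
have := H false [::] [::]; have := size_le_sz Enc_bool w; rewrite e size_cat !sz_nil; lia.
Qed.

Lemma Poly_enc_str : Poly enc_str.
Proof.
apply: (Poly_ext (f := fun w => flatten [seq [:: true; b] | b <- w] ++ [:: false])) => [w|].
  by rewrite cats1.
by poly.
Qed.

Lemma Poly_enc_seq : Poly enc_seq.
Proof. by have p := Poly_enc_str; rewrite /enc_seq; poly. Qed.

Lemma Poly_enc_cnf : Poly enc_cnf.
Proof.
have p := Poly_enc_seq.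
have pl : Poly enc_lit by rewrite /enc_lit; poly.
have pc : Poly enc_clause by rewrite /enc_clause; poly.
by rewrite /enc_cnf; poly.
Qed.

Definition dec_cnf (w : seq bool) : cnf :=
  [seq [seq (size (behead l), head false l) | l <- dec_seq c] | c <- dec_seq w].

Lemma enc_cnfK : cancel enc_cnf dec_cnf.
Proof.
move=> F; rewrite /dec_cnf dec_seqK -map_comp; apply: map_id_in => C _ /=.
rewrite /enc_clause dec_seqK -map_comp; apply: map_id_in => -[v b] _ /=.
by rewrite size_nseq.
Qed.

Lemma Poly_dec_cnf : Poly dec_cnf.
Proof. by have p := Poly_dec_seq; rewrite /dec_cnf; poly. Qed.

Lemma dec_pair (P : local_search) (xs : instance P * seq bool) :
  dec_seq (enc_pair xs) = [:: enc_instance xs.1; xs.2].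
Proof. exact: dec_seqK. Qed.

(** * Membership of k-SAT/1-FLIP in PLS *)

Lemma size_enc_str w : size (enc_str w) = (2 * size w).+1.
Proof.
rewrite /enc_str size_rcons; congr _.+1.
by elim: w => //= b w; lia.
Qed.

Lemma size_enc_seq_mem w ws : w \in ws -> size w <= size (enc_seq ws).
Proof.
elim: ws => //= v ws IH; rewrite in_cons /enc_seq /= size_cat size_enc_str.
by move=> /orP[/eqP->|/IH]; rewrite /enc_seq; lia.
Qed.

Lemma nvars_le_enc F : nvars F <= size (enc_cnf F).
Proof.
apply/bigmax_leqP_seq => C CF _; apply/bigmax_leqP_seq => l lC _.
have e1 := size_enc_seq_mem (map_f enc_clause CF).
have e2 := size_enc_seq_mem (map_f enc_lit lC).
apply: leq_trans e1; apply: leq_trans e2; by rewrite /enc_lit /= size_nseq.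
Qed.

Lemma Poly_bigmax X (EX : Enc X) (f : X -> seq nat) :
  Poly f -> Poly (fun x => \max_(i <- f x) i).
Proof.
move=> pf; have [U [pU mU HU]] := Poly_size pf.
have foldlE (s : seq nat) n : foldl maxn n s = maxn n (\max_(i <- s) i).
  elim: s n => [|a s IH] n /=; first by rewrite big_nil maxn0.
  by rewrite IH big_cons maxnA.
apply: (Poly_ext (f := fun x => foldl maxn 0 (f x))) => [x|]; first by rewrite foldlE max0n.
apply: (Poly_foldl (F := fun (_ : X) => maxn) (B := U)) => //.
- by poly.
- exact: Poly_const.
move=> x l1 l2 e; apply: leq_trans (HU x); rewrite foldlE max0n sz_nat.
have le : forall s : seq nat, 2 * (\max_(i <- s) i) < enc_size s.
  elim=> [|a s IH]; first by rewrite big_nil.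
  rewrite big_cons sz_cons sz_nat; move: IH; rewrite /maxn; case: ifP; lia.
by rewrite e sz_cat; have := le l1; sz_pos l2; lia.
Qed.

Lemma Poly_nvars : Poly nvars.
Proof.
apply: (Poly_ext (f := fun F : cnf => \max_(i <- [seq \max_(j <- [seq (l : literal).1.+1 | l <- C]) j | C <- F]) i)).
  move=> F; rewrite /nvars big_map; apply: eq_bigr => C _.
  by rewrite big_map.
apply: Poly_bigmax; apply: Poly_map; last by poly.
by apply: Poly_bigmax; poly.
Qed.

Definition flip_bit (i : nat) (s : seq bool) : seq bool :=
  take i s ++ ~~ nth false s i :: drop i.+1 s.

Lemma size_flip_bit i s : i < size s -> size (flip_bit i s) = size s.
Proof. by move=> lt; rewrite size_cat /= size_drop size_take lt; lia. Qed.

Lemma nth_flip_bit i s j : i < size s ->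
  nth false (flip_bit i s) j = if j == i then ~~ nth false s i else nth false s j.
Proof.
move=> lt; rewrite nth_cat size_take lt; case: (ltngtP j i) => [ji|ij|->].
- by rewrite nth_take.
- by rewrite (_ : j - i = (j - i.+1).+1) /= ?nth_drop ?subnKC //; lia.
- by rewrite subnn.
Qed.

Lemma hamming_self s : hamming s s = 0.
Proof. by rewrite /hamming; elim: s => //= b s ->; rewrite eqxx. Qed.

Lemma hamming_flip_bit i s : i < size s -> hamming s (flip_bit i s) <= 1.
Proof.
elim: s i => // b s IH [|i] lt; rewrite /hamming /flip_bit /= ?drop0.
  by have := hamming_self s; rewrite /hamming => ->; case: (b).
by rewrite eqxx add0n; exact: IH.
Qed.

Lemma hamming_le0 s s' : size s' = size s -> hamming s s' = 0 -> s' = s.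
Proof.
elim: s s' => [|b s IH] [|c s'] // /eqP; rewrite eqSS => /eqP e; rewrite /hamming /=.
by case: eqP => //= -> /(IH _ e) ->.
Qed.

Lemma hamming_le1 s s' : size s' = size s -> hamming s s' <= 1 ->
  s' = s \/ exists2 i, i < size s & s' = flip_bit i s.
Proof.
elim: s s' => [|b s IH] [|c s'] //; first by left.
move=> /eqP; rewrite eqSS => /eqP e.
rewrite {1}/hamming /=; case: eqP => /= [<-|ne].
  rewrite add0n => /(IH _ e)[->|[i lt ->]]; first by left.
  by right; exists i.+1.
rewrite add1n ltnS leqn0 => /eqP /(hamming_le0 e) ->; right; exists 0 => //.
by rewrite /flip_bit /= drop0; congr (_ :: _); case: b c ne => [] [].
Qed.

Definition flip_nbrs (s : seq bool) : seq (seq bool) :=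
  s :: [seq flip_bit i s | i <- iota 0 (size s)].

Lemma mem_flip_nbrs s : flip_nbrs s =i flip_neighbor 1 s.
Proof.
move=> s'; rewrite in_cons /flip_neighbor.
apply/orP/idP => [[/eqP->|/mapP[i]]|].
- by rewrite /in_mem /= eqxx hamming_self.
- rewrite mem_iota => /andP[_ lt] ->.
  by rewrite /in_mem /= size_flip_bit // eqxx hamming_flip_bit.
move=> /andP[/eqP e /(hamming_le1 e)[->|[i lt ->]]]; first by left.
by right; apply/mapP; exists i => //; rewrite mem_iota.
Qed.

Lemma Poly_flip_nbrs : Poly flip_nbrs.
Proof. by rewrite /flip_nbrs /flip_bit; poly. Qed.

Lemma enc_nat_double (b : bool) n :
  enc_nat (b + n.*2) = if (n == 0) && ~~ b then [::] else b :: enc_nat n.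
Proof.
case: ifP => [/andP[/eqP-> /negbTE->] //|nz].
rewrite /enc_nat up_log2S; last by case: (b) nz; lia.
have -> : (b + n.*2)./2 = n by rewrite half_bit_double.
rewrite /mkseq /= expn0 divn1 oddD odd_double addbF oddb; congr (_ :: _).
rewrite -[1]addn0 iotaDl -map_comp; apply: eq_map => i /=.
by rewrite add1n expnS divnMA divn2 half_bit_double.
Qed.

Lemma lex_payoff_rcons F C s :
  lex_payoff (rcons F C) s = clause_sat s C + (lex_payoff F s).*2.
Proof.
rewrite /lex_payoff size_rcons big_mkcond big_ord_recr /= nth_rcons ltnn eqxx subnn [LHS]addnC.
congr (_ + _).
rewrite [X in _ = X.*2]big_mkcond /= -muln2 big_distrl /=; apply: eq_bigr => i _.
rewrite nth_rcons ltn_ord; case: clause_sat => //.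
by rewrite -expnSr; congr (_ ^ _); have := ltn_ord i; lia.
Qed.

(* The bits, least significant first, of the number with the given bits, most
   significant first. *)
Definition lsb_bits (l : seq bool) : seq bool :=
  foldl (fun acc b => if nilp acc && ~~ b then [::] else b :: acc) [::] l.

Lemma enc_nat_eq0 n : nilp (enc_nat n) = (n == 0).
Proof. by rewrite /nilp size_mkseq up_log_eq0 orFb ltnS leqn0. Qed.

(** By Horner's rule the truth values of the clauses, in order of priority, are the binary digits of
    the payoff. Only leading zeros have to go, and the exponentially large number itself is never
    formed. *)
Lemma enc_lex_payoff F s : enc_nat (lex_payoff F s) = lsb_bits [seq clause_sat s C | C <- F].
Proof.
rewrite /lsb_bits; elim/last_ind: F => [|F C IH]; first by rewrite /lex_payoff big_ord0 /enc_nat up_log1.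
by rewrite map_rcons foldl_rcons -IH lex_payoff_rcons enc_nat_double enc_nat_eq0.
Qed.

Lemma Poly_lsb_bits : Poly lsb_bits.
Proof.
apply: (Poly_foldl (F := fun (_ : seq bool) acc b => if nilp acc && ~~ b then [::] else b :: acc)
   (B := fun n => 4 * n + 1)).
- by poly.
- exact: Poly_const.
- exact: Poly_id.
- by polyle.
move=> w l1 l2 e; have H : forall acc, enc_size (foldl
   (fun acc b => if nilp acc && ~~ b then [::] else b :: acc) acc l1) <=
   enc_size acc + 4 * size l1.
  elim: l1 {e} => [|b l1 IH] acc /=; first by rewrite addn0.
  case: ifP => _; first by have := IH [::]; rewrite sz_nil; sz_pos acc; lia.
  by have := IH (b :: acc); rewrite sz_cons; have := sz_bool b; lia.
by have := H [::]; have := size_le_sz Enc_bool w; rewrite e size_cat !sz_nil; lia.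
Qed.

Lemma sat_flip_in_PLS (k : nat) : in_PLS (sat_flip k 1).
Proof.
have pd := Poly_dec_seq; have pc := Poly_dec_cnf; have pe := Poly_enc_cnf.
have pn := Poly_nvars; have pf := Poly_flip_nbrs; have ps := Poly_enc_seq.
have pl := Poly_lsb_bits.
have decE (xs : instance (sat_flip k 1) * seq bool) :
    dec_cnf (nth [::] (dec_seq (enc_pair xs)) 0) = val xs.1 /\
    nth [::] (dec_seq (enc_pair xs)) 1 = xs.2.
  by rewrite dec_pair /= enc_cnfK.
split.
(* Decoding is total, so a word is recognized as an encoding by decoding it and encoding the result
   again. *)
- exists (fun w => (enc_cnf (dec_cnf w) == w) && kcnf k (dec_cnf w)) => [w|].
    split=> [/andP[/eqP e kF]|[[F kF] /= <-]]; first by exists (Sub (dec_cnf w) kF).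
    by rewrite enc_cnfK eqxx.
  apply: (@Poly_polytime _ _ _ _ _ _
    (fun w => [:: (enc_cnf (dec_cnf w) == w) && kcnf k (dec_cnf w)])) => //.
  by rewrite /kcnf; poly.
- exists 1, 1 => F s /eqP->; rewrite expn1 mul1n.
  by rewrite (leq_trans (nvars_le_enc _)) ?leq_addr.
- apply: (@Poly_polytime _ _ _ _ _ _ (fun w => [:: size (nth [::] (dec_seq w) 1)
            == nvars (dec_cnf (nth [::] (dec_seq w) 0))])); first by poly.
  by move=> xs _; have [-> ->] := decE xs.
- exists (fun F : kcnf_formula k => nseq (nvars (val F)) false) => [F|].
    by rewrite /= size_nseq.
  apply: (@Poly_polytime _ _ _ _ _ _ (fun w => nseq (nvars (dec_cnf w)) false)); first by poly.
  by move=> F _; rewrite /= enc_cnfK.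
- apply: (@Poly_polytime _ _ _ _ _ _ (fun w => lsb_bits
     [seq clause_sat (nth [::] (dec_seq w) 1) C | C <- dec_cnf (nth [::] (dec_seq w) 0)])).
    by rewrite /clause_sat /lit_sat; poly.
  by move=> xs _; have [-> ->] := decE xs; rewrite /= enc_lex_payoff.
- exists (fun xs => flip_nbrs xs.2) => [F s _|]; first exact: mem_flip_nbrs.
  apply: (@Poly_polytime _ _ _ _ _ _ (fun w => enc_seq (flip_nbrs (nth [::] (dec_seq w) 1)))).
    by poly.
  by move=> xs _; have [_ ->] := decE xs.
Qed.

(** * Stable assignments *)

Definition csat (s : nat -> bool) (C : clause) : bool := has (fun l => s l.1 == l.2) C.

Definition flipv (s : nat -> bool) (v : nat) : nat -> bool :=
  fun u => if u == v then ~~ s v else s u.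

Lemma flipvN s v x : x <> v -> flipv s v x = s x.
Proof. by rewrite /flipv => /eqP/negbTE->. Qed.

Lemma flipvE s v x : x = v -> flipv s v x = ~~ s v.
Proof. by rewrite /flipv => ->; rewrite eqxx. Qed.

Definition keeps (s : nat -> bool) (v : nat) (F : seq clause) : bool :=
  all (fun D => csat s D ==> csat (flipv s v) D) F.

(** The form in which local optimality is used: a flip that keeps the clauses before a block and
    satisfies the whole block has nothing to repair in it, whatever it does to later clauses.
    Assignments are total functions, so no range condition on [v] is carried along. *)
Definition stable (s : nat -> bool) (F : seq clause) : Prop :=
  forall v F1 S F2, F = F1 ++ S ++ F2 -> keeps s v F1 ->
  all (csat (flipv s v)) S -> all (csat s) S.

Lemma lex_payoff_cons C F s :
  lex_payoff (C :: F) s = clause_sat s C * 2 ^ size F + lex_payoff F s.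
Proof.
rewrite /lex_payoff big_mkcond big_ord_recl /= subSS subn0; congr (_ + _).
  by case: clause_sat; rewrite ?mul1n.
by rewrite [RHS]big_mkcond.
Qed.

Lemma lex_payoff_lt F s : lex_payoff F s < 2 ^ size F.
Proof.
elim: F => [|C F IH]; first by rewrite /lex_payoff big_ord0.
by rewrite lex_payoff_cons /= expnS; case: clause_sat; lia.
Qed.

(** The first clause of [F1] whose value changes becomes true, and its weight exceeds the total
    weight of all later clauses. *)
Lemma lex_payoff_gain F1 F2 s s' :
  all (fun D => clause_sat s D ==> clause_sat s' D) F1 ->
  has (fun D => ~~ clause_sat s D && clause_sat s' D) F1 ->
  lex_payoff (F1 ++ F2) s < lex_payoff (F1 ++ F2) s'.
Proof.
elim: F1 => //= C F1 IH /andP[imp H] g; rewrite !lex_payoff_cons.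
have b1 := lex_payoff_lt (F1 ++ F2) s.
case: (clause_sat s C) imp g => /= [->|_].
  by move=> /(IH H) lt; rewrite ltn_add2l.
case: (clause_sat s' C) => /= [_|/(IH H)]; last by rewrite !mul0n !add0n.
by rewrite mul0n mul1n add0n (leq_trans b1) ?leq_addr.
Qed.

Lemma csat_eq_in s s' C : {in C, forall l : literal, s l.1 = s' l.1} -> csat s C = csat s' C.
Proof. by move=> H; apply: eq_in_has => l /H ->. Qed.

Lemma local_opt_stable F s : size s = nvars F ->
  (forall s', flip_neighbor 1 s s' -> ~~ (lex_payoff F s < lex_payoff F s')) ->
  stable (nth false s) F.
Proof.
move=> sz opt v F1 S F2 eF kp aS.
(* A variable beyond the range occurs in no clause, so flipping it does not affect the formula. *)
have [lt|ge] := ltnP v (size s); last first.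
  apply/allP => D DS; have := allP aS D DS; rewrite (@csat_eq_in _ (nth false s)) // => l lD.
  apply: flipvN => e; have : l.1 < nvars F.
    rewrite /nvars; have DF : D \in F by rewrite eF !mem_cat DS orbT.
    have := leq_bigmax_seq (F := fun C : clause => \max_(l <- C) l.1.+1) _ DF isT.
    have := leq_bigmax_seq (F := fun l : literal => l.1.+1) _ lD isT.
    by move=> h1 h2; exact: leq_trans h1 h2.
  by rewrite e -sz ltnNge ge.
have fl : nth false (flip_bit v s) = flipv (nth false s) v.
  by apply: functional_extensionality => j; rewrite nth_flip_bit.
apply/negPn/negP => nS.
have nb : flip_neighbor 1 s (flip_bit v s).
  by rewrite /flip_neighbor size_flip_bit // eqxx hamming_flip_bit.
have /negP := opt _ nb; apply; rewrite eF catA; apply: lex_payoff_gain.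
  rewrite all_cat /clause_sat /lit_sat fl; apply/andP; split; first exact: kp.
  by apply/allP => D DS; apply/implyP => _; exact: (allP aS D DS).
rewrite has_cat; apply/orP; right; rewrite -has_predC in nS.
have /hasP[D DS nD] := nS; apply/hasP; exists D => //.
apply/andP; split; first exact: nD.
by rewrite /clause_sat /lit_sat fl; exact: (allP aS D DS).
Qed.

Section Keeps.

Variables (s : nat -> bool) (v : nat).

Lemma keeps_cat F G : keeps s v (F ++ G) = keeps s v F && keeps s v G.
Proof. exact: all_cat. Qed.

Lemma keeps_flatten (f : nat -> seq clause) a n :
  (forall j, a <= j < a + n -> keeps s v (f j)) -> keeps s v (flatten [seq f j | j <- iota a n]).
Proof.
move=> H; apply/allP => D /flattenP[S /mapP[j]]; rewrite mem_iota => jn -> DS.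
exact: (allP (H j jn)).
Qed.

End Keeps.

(** * Gates *)

(* [(o, ((true, c), _))] sets [o] to [c], and [(o, ((false, _), (x, (y, z))))]
   sets [o] to [if x then y else z]. *)
Definition gate := (nat * ((bool * bool) * (nat * (nat * nat))))%type.

Definition gval (s : nat -> bool) (g : gate) : bool :=
  if g.2.1.1 then g.2.1.2 else if s g.2.2.1 then s g.2.2.2.1 else s g.2.2.2.2.

Definition ginp (g : gate) : seq nat :=
  if g.2.1.1 then [::] else [:: g.2.2.1; g.2.2.2.1; g.2.2.2.2].

(** Multiplexers and constants suffice for Shannon expansions, and their clauses have at most three
    literals, which leaves the fourth place to the guard [ctl]. *)
Definition gate_clauses (ctl : clause) (g : gate) : seq clause :=
  if g.2.1.1 then [:: ctl ++ [:: (g.1, g.2.1.2)]] else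
  [:: ctl ++ [:: (g.2.2.1, false); (g.2.2.2.1, false); (g.1, true)];
      ctl ++ [:: (g.2.2.1, false); (g.2.2.2.1, true); (g.1, false)];
      ctl ++ [:: (g.2.2.1, true); (g.2.2.2.2, false); (g.1, true)];
      ctl ++ [:: (g.2.2.1, true); (g.2.2.2.2, true); (g.1, false)]].

Definition gates_clauses (ctl : clause) (gs : seq gate) : seq clause :=
  flatten [seq gate_clauses ctl g | g <- gs].

Definition gates_ok (s : nat -> bool) (gs : seq gate) : Prop :=
  forall g, g \in gs -> s g.1 = gval s g.

(** The list is in topological order: a gate reads the input window or earlier outputs of the same
    circuit. Circuits with disjoint windows and output ranges then do not interfere. *)
Definition wf_gates (lo hi base : nat) (gs : seq gate) : Prop :=
  [seq g.1 | g <- gs] = iota base (size gs) /\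
  forall g, g \in gs -> forall x, x \in ginp g -> (lo <= x < hi) || (base <= x < g.1).

Lemma gate_clauses_sat s ctl g :
  all (csat s) (gate_clauses ctl g) = csat s ctl || (s g.1 == gval s g).
Proof.
case: g => o [[[] c] [x [y z]]]; rewrite /gate_clauses /gval /csat /= !has_cat /=.
  by rewrite andbT orbF.
by case: (has _ ctl) => //=; case: (s x); case: (s y); case: (s z); case: (s o).
Qed.

Lemma gval_flipv s v g : v \notin ginp g -> gval (flipv s v) g = gval s g.
Proof.
rewrite /ginp /gval; case: ifP => // _; rewrite !inE !negb_or => /and3P[x y z].
by rewrite !flipvN //; apply/eqP; rewrite eq_sym.
Qed.

Lemma wf_gates_out lo hi base gs g :
  wf_gates lo hi base gs -> g \in gs -> base <= g.1 < base + size gs.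
Proof. by move=> [e _] gg; have := map_f fst gg; rewrite e mem_iota. Qed.

Lemma wf_gates_split lo hi base g1 g g2 :
  hi <= base -> wf_gates lo hi base (g1 ++ g :: g2) ->
  g.1 \notin ginp g /\ forall g', g' \in g1 -> g.1 != g'.1 /\ g.1 \notin ginp g'.
Proof.
move=> hb [e inp].
have u : uniq [seq g.1 | g <- g1 ++ g :: g2] by rewrite e iota_uniq.
have gin : g \in g1 ++ g :: g2 by rewrite mem_cat inE eqxx orbT.
have gout := wf_gates_out (conj e inp) gin.
have /andP[b1 _] := gout; split.
  apply/negP => /(inp g gin) /orP[/andP[_ b2]|/andP[_]]; last by rewrite ltnn.
  by have := leq_trans b2 (leq_trans hb b1); rewrite ltnn.
move=> g' gg; have gin' : g' \in g1 ++ g :: g2 by rewrite mem_cat gg.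
have lt : g'.1 < g.1.
  move: (e); rewrite map_cat /= size_cat iotaD => /eqP; rewrite eqseq_cat; last by rewrite size_map size_iota.
  rewrite /= eqseq_cons => /and3P[/eqP e1 /eqP e2 _].
  by have := map_f fst gg; rewrite e1 mem_iota -e2 => /andP[].
split; first by rewrite gtn_eqF.
apply/negP => /(inp g' gin') /orP[/andP[_ b2]|/andP[_ b2]].
  by have := leq_trans b2 (leq_trans hb b1); rewrite ltnn.
by have := ltn_trans b2 lt; rewrite ltnn.
Qed.

(** Three ways in which flipping a variable foreign to the gates is harmless: the guard does not
    contain it, the guard is true afterwards, or the gates are already evaluated. The third is the
    case of switching an idle circuit on. *)
Lemma keeps_gates s v ctl gs :
  (forall g, g \in gs -> v != g.1 /\ v \notin ginp g) ->
  [\/ v \notin [seq l.1 | l <- ctl], csat (flipv s v) ctl | gates_ok s gs] ->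
  keeps s v (gates_clauses ctl gs).
Proof.
move=> nv H; apply/allP => D /flattenP[S /mapP[g gg ->] DS].
have [n1 n2] := nv g gg; apply/implyP => sD.
have e1 : flipv s v g.1 = s g.1 by apply: flipvN; apply/eqP; rewrite eq_sym.
case: H => [nc|c|ok].
- rewrite -(@csat_eq_in s) // => l lD; rewrite flipvN //.
  move: DS; rewrite /gate_clauses; move: n2; rewrite /ginp; case: ifP => _ n2 DS e.
    move: DS; rewrite inE => /eqP eD; move: lD; rewrite eD mem_cat => /orP[lc|].
      by move/negP: nc; apply; rewrite -e; exact: map_f.
    by rewrite inE => /eqP el; rewrite -e el eqxx in n1.
  move: n2; rewrite !inE !negb_or => /and3P[x1 x2 x3].
  have : l.1 \in [seq l.1 | l <- ctl] ++ [:: g.2.2.1; g.2.2.2.1; g.2.2.2.2; g.1].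
    move: DS; rewrite !inE => /or4P[]/eqP eD; move: lD; rewrite eD !mem_cat => /orP[lc|];
     try (by rewrite map_f ?lc); rewrite !inE => /or3P[]/eqP-> /=; rewrite eqxx ?orbT //.
  rewrite e mem_cat (negbTE nc) /= !inE.
  by rewrite (negbTE x1) (negbTE x2) (negbTE x3) (negbTE n1).
- have : all (csat (flipv s v)) (gate_clauses ctl g) by rewrite gate_clauses_sat c.
  by move/allP; apply.
- have : all (csat (flipv s v)) (gate_clauses ctl g).
    by rewrite gate_clauses_sat e1 gval_flipv // ok // eqxx orbT.
  by move/allP; apply.
Qed.

(** If a gate were wrong, flipping its output would repair its clauses: earlier gates do not mention
    that output, and the gates that read it come later in the order of priority. *)
Lemma stable_gates lo hi base s F F1 F2 ctl gs :
  stable s F -> F = F1 ++ gates_clauses ctl gs ++ F2 -> hi <= base ->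
  wf_gates lo hi base gs -> ~~ csat s ctl ->
  (forall l, l \in ctl -> l.1 < base) ->
  (forall v, base <= v < base + size gs -> keeps s v F1) ->
  gates_ok s gs.
Proof.
move=> st eF hb wf nctl ctlv kp g gg.
have gout := wf_gates_out wf gg.
have [g1 [g2 egs]] : exists g1 g2, gs = g1 ++ g :: g2.
  by case/splitPr: gg => g1 g2; exists g1, g2.
have wf' := wf; rewrite egs in wf'; have [ni nv] := wf_gates_split hb wf'.
have nc : g.1 \notin [seq l.1 | l <- ctl].
  by apply/negP => /mapP[l lc e]; have := ctlv l lc; rewrite -e; lia.
have ec : csat (flipv s g.1) ctl = csat s ctl.
  apply: csat_eq_in => l lc; apply: flipvN => e.
  by move/negP: nc; apply; rewrite -e; exact: map_f.
apply/eqP; apply/negPn/negP => ne.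
have := @st g.1 (F1 ++ gates_clauses ctl g1) (gate_clauses ctl g) (gates_clauses ctl g2 ++ F2).
rewrite eF egs /gates_clauses map_cat /= flatten_cat /= -!catA => /(_ erefl).
rewrite keeps_cat kp //= !gate_clauses_sat ec (negbTE nctl) /= (negbTE ne).
rewrite flipvE // gval_flipv //.
have -> : ~~ s g.1 == gval s g by case: (s _) (gval _ _) ne => [] [].
suff -> : keeps s g.1 (flatten [seq gate_clauses ctl g | g <- g1]) by move=> /(_ isT isT).
by apply: keeps_gates => //; constructor 1.
Qed.

(** * The formula *)

(* Variables 0 and 1 are the control bits [a] and [b]; then come the registers
   [A] and [B], with most significant bits first, and the comparison bits [G_0, ..., G_m]. *)
Local Notation varA j := (2 + j).
Local Notation varB m j := (2 + m + j).
Local Notation varG m j := (2 + m + m + j).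

(* [G_(j+1) = G_j || (~~ A_j && B_j)] *)
Definition cmp_def (ctl : clause) (m j : nat) : seq clause :=
  [:: ctl ++ [:: (varG m j.+1, true); (varG m j, false)];
      ctl ++ [:: (varG m j.+1, true); (varA j, true); (varB m j, false)];
      ctl ++ [:: (varG m j.+1, false); (varG m j, true); (varA j, false)];
      ctl ++ [:: (varG m j.+1, false); (varG m j, true); (varB m j, true)]].

(** With [b] on, bit [j] of [A] is at most that of [B] unless an earlier position already has [B]
    ahead. Given the definition of the [G] bits, this keeps [A] lexicographically at most [B]. *)
Definition bound_cl (m j : nat) : seq clause :=
  [:: [:: (1, false); (varG m j, true); (varA j, false); (varB m j, true)]].

(** The bound precedes the unit clause and so vetoes setting a bit of [A] too early; the comparison
    follows, since raising [A_j] may change the value required of [G_(j+1)]. Going level by level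
    makes raising a leading bit worth upsetting all later levels. *)
Definition level (m j : nat) : seq clause :=
  bound_cl m j ++ [:: [:: (varA j, true)]] ++ cmp_def [:: (1, false)] m j.

(** [n0 + j * z] is the gate of [gA] carrying bit [j] of the successor. With [a] on, [B] copies it;
    with both bits off, [B] loads [init]; with only [b] on, the clauses hold for any content of
    [B]. *)
Definition copy_cl (m : nat) (init : seq bool) (n0 z j : nat) : seq clause :=
  [:: [:: (0, false); (n0 + j * z, false); (varB m j, true)];
      [:: (0, false); (n0 + j * z, true); (varB m j, false)];
      [:: (0, true); (1, true); (varB m j, nth false init j)]].

(** The validity clauses precede the clause that one control bit is on, so a bit with an invalid
    register goes off even if that leaves both off. The pairs of clauses on [G_m] drive the cycle:
    if it is false, [a] goes on and [b] off; if it is true, [b] goes on and [a] off. The latter pair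
    comes last because, with [b] off, [G_m] is defined only by the unguarded clauses above it. *)
Definition formula (m : nat) (init : seq bool) (gA gB : seq gate) (wA wB n0 z : nat) : cnf :=
  [:: [:: (varG m 0, false)]] ++
  gates_clauses [:: (0, false)] gA ++ gates_clauses [:: (1, false)] gB ++
  [:: [:: (0, false); (wA, true)]] ++ [:: [:: (1, false); (wB, true)]] ++
  [:: [:: (0, true); (1, true)]] ++
  flatten [seq level m j | j <- iota 0 m] ++
  [:: [:: (varG m m, true); (0, true)]] ++ [:: [:: (varG m m, true); (1, false)]] ++
  flatten [seq copy_cl m init n0 z j | j <- iota 0 m] ++
  gates_clauses [::] gA ++ gates_clauses [::] gB ++
  flatten [seq cmp_def [::] m j | j <- iota 0 m] ++
  [:: [:: (varG m m, false); (1, true)]] ++ [:: [:: (varG m m, false); (0, false)]].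

Lemma flatten_iota_split (f : nat -> seq clause) n i : i < n ->
  flatten [seq f j | j <- iota 0 n] =
  flatten [seq f j | j <- iota 0 i] ++ f i ++ flatten [seq f j | j <- iota i.+1 (n - i.+1)].
Proof.
move=> lt; have -> : n = i + (1 + (n - i.+1)) by lia.
by rewrite !iotaD /= map_cat flatten_cat /= addn1; congr (_ ++ (_ ++ flatten (map f (iota _ _)))); lia.
Qed.

Ltac flip_simp := repeat match goal with
  | |- context [flipv ?s ?v ?x] =>
      first [rewrite (@flipvN s v x); last lia | rewrite (@flipvE s v x); last lia]
  end.

(** * Stable assignments of the formula *)

Section Analysis.

Variables (m : nat) (init : seq bool) (gA gB : seq gate) (wA wB n0 z : nat).
Variables (valid : seq bool -> bool) (next : seq bool -> seq bool).

Local Notation A0 := 2.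
Local Notation B0 := (2 + m).
Local Notation G0 := (3 + m + m + m).
Local Notation H0 := (3 + m + m + m + size gA).

Definition read (s : nat -> bool) (o : nat) : seq bool := mkseq (fun j => s (o + j)) m.

Hypothesis wfA : wf_gates A0 (A0 + m) G0 gA.
Hypothesis wfB : wf_gates B0 (B0 + m) H0 gB.
Hypothesis wA_range : G0 <= wA < H0.
Hypothesis wB_range : H0 <= wB < H0 + size gB.
Hypothesis N_range : forall j, j < m -> G0 <= n0 + j * z < H0.
Hypothesis semA : forall s, gates_ok s gA -> s wA = valid (read s A0) /\
  forall j, j < m -> s (n0 + j * z) = nth false (next (read s A0)) j.
Hypothesis semB : forall s, gates_ok s gB -> s wB = valid (read s B0).
Hypothesis init_size : size init = m.
Hypothesis init_valid : valid init.
Hypothesis next_size : forall A, size A = m -> valid A -> size (next A) = m.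
Hypothesis next_valid : forall A, size A = m -> valid A -> valid (next A).
Hypothesis next_better : forall A, size A = m -> valid A -> next A = A \/
  exists i, [/\ i < m, forall j, j < i -> nth false A j = nth false (next A) j,
    nth false A i = false & nth false (next A) i = true].

Variable s : nat -> bool.
Hypothesis st : stable s (formula m init gA gB wA wB n0 z).

Local Notation F := (formula m init gA gB wA wB n0 z).
Local Notation S0 := [:: [:: (varG m 0, false)]].
Local Notation SA := (gates_clauses [:: (0, false)] gA).
Local Notation SB := (gates_clauses [:: (1, false)] gB).
Local Notation Sw := [:: [:: (0, false); (wA, true)]].
Local Notation Su := [:: [:: (1, false); (wB, true)]].
Local Notation ST := [:: [:: (0, true); (1, true)]].
Local Notation SL n := (flatten [seq level m j | j <- iota 0 n]).
Local Notation Sa := [:: [:: (varG m m, true); (0, true)]].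
Local Notation Sb := [:: [:: (varG m m, true); (1, false)]].
Local Notation SC n := (flatten [seq copy_cl m init n0 z j | j <- iota 0 n]).
Local Notation TA := (gates_clauses [::] gA).
Local Notation TB := (gates_clauses [::] gB).
Local Notation SG n := (flatten [seq cmp_def [::] m j | j <- iota 0 n]).
Local Notation Sc := [:: [:: (varG m m, false); (1, true)]].
Local Notation Sd := [:: [:: (varG m m, false); (0, false)]].

Ltac bool_cases := rewrite /=; repeat match goal with
  | |- context [flipv s ?v ?x] => case: (flipv s v x)
  | |- context [s ?x] => case: (s x)
  end; by rewrite /= ?implybb ?implybT ?andbT ?orbT.

Lemma gA_vars v g : g \in gA -> ~~ ((A0 <= v < B0) || (G0 <= v < H0)) ->
  v != g.1 /\ v \notin ginp g.
Proof.
move=> gg nv; have [_ inp] := wfA; have /andP[o1 o2] := wf_gates_out wfA gg; split.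
  by apply/eqP => e; move: nv; rewrite e o1 o2 orbT.
apply/negP => /(inp g gg) /orP[vi|/andP[v1 v2]]; first by rewrite vi in nv.
by move: nv; rewrite v1 (ltn_trans v2 o2) orbT.
Qed.

Lemma gB_vars v g : g \in gB -> ~~ ((B0 <= v < B0 + m) || (H0 <= v)) ->
  v != g.1 /\ v \notin ginp g.
Proof.
move=> gg nv; have [_ inp] := wfB; have /andP[o1 o2] := wf_gates_out wfB gg; split.
  by apply/eqP => e; move: nv; rewrite e o1 orbT.
apply/negP => /(inp g gg) /orP[vi|/andP[v1 v2]]; first by rewrite vi in nv.
by move: nv; rewrite v1 orbT.
Qed.

Lemma keeps_gA v ctl : ~~ ((A0 <= v < B0) || (G0 <= v < H0)) ->
  [\/ v \notin [seq l.1 | l <- ctl], csat (flipv s v) ctl | gates_ok s gA] ->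
  keeps s v (gates_clauses ctl gA).
Proof. by move=> nv; apply: keeps_gates => g gg; exact: gA_vars. Qed.

Lemma keeps_gB v ctl : ~~ ((B0 <= v < B0 + m) || (H0 <= v)) ->
  [\/ v \notin [seq l.1 | l <- ctl], csat (flipv s v) ctl | gates_ok s gB] ->
  keeps s v (gates_clauses ctl gB).
Proof. by move=> nv; apply: keeps_gates => g gg; exact: gB_vars. Qed.

Lemma keeps_ctl v c b gs : s c = b -> c != v -> keeps s v (gates_clauses [:: (c, b)] gs).
Proof.
move=> sc cv; apply/allP => D /flattenP[S /mapP[g gg ->] DS]; apply/implyP => _.
have : all (csat (flipv s v)) (gate_clauses [:: (c, b)] g).
  by rewrite gate_clauses_sat /csat /= flipvN ?sc ?eqxx //; exact/eqP.
by move/allP; apply.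
Qed.

Ltac split_keeps := repeat (rewrite keeps_cat; apply/andP; split).
Ltac small := rewrite /keeps /csat /=; flip_simp; bool_cases.
Ltac ctl_out := constructor 1; rewrite ?inE /=; lia.

Lemma g0_false : s (varG m 0) = false.
Proof.
apply/negP => t; have := @st (varG m 0) [::] S0 _ erefl isT.
by rewrite /csat /= flipvE // t => /(_ isT).
Qed.

Lemma stable_cmp ctl F1 F2 j : F = F1 ++ cmp_def ctl m j ++ F2 -> j < m ->
  ~~ csat s ctl -> (forall l, l \in ctl -> l.1 < 2) -> keeps s (varG m j.+1) F1 ->
  s (varG m j.+1) = s (varG m j) || (~~ s (varA j) && s (varB m j)).
Proof.
move=> eF jm nc cv kp.
have ec : csat (flipv s (varG m j.+1)) ctl = csat s ctl.
  by apply: csat_eq_in => -[x b] /cv /= lt; apply: flipvN; lia.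
move: nc; rewrite /csat in ec * => nc.
have := st eF kp; rewrite /cmp_def /csat /= !has_cat ec (negbTE nc) /=.
flip_simp; case: (s (varG m j.+1)); case: (s (varG m j)); case: (s (varA j)); case: (s (varB m j)) => //=.
all: by move=> /(_ isT).
Qed.

Lemma gatesA_hard : s 0 = true -> gates_ok s gA.
Proof.
move=> a1; apply: (stable_gates (F1 := S0) (ctl := [:: (0, false)]) st _ _ wfA) => //.
- by lia.
- by rewrite /csat /= a1.
- by move=> l; rewrite inE => /eqP->.
- by move=> v vr; small.
Qed.

Lemma gatesB_hard : s 1 = true -> gates_ok s gB.
Proof.
move=> b1; apply: (stable_gates (F1 := S0 ++ SA) (ctl := [:: (1, false)]) st _ _ wfB) => //.
- by lia.
- by rewrite /csat /= b1.
- by move=> l; rewrite inE => /eqP->.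
- move=> v vr; split_keeps; first small.
  by apply: keeps_gA; [lia | ctl_out].
Qed.

Lemma st_at v F1 S F2 : F1 ++ S ++ F2 = F -> keeps s v F1 ->
  all (csat (flipv s v)) S -> all (csat s) S.
Proof. by move=> e; apply: (st (F2 := F2)). Qed.

(** Otherwise [a] could be switched off: this satisfies every clause it guards, and the clause that
    one control bit is on has lower priority. *)
Lemma validA : s 0 = true -> s wA = true.
Proof.
move=> a1; have : all (csat s) Sw.
  apply: (@st_at 0 (S0 ++ SA ++ SB)); first by rewrite -!catA.
    split_keeps; first small.
    - apply: keeps_gA; first by lia.
      by constructor 2; rewrite /csat /= flipvE // a1.
    - by apply: keeps_gB; [lia | ctl_out].
  by rewrite /csat /= flipvE // a1.
by rewrite /csat /= a1 /= orbF andbT => /eqP.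
Qed.

Lemma validB : s 1 = true -> s wB = true.
Proof.
move=> b1; have : all (csat s) Su.
  apply: (@st_at 1 (S0 ++ SA ++ SB ++ Sw)); first by rewrite -!catA.
    split_keeps; try small.
    - by apply: keeps_gA; [lia | ctl_out].
    - apply: keeps_gB; first by lia.
      by constructor 2; rewrite /csat /= flipvE // b1.
  by rewrite /csat /= flipvE // b1.
by rewrite /csat /= b1 /= orbF andbT => /eqP.
Qed.

(** With [a] off, every clause of higher priority that mentions a gate of [gA] contains the true
    literal that negates [a], so a wrong output is free to be corrected. *)
Lemma gatesA_soft : s 0 = false -> gates_ok s gA.
Proof.
move=> a0; apply: (stable_gates (F1 := S0 ++ SA ++ SB ++ Sw ++ Su ++ ST ++ SL m ++ Sa ++ Sb ++ SC m)
   (ctl := [::]) st _ _ wfA) => //.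
- by rewrite /formula -!catA.
- by lia.
- move=> v vr; split_keeps; try small.
  + by apply: keeps_ctl => //; lia.
  + by apply: keeps_gB; [lia | ctl_out].
  + by rewrite /keeps /csat /= !(@flipvN _ _ 0) ?a0 //; lia.
  + apply: keeps_flatten => j jm; rewrite /level /cmp_def /bound_cl; small.
  + apply: keeps_flatten => j jm; rewrite /copy_cl /keeps /csat /=.
    have f0 : flipv s v 0 = s 0 by apply: flipvN; lia.
    have f1 : flipv s v 1 = s 1 by apply: flipvN; lia.
    have f2 : flipv s v (varB m j) = s (varB m j) by apply: flipvN; lia.
    by rewrite f0 f1 f2 a0; bool_cases.
Qed.

Lemma gatesB_soft : s 1 = false -> gates_ok s gB.
Proof.
move=> b0; apply: (stable_gates (F1 := S0 ++ SA ++ SB ++ Sw ++ Su ++ ST ++ SL m ++ Sa ++ Sb ++ SC m ++ TA)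
   (ctl := [::]) st _ _ wfB) => //.
- by rewrite /formula -!catA.
- by lia.
- move=> v vr; split_keeps; try small.
  + by apply: keeps_gA; [lia | ctl_out].
  + by apply: keeps_ctl => //; lia.
  + by rewrite /keeps /csat /= !(@flipvN _ _ 1) ?b0 //; lia.
  + apply: keeps_flatten => j jm; rewrite /level /cmp_def /bound_cl; small.
  + apply: keeps_flatten => j jm; rewrite /copy_cl; have := N_range (j := j).
    case/andP: jm => _ jm /(_ jm) nr; small.
  + by apply: keeps_gA; [lia | constructor 1].
Qed.

Local Notation PL n := (S0 ++ SA ++ SB ++ Sw ++ Su ++ ST ++ SL n).
Ltac unfold_keeps := rewrite /level /bound_cl /cmp_def /copy_cl /keeps /csat /=; flip_simp.

Lemma formula_level j : j < m -> exists F2, F = PL j ++ level m j ++ F2.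
Proof.
move=> jm; eexists; rewrite /formula (flatten_iota_split _ jm) -!catA; reflexivity.
Qed.

Lemma formula_copy j : j < m -> exists F2,
  F = (PL m ++ Sa ++ Sb ++ SC j) ++ copy_cl m init n0 z j ++ F2.
Proof.
move=> jm; eexists; rewrite /formula (flatten_iota_split (copy_cl m init n0 z) jm) -!catA.
reflexivity.
Qed.

Lemma formula_cmp j : j < m -> exists F2,
  F = (PL m ++ Sa ++ Sb ++ SC m ++ TA ++ TB ++ SG j) ++ cmp_def [::] m j ++ F2.
Proof.
move=> jm; eexists; rewrite /formula (flatten_iota_split (cmp_def [::] m) jm) -!catA.
reflexivity.
Qed.

Lemma cmp_hard j : s 1 = true -> j < m ->
  s (varG m j.+1) = s (varG m j) || (~~ s (varA j) && s (varB m j)).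
Proof.
move=> b1 jm; have [F2 eF] := formula_level jm.
apply: (@stable_cmp [:: (1, false)] (PL j ++ bound_cl m j ++ [:: [:: (varA j, true)]]) F2) => //.
- by rewrite eF /level -!catA.
- by rewrite /csat /= b1.
- by move=> l; rewrite inE => /eqP->.
- split_keeps; try small.
  + by apply: keeps_gA; [lia | ctl_out].
  + by apply: keeps_gB; [lia | ctl_out].
  + by apply: keeps_flatten => i ij; unfold_keeps; bool_cases.
Qed.

(** With [a] on and [b] off, the control literals satisfy the bounds, the guarded comparison and the
    two clauses on [G_m] above. So nothing above the unguarded definition of [G_(j+1)] depends on
    its value. *)
Lemma cmp_soft j : s 0 = true -> s 1 = false -> j < m ->
  s (varG m j.+1) = s (varG m j) || (~~ s (varA j) && s (varB m j)).
Proof.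
move=> a1 b0 jm; have [F2 eF] := formula_cmp jm.
apply: (stable_cmp eF) => //; split_keeps; try small.
- by apply: keeps_gA; [lia | ctl_out].
- by apply: keeps_gB; [lia | ctl_out].
- by apply: keeps_flatten => i ij; unfold_keeps; rewrite ?b0; bool_cases.
- by unfold_keeps; rewrite ?a1; bool_cases.
- by unfold_keeps; rewrite ?b0; bool_cases.
- apply: keeps_flatten => i /andP[_ im]; have nr := N_range im.
  by unfold_keeps; bool_cases.
- by apply: keeps_gA; [lia | constructor 1].
- by apply: keeps_gB; [lia | constructor 1].
- by apply: keeps_flatten => i ij; unfold_keeps; bool_cases.
Qed.

(** Apart from the copying clauses of other positions, bits of [B] occur above only in the circuit
    of [B] and in the levels, and there the literal that negates [b] satisfies the clause. *)
Lemma keeps_copy j : s 1 = false -> j < m -> keeps s (varB m j) (PL m ++ Sa ++ Sb ++ SC j).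
Proof.
move=> b0 jm; split_keeps; try small.
- by apply: keeps_gA; [lia | ctl_out].
- by apply: keeps_ctl => //; lia.
- by apply: keeps_flatten => i ij; unfold_keeps; rewrite ?b0; bool_cases.
- apply: keeps_flatten => i /andP[_ ij]; have nr := N_range (ltn_trans ij jm).
  by unfold_keeps; bool_cases.
Qed.

Lemma copy_init j : s 0 = false -> s 1 = false -> j < m -> s (varB m j) = nth false init j.
Proof.
move=> a0 b0 jm; have [F2 eF] := formula_copy jm.
have := st eF (keeps_copy b0 jm); unfold_keeps; rewrite a0 b0 /=.
by case: (s (varB m j)); case: (nth false init j) => //= /(_ isT).
Qed.

Lemma copy_next j : s 0 = true -> s 1 = false -> j < m -> s (varB m j) = s (n0 + j * z).
Proof.
move=> a1 b0 jm; have [F2 eF] := formula_copy jm; have nr := N_range jm.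
have := st eF (keeps_copy b0 jm); unfold_keeps; rewrite a1 /=.
by case: (s (varB m j)); case: (s (n0 + j * z)) => //= /(_ isT).
Qed.

(** While the prefixes agree, [G_j] is false and the bound is active: if [B_j] is false it forces
    [A_j] down, if [B_j] is true it holds and the unit clause pulls [A_j] up. With [a] off, the
    circuit reading [A] does not resist the change. *)
Lemma copy_level j : s 0 = false -> s 1 = true -> j <= m ->
  s (varG m j) = false /\ forall i, i < j -> s (varA i) = s (varB m i).
Proof.
move=> a0 b1; elim: j => [|j IH] jm; first by split=> //; exact: g0_false.
have [g0 ab] := IH (ltnW jm); have [F2 eF] := formula_level jm.
have kp : keeps s (varA j) (PL j).
  split_keeps; try small.
  - by apply: keeps_ctl => //; lia.
  - by apply: keeps_gB; [lia | ctl_out].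
  - by apply: keeps_flatten => i ij; unfold_keeps; bool_cases.
have abj : s (varA j) = s (varB m j).
  case eB: (s (varB m j)).
    have : all (csat s) (bound_cl m j ++ [:: [:: (varA j, true)]]).
      apply/negPn/negP => nall; case/negP: (nall).
      apply: (@st_at (varA j) (PL j) _ (cmp_def [:: (1, false)] m j ++ F2)) => //.
      move: nall; rewrite /bound_cl /csat /=; flip_simp; rewrite eB /= !orbT /=.
      by case: (s (varA j)).
    by rewrite /bound_cl /csat /= => /and3P[_]; case: (s (varA j)).
  have : all (csat s) (bound_cl m j).
    apply/negPn/negP => nall; case/negP: (nall).
    apply: (@st_at (varA j) (PL j) _ ([:: [:: (varA j, true)]] ++ cmp_def [:: (1, false)] m j ++ F2)) => //.
    move: nall; rewrite /bound_cl /csat /=; flip_simp; rewrite b1 g0 eB /=.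
    by case: (s (varA j)).
  by rewrite /bound_cl /csat /= b1 g0 eB; case: (s (varA j)).
split; first by rewrite cmp_hard // g0 abj; case: (s _).
by move=> i; rewrite ltnS leq_eqVlt => /predU1P[->|/ab].
Qed.

Lemma read_nth s' o j : j < m -> nth false (read s' o) j = s' (o + j).
Proof. by move=> jm; rewrite nth_mkseq. Qed.

Lemma eq_read o (w : seq bool) : size w = m ->
  (forall j, j < m -> s (o + j) = nth false w j) -> read s o = w.
Proof.
move=> sz H; apply: (eq_from_nth (x0 := false)); first by rewrite size_mkseq.
by move=> j; rewrite size_mkseq => jm; rewrite nth_mkseq // H.
Qed.

(** [B] then contains the valid initial register and its circuit is evaluated, so switching [b] on
    is harmless and satisfies the clause that one control bit is on. *)
Lemma not_00 : ~ (s 0 = false /\ s 1 = false).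
Proof.
move=> [a0 b0]; have okB := gatesB_soft b0.
have wB1 : s wB = true.
  by rewrite semB // (@eq_read B0 init) // => j jm; rewrite copy_init.
have : all (csat s) ST.
  apply: (@st_at 1 (S0 ++ SA ++ SB ++ Sw ++ Su)); first by rewrite -!catA.
    split_keeps; try small.
    - by apply: keeps_gA; [lia | ctl_out].
    - by apply: keeps_gB; [lia | constructor 3].
    - by unfold_keeps; rewrite wB1; bool_cases.
  by rewrite /csat /=; flip_simp; rewrite b0 /= orbT.
by rewrite /csat /= a0 b0.
Qed.

(** [A] has become equal to [B], whose validity [b] certifies, so [a] may be switched on; [G_m] is
    false, which asks for it. *)
Lemma not_01 : ~ (s 0 = false /\ s 1 = true).
Proof.
move=> [a0 b1]; have okA := gatesA_soft a0; have okB := gatesB_hard b1.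
have [l0 ab] := copy_level a0 b1 (leqnn m).
have wA1 : s wA = true.
  have [-> _] := semA okA; rewrite -(validB b1) (semB okB); congr valid.
  apply: eq_read; first by rewrite size_mkseq.
  by move=> j jm; rewrite read_nth // ab.
have : all (csat s) Sa.
  apply: (@st_at 0 (PL m)); first by rewrite -!catA.
    split_keeps; try small.
    - by apply: keeps_gA; [lia | constructor 3].
    - by apply: keeps_gB; [lia | ctl_out].
    - by unfold_keeps; rewrite wA1; bool_cases.
    - by unfold_keeps; rewrite a0; bool_cases.
    - by apply: keeps_flatten => i ij; unfold_keeps; bool_cases.
  by rewrite /csat /=; flip_simp; rewrite a0 /= orbT.
by rewrite /csat /= a0 l0.
Qed.

(** If [G_m] is false, switching [b] off gains; if it is true, switching [a] off gains. Either way
    the other bit still satisfies the clause that one of them is on. *)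
Lemma not_11 : ~ (s 0 = true /\ s 1 = true).
Proof.
move=> [a1 b1].
have l1 : s (varG m m) = true.
  have : all (csat s) Sb.
    apply: (@st_at 1 (PL m ++ Sa)); first by rewrite -!catA.
      split_keeps; try small.
      - by apply: keeps_gA; [lia | ctl_out].
      - by apply: keeps_gB; [lia | constructor 2; rewrite /csat /= flipvE // b1].
      - by unfold_keeps; rewrite b1; bool_cases.
      - by unfold_keeps; rewrite a1; bool_cases.
      - by apply: keeps_flatten => i ij; unfold_keeps; rewrite ?b1; bool_cases.
    by rewrite /csat /=; flip_simp; rewrite b1 /= orbT.
  by rewrite /csat /= b1; case: (s (varG m m)).
have : all (csat s) Sd.
  apply: (@st_at 0 (PL m ++ Sa ++ Sb ++ SC m ++ TA ++ TB ++ SG m ++ Sc) _ [::]).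
    by rewrite -!catA.
    split_keeps; try small.
    - by apply: keeps_gA; [lia | constructor 2; rewrite /csat /= flipvE // a1].
    - by apply: keeps_gB; [lia | ctl_out].
    - by unfold_keeps; rewrite a1; bool_cases.
    - by unfold_keeps; rewrite b1; bool_cases.
    - by apply: keeps_flatten => i ij; unfold_keeps; bool_cases.
    - by unfold_keeps; rewrite l1; bool_cases.
    - apply: keeps_flatten => i /andP[_ im]; have nr := N_range im.
      by unfold_keeps; rewrite ?a1 ?b1; bool_cases.
    - by apply: keeps_gA; [lia | constructor 1].
    - by apply: keeps_gB; [lia | constructor 1].
    - by apply: keeps_flatten => i ij; unfold_keeps; bool_cases.
  by rewrite /csat /=; flip_simp; rewrite a1 /= orbT.
by rewrite /csat /= a1 l1.
Qed.

(** Switching [b] on activates the bounds, which must therefore hold beforehand; this is the last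
    hypothesis. The guarded comparison, activated as well, is met because the unguarded one has
    already been evaluated. *)
Lemma not_10 : s 0 = true -> s 1 = false -> gates_ok s gB -> s wB = true ->
  s (varG m m) = true -> (forall j, j < m -> s (varG m j) || ~~ s (varA j) || s (varB m j)) -> False.
Proof.
move=> a1 b0 okB wB1 l1 bnd; have : all (csat s) Sc; last by rewrite /csat /= b0 l1.
apply: (@st_at 1 (PL m ++ Sa ++ Sb ++ SC m ++ TA ++ TB ++ SG m)); first by rewrite -!catA.
  split_keeps; try small.
  - by apply: keeps_gA; [lia | ctl_out].
  - by apply: keeps_gB; [lia | constructor 3].
  - by unfold_keeps; rewrite wB1; bool_cases.
  - by unfold_keeps; rewrite a1; bool_cases.
  - apply: keeps_flatten => j /andP[_ jm]; unfold_keeps.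
    move: (bnd j jm); rewrite (cmp_soft a1 b0 jm) b0.
    by case: (s (varG m j)); case: (s (varA j)); case: (s (varB m j)).
  - by unfold_keeps; rewrite l1; bool_cases.
  - apply: keeps_flatten => j /andP[_ jm]; have nr := N_range jm.
    by unfold_keeps; rewrite ?b0; bool_cases.
  - by apply: keeps_gA; [lia | constructor 1].
  - by apply: keeps_gB; [lia | constructor 1].
  - by apply: keeps_flatten => j jm; unfold_keeps; bool_cases.
by rewrite /csat /=; flip_simp; rewrite b0 /= orbT.
Qed.

Lemma stable_formula : valid (read s A0) /\ next (read s A0) = read s A0.
Proof.
have [a1 b0] : s 0 = true /\ s 1 = false.
  move: not_00 not_01 not_11; case: (s 0); case: (s 1) => // n1 n2 n3.
  - by case: n3.
  - by case: n2.
  - by case: n1.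
have okA := gatesA_hard a1; have okB := gatesB_soft b0; have [eA eN] := semA okA.
have vA1 : valid (read s A0) by rewrite -eA validA.
have szA : size (read s A0) = m by rewrite size_mkseq.
have eB : read s B0 = next (read s A0).
  by apply: eq_read => [|j jm]; [exact: next_size | rewrite copy_next // eN].
have wB1 : s wB = true by rewrite semB // eB next_valid.
have Bj j : j < m -> s (varB m j) = nth false (next (read s A0)) j.
  by move=> jm; rewrite -eB read_nth.
split=> //; case: (next_better szA vA1) => // -[i [im pre Ai Ni]].
(* [i] is the first position where [A] and its successor differ, so the comparison bits turn from
   false to true right after it. *)
have cmp j : j <= m -> s (varG m j) = (i < j).
  elim: j => [|j IH] jm; first by rewrite g0_false.
  rewrite cmp_soft // IH ?(ltnW jm) // Bj //.
  have -> : s (varA j) = nth false (read s A0) j by rewrite read_nth.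
  case: (ltngtP j i) => [ji|ij|->].
  - by rewrite pre // andNb /= ltnS leqNgt ji.
  - by rewrite ltnS (ltnW ij).
  - by rewrite Ai Ni ltnSn orbT.
case: (@not_10 a1 b0 okB wB1) => [|j jm]; first by rewrite cmp.
rewrite cmp ?(ltnW jm) // Bj //.
have -> : s (varA j) = nth false (read s A0) j by rewrite read_nth.
by case: (ltngtP j i) => [/pre->|//|->]; [case: nth | rewrite Ni orbT].
Qed.

End Analysis.

(** * Circuits for Turing machines *)

(** Exponential in [K], but [K] will depend only on the machine and not on its input. *)
Fixpoint shan_size (K : nat) : nat :=
  if K is K'.+1 then (shan_size K' + shan_size K').+1 else 1.

(* The Shannon expansion of [F] on the [K] variables [addrs]; the last gate,
   numbered [base + (shan_size K).-1], carries the value. *)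
Fixpoint shan (K : nat) (F : seq bool -> bool) (addrs : seq nat) (base : nat) : seq gate :=
  if K is K'.+1 then
    shan K' (fun l => F (true :: l)) (behead addrs) base ++
    shan K' (fun l => F (false :: l)) (behead addrs) (base + shan_size K') ++
    [:: (base + shan_size K' + shan_size K', ((false, false), (head 0 addrs,
          (base + (shan_size K').-1, base + shan_size K' + (shan_size K').-1))))]
  else [:: (base, ((true, F [::]), (0, (0, 0))))].

Lemma shan_size_gt0 K : 0 < shan_size K.
Proof. by case: K. Qed.

Lemma shan_outs K F addrs base :
  [seq g.1 | g <- shan K F addrs base] = iota base (shan_size K).
Proof.
elim: K F addrs base => // K IH F addrs base.
have -> : shan_size K.+1 = shan_size K + (shan_size K + 1) by rewrite /= addn1 addnS.
by rewrite [shan _ _ _ _]/= !map_cat !IH !iotaD.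
Qed.

Lemma gates_ok_cat s g1 g2 : gates_ok s (g1 ++ g2) <-> gates_ok s g1 /\ gates_ok s g2.
Proof.
split=> [H|[H1 H2] g]; last by rewrite mem_cat => /orP[/H1|/H2].
by split=> g gg; apply: H; rewrite mem_cat gg ?orbT.
Qed.

Lemma gates_ok_flatten (I : eqType) s (f : I -> seq gate) (r : seq I) i :
  gates_ok s (flatten [seq f i | i <- r]) -> i \in r -> gates_ok s (f i).
Proof. by move=> H ir g gg; apply: H; apply/flattenP; exists (f i) => //; exact: map_f. Qed.

Lemma shan_ok s K F addrs base : gates_ok s (shan K F addrs base) -> size addrs = K ->
  s (base + (shan_size K).-1) = F [seq s x | x <- addrs].
Proof.
elim: K F addrs base => [|K IH] F addrs base /=.
  by move=> ok /size0nil->; rewrite addn0 /= (ok _ (mem_head _ _)).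
rewrite !gates_ok_cat => -[ok1 [ok2 ok3]]; case: addrs ok1 ok2 ok3 => // x addrs ok1 ok2 ok3 [sz].
rewrite addnA (ok3 _ (mem_head _ _)) /gval /= (IH _ _ _ ok1 sz) (IH _ _ _ ok2 sz).
by case: (s x).
Qed.

Lemma shan_inp K F addrs base g x : size addrs = K -> g \in shan K F addrs base ->
  x \in ginp g -> (x \in addrs) || (base <= x < g.1).
Proof.
elim: K F addrs base => [|K IH] F addrs base /=.
  by move=> _; rewrite inE => /eqP->.
case: addrs => // y addrs [sz]; rewrite !mem_cat inE => /or3P[g1|g2|/eqP->].
- by move=> /(IH _ _ _ sz g1) /orP[xa|/= ->]; rewrite ?orbT // inE xa orbT.
- move=> /(IH _ _ _ sz g2) /orP[xa|/andP[b1 b2]]; first by rewrite inE xa orbT.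
  by rewrite b2 (leq_trans (leq_addr _ _) b1) !orbT.
- rewrite /ginp /= !inE; have := shan_size_gt0 K.
  by move=> h /or3P[/eqP->|/eqP->|/eqP->]; rewrite ?eqxx //; apply/orP; right; lia.
Qed.

Lemma outs_flatten (f : nat -> seq gate) base Q n :
  (forall i, i < n -> [seq g.1 | g <- f i] = iota (base + i * Q) Q) ->
  [seq g.1 | g <- flatten [seq f i | i <- iota 0 n]] = iota base (n * Q).
Proof.
elim: n => [|n IH] H; first by rewrite mul0n.
rewrite -[n.+1]addn1 iotaD map_cat flatten_cat map_cat IH => [|i lt].
  by rewrite /= cats0 add0n H // addn1 mulSnr iotaD.
by apply: H; exact: ltnW.
Qed.

Section Cells.

Variables (T : finType) (t0 : T).

Let D := #|T|.
Let K := 4 * D.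
Let Z := shan_size K.

(** One-hot code: wire [e] tells whether the cell is element number [e], so every wire is a Boolean
    function with its own Shannon expansion. *)
Definition cell_code (c : T) : seq bool := [seq enum_rank c == e :> nat | e <- iota 0 D].

Definition decode_cell (bits : seq bool) : T := nth t0 (enum T) (index true bits).

Lemma size_cell_code c : size (cell_code c) = D.
Proof. by rewrite size_map size_iota. Qed.

Lemma cell_codeK : cancel cell_code decode_cell.
Proof.
move=> c; have lt : enum_rank c < D by exact: ltn_ord.
rewrite /decode_cell (_ : index true (cell_code c) = enum_rank c).
  by rewrite nth_enum_rank.
have lt' : (enum_rank c : nat) < size (cell_code c) by rewrite size_cell_code.
have e1 : nth false (cell_code c) (enum_rank c) = true.
  by rewrite (nth_map 0) ?size_iota // nth_iota // add0n eqxx.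
have mt : true \in cell_code c by rewrite -e1 mem_nth.
have := nth_index false mt; have := mt; rewrite -index_mem size_cell_code => ilt.
by rewrite (nth_map 0) ?size_iota // nth_iota // add0n => /eqP<-.
Qed.

Definition cell_gates (F : seq bool -> T) (addrs : seq nat) (base : nat) : seq gate :=
  flatten [seq shan K (fun bits => enum_rank (F bits) == e :> nat) addrs (base + e * Z)
          | e <- iota 0 D].

Definition cell_vars (base : nat) : seq nat := [seq base + e * Z + Z.-1 | e <- iota 0 D].

Lemma size_cell_vars base : size (cell_vars base) = D.
Proof. by rewrite size_map size_iota. Qed.

Lemma cell_vars_range base x : x \in cell_vars base -> base <= x < base + D * Z.
Proof.
move=> /mapP[e]; rewrite mem_iota add0n => /andP[_ lt] ->.
have Z0 : 0 < Z := shan_size_gt0 _.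
rewrite -addnA leq_addr ltn_add2l; have : e.+1 * Z <= D * Z by rewrite leq_mul2r lt orbT.
by rewrite mulSn; lia.
Qed.

Lemma cell_gates_outs F addrs base :
  [seq g.1 | g <- cell_gates F addrs base] = iota base (D * Z).
Proof. by apply: outs_flatten => e lt; rewrite shan_outs. Qed.

Lemma cell_gates_ok s F addrs base : gates_ok s (cell_gates F addrs base) -> size addrs = K ->
  [seq s x | x <- cell_vars base] = cell_code (F [seq s x | x <- addrs]).
Proof.
move=> ok sz; rewrite -map_comp; apply/eq_in_map => e ei /=.
by have := shan_ok (gates_ok_flatten ok ei) sz; rewrite -/Z => ->.
Qed.

Lemma cell_gates_inp F addrs base g x : size addrs = K -> g \in cell_gates F addrs base ->
  x \in ginp g -> (x \in addrs) || (base <= x < g.1).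
Proof.
move=> sz /flattenP[S /mapP[e ei ->] gS] /(shan_inp sz gS)/orP[->//|/andP[b1 b2]].
by rewrite b2 (leq_trans (leq_addr _ _) b1) orbT.
Qed.

Lemma cell_gates_range F addrs base g : g \in cell_gates F addrs base ->
  base <= g.1 < base + D * Z.
Proof. by move=> gg; have := map_f fst gg; rewrite cell_gates_outs mem_iota. Qed.

Definition cells4 (bits : seq bool) : T * T * (T * T) :=
  (decode_cell (take D bits), decode_cell (take D (drop D bits)),
   (decode_cell (take D (drop (D + D) bits)), decode_cell (take D (drop (D + D + D) bits)))).

Lemma cells4E c1 c2 c3 c4 :
  cells4 (cell_code c1 ++ cell_code c2 ++ cell_code c3 ++ cell_code c4) = (c1, c2, (c3, c4)).
Proof.
have tk (c : T) w : decode_cell (take D (cell_code c ++ w)) = c.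
  by rewrite take_size_cat ?size_cell_code // cell_codeK.
have dr (c : T) w : drop D (cell_code c ++ w) = w by rewrite drop_size_cat ?size_cell_code.
rewrite /cells4 tk -!drop_drop !dr !tk; congr (_, (_, _)).
by rewrite -[cell_code c4]cats0 tk.
Qed.

End Cells.

Lemma Poly_shan K F : Poly (fun p : seq nat * nat => shan K F p.1 p.2).
Proof.
elim: K F => [|K IH] F /=; first by poly.
have i1 := IH (fun l => F (true :: l)); have i2 := IH (fun l => F (false :: l)).
by poly; apply: (@Poly_app2 _ _ _ _ _ _ _ _ (shan K _)) => //; poly.
Qed.

Lemma Poly_cell_gates (T : finType) (F : seq bool -> T) :
  Poly (fun p : seq nat * nat => cell_gates F p.1 p.2).
Proof.
rewrite /cell_gates; apply: Poly_flatten; apply: Poly_map_seq => e.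
have ps := Poly_shan (4 * #|T|) (fun bits => enum_rank (F bits) == e :> nat).
by apply: (@Poly_app2 _ _ _ _ _ _ _ _ (shan _ _)) => //; poly.
Qed.

(** * Tableaux with columns relative to the heads *)

Section Tableau.

Variable M : turing_machine.

Local Notation k := (tm_extra_tapes M).+1.
Local Notation sym := (symbol (tm_aux M)).

(* The tape cells at one position relative to the heads; the first component
   marks the position of the heads, and the state is repeated in every cell. *)
Definition cell : finType := (bool * tm_state M * {ffun 'I_k -> sym})%type.

Definition cell_init (mk : bool) (o : option bool) : cell :=
  (mk, tm_start M, [ffun i => if i == ord0 then omap inl o else None]).

Local Notation D := (#|cell|).
Local Notation K := (4 * D).
Local Notation Z := (shan_size K).
Local Notation CZ := (D * Z).

(** The first three cells are a column between its neighbors, the fourth is the column of the heads,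
    with the state and all scanned symbols. The heads of all tapes stay in this one column and a
    move shifts the tape instead: after a left move each symbol comes from the left neighbor. *)
Definition next_cell (cs : cell * cell * (cell * cell)) : cell :=
  let: (c1, c2, (c3, c4)) := cs in
  if tm_halt c4.1.2 then (c2.1.1, c4.1.2, c2.2) else
  let: (q, acts) := tm_trans c4.1.2 c4.2 in
  (c2.1.1, q, [ffun i => match (acts i).2 with
     | MoveLeft => if c1.1.1 then (acts i).1 else c1.2 i
     | Stay => if c2.1.1 then (acts i).1 else c2.2 i
     | MoveRight => if c3.1.1 then (acts i).1 else c3.2 i
     end]).

Definition tape_cell (t : tape (tm_aux M)) (ctr j : nat) : sym :=
  if j < ctr then nth None (tape_left t) (ctr - j).-1
  else nth None (tape_head t :: tape_right t) (j - ctr).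

Definition config_cell (c : config M) (ctr j : nat) : cell :=
  (j == ctr, c.1, [ffun i => tape_cell (c.2 i) ctr j]).

Lemma tape_cell_step (t : tape (tm_aux M)) a mv ctr j : 0 < j ->
  tape_cell (tape_write_move t (a, mv)) ctr j =
  match mv with
  | MoveLeft => if j.-1 == ctr then a else tape_cell t ctr j.-1
  | Stay => if j == ctr then a else tape_cell t ctr j
  | MoveRight => if j.+1 == ctr then a else tape_cell t ctr j.+1
  end.
Proof.
case: t => l h r; case: j => // j _; case: mv; rewrite /tape_cell /=.
- case: (ltngtP j ctr) => [lt|gt|->].
  + case: ltnP => le.
      by rewrite nth_behead; congr nth; lia.
    have -> : ctr = j.+1 by lia.
    by rewrite !subSnn subnn /= nth0.
  + have -> : (j.+1 < ctr) = false by lia.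
    have -> : j.+1 - ctr = (j - ctr.+1).+2 by lia.
    by have -> : j - ctr = (j - ctr.+1).+1 by lia.
  + by rewrite ltnNge leqnSn /= subSnn.
- case: (ltngtP j.+1 ctr) => // [gt|->]; last by rewrite subnn.
  by have -> : j.+1 - ctr = (j - ctr).+1 by lia.
- case: (ltngtP j.+2 ctr) => [lt|gt|<-].
  + by have -> : (ctr - j.+1).-1 = (ctr - j.+2).-1.+1 by lia.
  + have -> : j.+2 - ctr = (j.+1 - ctr).+1 by lia.
    by case: (j.+1 - ctr) => [|n] /=; rewrite ?nth0 // nth_behead.
  + by rewrite subSnn.
Qed.

Lemma next_config_cell (c : config M) ctr j : 0 < j ->
  next_cell (config_cell c ctr j.-1, config_cell c ctr j,
             (config_cell c ctr j.+1, config_cell c ctr ctr)) =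
  config_cell (tm_step c) ctr j.
Proof.
case: c => q ts j0; rewrite /next_cell /config_cell /tm_step /=.
case: ifP => // _.
have -> : [ffun i => tape_cell (ts i) ctr ctr] = [ffun i => tape_head (ts i)].
  by apply/ffunP => i; rewrite !ffunE /tape_cell ltnn subnn.
case: (tm_trans _ _) => q' acts /=; congr (_, _); apply/ffunP => i; rewrite !ffunE.
by case: (acts i) => a mv; rewrite tape_cell_step //=.
Qed.

Section Circuit.

Variables (T m : nat) (src : seq (bool * nat)) (inp base : nat).

(** Border columns are computed from wrong neighbors, and the error moves inward by one column per
    step. With the heads in column [T] and [T] spare columns on either side, columns [T] to [T + m],
    which hold the [m.+1] output bits, are still right after [T] steps. *)
Definition tab_width : nat := T + T + m.+1.
Local Notation W := tab_width.

Definition cell_base (t j : nat) : nat := base + (t * W + j) * CZ.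
Definition cvars (t j : nat) : seq nat := cell_vars cell (cell_base t j).

(* An input symbol [(true, i)] is bit [i] of the register at [inp], and
   [(false, b)] is a constant. *)
Definition src_val (s : nat -> bool) (p : bool * nat) : bool :=
  if p.1 then s (inp + p.2) else p.2 != 0.

Definition init_fun (mk var inr b : bool) (bits : seq bool) : cell :=
  cell_init mk (if var then Some (head false bits) else if inr then Some b else None).

(** [cell_gates] expects [K] addresses but [init_fun] reads at most the first, so one address is
    repeated; [inp] is the dummy when the cell is constant. *)
Definition init_gates (j : nat) : seq gate :=
  let p := nth (false, 0) src (j - T) in
  let inr := (T <= j) && (j - T < size src) in
  cell_gates (init_fun (j == T) (inr && p.1) inr (p.2 != 0))
    (nseq K (inp + if inr && p.1 then p.2 else 0)) (cell_base 0 j).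

Definition step_gates (t j : nat) : seq gate :=
  cell_gates (fun bits => next_cell (cells4 (cell_init false None) bits))
    (* At the borders the column itself replaces the missing neighbor; [row_ok] claims nothing about
       the columns this spoils. *)
    (cvars t j.-1 ++ cvars t j ++ cvars t (minn j.+1 W.-1) ++ cvars t T) (cell_base t.+1 j).

Definition out_base : nat := base + T.+1 * (W * CZ).

Definition out_fun (bits : seq bool) : bool :=
  (decode_cell (cell_init false None) (take D bits)).2 ord0 == Some (inl true).

Definition out_gates (i : nat) : seq gate :=
  shan K out_fun (cvars T (T + i) ++ nseq (D + D + D) inp) (out_base + i * Z).

Definition row_gates (t : nat) : seq gate :=
  flatten [seq if t is t'.+1 then step_gates t' j else init_gates j | j <- iota 0 W].

Definition circuit : seq gate :=
  flatten [seq row_gates t | t <- iota 0 T.+1] ++ flatten [seq out_gates i | i <- iota 0 m.+1].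

Definition out_var (i : nat) : nat := out_base + i * Z + Z.-1.

Lemma D_gt0 : 0 < D.
Proof. by apply/card_gt0P; exists (cell_init false None). Qed.

Lemma size_init_addrs x : size (nseq K (x : nat)) = K.
Proof. by rewrite size_nseq. Qed.

Lemma size_step_addrs t j1 j2 j3 j4 :
  size (cvars t j1 ++ cvars t j2 ++ cvars t j3 ++ cvars t j4) = K.
Proof. by rewrite !size_cat !size_cell_vars; lia. Qed.

Lemma size_out_addrs t j : size (cvars t j ++ nseq (D + D + D) inp) = K.
Proof. by rewrite size_cat size_cell_vars size_nseq; lia. Qed.

Lemma circuit_outs : [seq g.1 | g <- circuit] = iota base (T.+1 * (W * CZ) + m.+1 * Z).
Proof.
rewrite /circuit map_cat iotaD; congr (_ ++ _).
  apply: outs_flatten => t _; apply: outs_flatten => j _.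
  have -> : base + t * (W * CZ) + j * CZ = cell_base t j.
    by rewrite /cell_base mulnDl mulnA addnA.
  by case: t => [|t]; rewrite cell_gates_outs.
by apply: outs_flatten => i _; rewrite shan_outs.
Qed.

Lemma size_circuit : size circuit = T.+1 * (W * CZ) + m.+1 * Z.
Proof. by have := congr1 size circuit_outs; rewrite size_map size_iota. Qed.

Lemma cvars_lt t j x : x \in cvars t j -> j < W -> base <= x < base + t.+1 * (W * CZ).
Proof.
move=> /cell_vars_range /andP[b1 b2] jW; rewrite /cell_base in b1 b2.
rewrite (leq_trans (leq_addr _ _) b1) /= (leq_trans b2) // -addnA leq_add2l -mulSnr [X in _ <= X]mulnA.
by rewrite leq_mul2r mulSn; apply/orP; right; lia.
Qed.

Lemma cvars_lt_out t j g x : x \in cvars t j -> j < W ->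
  base + t.+1 * (W * CZ) <= g -> base <= x < g.
Proof.
by move=> xc jW bg; have /andP[-> b2] := cvars_lt xc jW; exact: leq_trans b2 bg.
Qed.

Lemma circuit_wf : 0 < m -> all (fun p => p.1 ==> (p.2 < m)) src ->
  wf_gates inp (inp + m) base circuit.
Proof.
move=> m0 srcm; split; first by rewrite circuit_outs size_circuit.
have W0 : 0 < W by rewrite /tab_width addnS.
have inpP x : (x \in nseq K (inp + 0)) || (x \in nseq (D + D + D) inp) -> inp <= x < inp + m.
  by rewrite !mem_nseq addn0 => /orP[]/andP[_ /eqP->]; rewrite leqnn; lia.
move=> g; rewrite mem_cat => /orP[]/flattenP[S /mapP[t]]; last first.
  rewrite mem_iota add0n => /andP[_ tm] -> gS x /(shan_inp (size_out_addrs _ _) gS); rewrite mem_cat.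
  have gb : out_base <= g.1.
    have := map_f fst gS; rewrite shan_outs mem_iota => /andP[b1 _].
    exact: leq_trans (leq_addr _ _) b1.
  move=> /orP[/orP[xc|xi]|/andP[b1 ->]].
  - have tW : T + t < W by rewrite /tab_width; lia.
    by rewrite (cvars_lt_out xc tW) ?orbT.
  - by rewrite inpP ?xi ?orbT.
  - have bo : base <= out_base by exact: leq_addr.
    by rewrite (leq_trans (leq_trans bo (leq_addr _ _)) b1) orbT.
rewrite mem_iota add0n => /andP[_ tT] -> /flattenP[S' /mapP[j]].
rewrite mem_iota add0n => /andP[_ jW] -> gS x.
case: t tT gS => [|t] tT gS.
  move=> /(cell_gates_inp (size_init_addrs _) gS)/orP[|/andP[b1 ->]]; last first.
    by rewrite (leq_trans (leq_addr _ _) b1) orbT.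
  rewrite mem_nseq => /andP[_ /eqP->]; case: ifP => [/andP[/andP[_ lt] pv]|_].
    have := allP srcm _ (mem_nth (false, 0) lt); rewrite pv /= => pm.
    by rewrite leq_addr ltn_add2l pm.
  by rewrite addn0 leqnn; apply/orP; left; lia.
move=> /(cell_gates_inp (size_step_addrs _ _ _ _ _) gS)/orP[|/andP[b1 ->]]; last first.
  by rewrite (leq_trans (leq_addr _ _) b1) orbT.
have gb : base + t.+1 * (W * CZ) <= g.1.
  have /andP[b1 _] := cell_gates_range gS; apply: leq_trans b1.
  by rewrite /cell_base leq_add2l mulnA leq_mul2r leq_addr orbT.
by rewrite !mem_cat => /or4P[]/cvars_lt_out H; rewrite (H _ _ gb) ?orbT //;
  rewrite /tab_width in jW *; lia.
Qed.

Lemma leading_bits_nth (u : seq sym) i : i < size (leading_bits u) ->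
  nth None u i = Some (inl (nth false (leading_bits u) i)).
Proof. by elim: u i => //= -[[b|a]|] u IH [|i] //= /IH. Qed.

Lemma nth_head_behead (u : seq sym) n : nth None (head None u :: behead u) n = nth None u n.
Proof. by case: u n => [|a u] [|n] //=; rewrite nth_nil. Qed.

Lemma init_fun_cell s j :
  let p := nth (false, 0) src (j - T) in
  let inr := (T <= j) && (j - T < size src) in
  init_fun (j == T) (inr && p.1) inr (p.2 != 0)
    [seq s x | x <- nseq K (inp + if inr && p.1 then p.2 else 0)] =
  config_cell (tm_init M [seq src_val s p | p <- src]) T j.
Proof.
move=> p inr; rewrite /init_fun /cell_init /config_cell /=; congr (_, _).
apply/ffunP => i; rewrite !ffunE /tape_cell map_nseq.
have -> : head false (nseq K (s (inp + if inr && p.1 then p.2 else 0))) =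
    s (inp + if inr && p.1 then p.2 else 0).
  by have := D_gt0; case: D.
rewrite /tape_of nth_head_behead; case: ifP => [_|_]; last by rewrite !nth_nil if_same.
rewrite /inr; case: (ltnP j T) => [jT|Tj] /=; first by rewrite nth_nil.
case: ltnP => [lt|ge] /=; last by rewrite nth_default // !size_map.
rewrite -map_comp (nth_map (false, 0)) //= /src_val -/p.
by case: (p.1).
Qed.

Lemma row_ok s t j : gates_ok s circuit -> t <= T -> t <= j < W - t ->
  [seq s x | x <- cvars t j] =
  cell_code (config_cell (iter t (@tm_step M) (tm_init M [seq src_val s p | p <- src])) T j).
Proof.
move=> /gates_ok_cat[ok _].
have okr t' j' : t' <= T -> j' < W ->
    gates_ok s (if t' is t''.+1 then step_gates t'' j' else init_gates j').
  move=> tT jW.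
  have := @gates_ok_flatten _ s row_gates (iota 0 T.+1) t' ok.
  rewrite mem_iota add0n ltnS tT => /(_ isT) ok1.
  have := @gates_ok_flatten _ s (fun j => if t' is t''.+1 then step_gates t'' j else init_gates j)
            (iota 0 W) j' ok1.
  by rewrite mem_iota add0n jW => /(_ isT).
elim: t j => [|t IH] j tT jr.
  have jW : j < W by lia.
  rewrite /= -init_fun_cell.
  by apply: cell_gates_ok (okr 0 j tT jW) _; rewrite size_nseq.
have jW : j < W by lia.
rewrite iterS -next_config_cell; last by lia.
have ht : t <= T by exact: ltnW.
have := cell_gates_ok (okr t.+1 j tT jW) (size_step_addrs _ _ _ _ _).
rewrite -/(cvars t.+1 j) => ->; congr cell_code; rewrite !map_cat.
have -> : minn j.+1 W.-1 = j.+1 by lia.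
rewrite !IH ?cells4E //; move: jr; rewrite /tab_width; lia.
Qed.

Lemma circuit_ok s i :
  let c := iter T (@tm_step M) (tm_init M [seq src_val s p | p <- src]) in
  gates_ok s circuit -> size (tm_output c) = m.+1 -> i <= m ->
  s (out_var i) = nth false (tm_output c) i.
Proof.
move=> c ok sz im; have /gates_ok_cat[_ ok2] := ok.
have := @gates_ok_flatten _ s out_gates (iota 0 m.+1) i ok2.
rewrite mem_iota add0n ltnS im => /(_ isT) ok3.
rewrite /out_var (shan_ok ok3 (size_out_addrs _ _)) map_cat (row_ok ok (leqnn T)); last first.
  by rewrite /tab_width; lia.
rewrite /out_fun take_size_cat ?size_cell_code // cell_codeK /config_cell /= ffunE /tape_cell.
rewrite ltnNge leq_addr /= addKn -/c.
have := @leading_bits_nth (tape_head (c.2 ord0) :: tape_right (c.2 ord0)) i.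
rewrite -/(tm_output c) sz ltnS im => /(_ isT) ->.
by case: (nth false _ i).
Qed.

End Circuit.

(** [Poly_cell_gates] is for a fixed table, so the four input-dependent Booleans that select a table
    are split into sixteen constant cases. *)
Lemma Poly_bool4 X B (EX : Enc X) (EB : Enc B) (f : bool -> bool -> bool -> bool -> X -> B)
    (c1 c2 c3 c4 : X -> bool) :
  (forall b1 b2 b3 b4, Poly (f b1 b2 b3 b4)) -> Poly c1 -> Poly c2 -> Poly c3 -> Poly c4 ->
  Poly (fun x => f (c1 x) (c2 x) (c3 x) (c4 x) x).
Proof.
move=> pf p1 p2 p3 p4.
apply: (Poly_bool (f := fun b x => f b (c2 x) (c3 x) (c4 x) x)) => //.
- apply: (Poly_bool (f := fun b x => f true b (c3 x) (c4 x) x)) => //.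
  + apply: (Poly_bool (f := fun b x => f true true b (c4 x) x)) => //.
    * by apply: (Poly_bool (f := fun b x => f true true true b x)).
    * by apply: (Poly_bool (f := fun b x => f true true false b x)).
  + apply: (Poly_bool (f := fun b x => f true false b (c4 x) x)) => //.
    * by apply: (Poly_bool (f := fun b x => f true false true b x)).
    * by apply: (Poly_bool (f := fun b x => f true false false b x)).
- apply: (Poly_bool (f := fun b x => f false b (c3 x) (c4 x) x)) => //.
  + apply: (Poly_bool (f := fun b x => f false true b (c4 x) x)) => //.
    * by apply: (Poly_bool (f := fun b x => f false true true b x)).
    * by apply: (Poly_bool (f := fun b x => f false true false b x)).
  + apply: (Poly_bool (f := fun b x => f false false b (c4 x) x)) => //.
    * by apply: (Poly_bool (f := fun b x => f false false true b x)).
    * by apply: (Poly_bool (f := fun b x => f false false false b x)).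
Qed.

Lemma Poly_circuit X (EX : Enc X) (T m inp base : X -> nat) (src : X -> seq (bool * nat)) :
  Poly T -> Poly m -> Poly src -> Poly inp -> Poly base ->
  Poly (fun x => circuit (T x) (m x) (src x) (inp x) (base x)).
Proof.
move=> pT pm ps pi pb.
apply: (Poly_ext (f := fun x =>
  flatten [seq flatten [seq if t == 0 then init_gates (T x) (m x) (src x) (inp x) (base x) j
                            else step_gates (T x) (m x) (base x) t.-1 j
                       | j <- iota 0 (tab_width (T x) (m x))] | t <- iota 0 (T x).+1] ++
  flatten [seq out_gates (T x) (m x) (inp x) (base x) i | i <- iota 0 (m x).+1])).
  move=> x; congr (flatten _ ++ _); apply: eq_map => -[|t]; exact.
rewrite /tab_width; apply: Poly_cat; apply: Poly_flatten; apply: Poly_map; [|by poly| |by poly].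
  apply: Poly_flatten; apply: Poly_map; last by poly.
  apply: Poly_if; first by poly.
    rewrite /init_gates; apply: (Poly_bool4
      (f := fun b1 b2 b3 b4 (p : X * nat * nat) => cell_gates (init_fun b1 b2 b3 b4) _ _)).
    + move=> b1 b2 b3 b4; have pc := Poly_cell_gates (init_fun b1 b2 b3 b4).
      apply: (Poly_app2 pc); rewrite /cell_base /tab_width; by poly.
    + by poly.
    + by poly.
    + by poly.
    + by poly.
  have pc := Poly_cell_gates (fun bits => next_cell (cells4 (cell_init false None) bits)).
  by apply: (Poly_app2 pc); rewrite /cvars /cell_vars /cell_base /tab_width; poly.
have ps' := Poly_shan K out_fun.
by apply: (Poly_app2 ps'); rewrite /cvars /cell_vars /out_base /cell_base /tab_width; poly.
Qed.

End Tableau.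

(** * Construction in polynomial time and clause width of the formula *)

Lemma Poly_gates_clauses X (EX : Enc X) (ctl : clause) (gs : X -> seq gate) :
  Poly gs -> Poly (fun x => gates_clauses ctl (gs x)).
Proof. by move=> pg; rewrite /gates_clauses /gate_clauses; poly. Qed.

Lemma Poly_formula X (EX : Enc X) (m wA wB n0 : X -> nat) (z : nat) (init : X -> seq bool)
    (gA gB : X -> seq gate) :
  Poly m -> Poly wA -> Poly wB -> Poly n0 -> Poly init -> Poly gA -> Poly gB ->
  Poly (fun x => formula (m x) (init x) (gA x) (gB x) (wA x) (wB x) (n0 x) z).
Proof.
move=> pm pa pb pn pi pgA pgB.
have h1 := Poly_gates_clauses [:: (0, false)] pgA; have h2 := Poly_gates_clauses [:: (1, false)] pgB.
have h3 := Poly_gates_clauses [::] pgA; have h4 := Poly_gates_clauses [::] pgB.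
by rewrite /formula /level /bound_cl /cmp_def /copy_cl; poly.
Qed.

Lemma kcnf_cat k F G : kcnf k (F ++ G) = kcnf k F && kcnf k G.
Proof. exact: all_cat. Qed.

Lemma kcnf_flatten k (I : Type) (f : I -> seq clause) (r : seq I) :
  (forall i, kcnf k (f i)) -> kcnf k (flatten [seq f i | i <- r]).
Proof. by move=> H; elim: r => //= i r IH; rewrite kcnf_cat H. Qed.

Lemma kcnf_gates ctl gs : size ctl <= 1 -> kcnf 4 (gates_clauses ctl gs).
Proof.
move=> sz; apply: kcnf_flatten => g; rewrite /kcnf /gate_clauses.
by case: ifP => _ /=; rewrite !size_cat /=; lia.
Qed.

Lemma kcnf_formula4 m init gA gB wA wB n0 z : kcnf 4 (formula m init gA gB wA wB n0 z).
Proof.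
rewrite /formula !kcnf_cat !kcnf_gates //=.
by rewrite !kcnf_flatten // => j; rewrite /level /kcnf /=.
Qed.

(** * Binary values in lexicographic order *)

Definition bits_lt (u v : seq bool) : bool :=
  has (fun i => [&& ~~ nth false u i, nth false v i
                  & all (fun j => nth false u j == nth false v j) (iota 0 i)]) (iota 0 (size u)).

Lemma bits_ltP u v : reflect (exists i, [/\ i < size u,
    forall j, j < i -> nth false u j = nth false v j, nth false u i = false & nth false v i = true])
  (bits_lt u v).
Proof.
apply: (iffP hasP) => [[i]|[i [iu pre ui vi]]].
  rewrite mem_iota add0n => /andP[_ iu] /and3P[/negbTE ui vi /allP pre].
  by exists i; split=> // j ji; apply/eqP; apply: pre; rewrite mem_iota.
exists i; first by rewrite mem_iota.
by rewrite ui vi; apply/allP => j; rewrite mem_iota add0n => /andP[_ /pre->].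
Qed.

Lemma Poly_bits_lt X (EX : Enc X) (f g : X -> seq bool) :
  Poly f -> Poly g -> Poly (fun x => bits_lt (f x) (g x)).
Proof. by move=> pf pg; rewrite /bits_lt; poly. Qed.

Fixpoint bits_val (u : seq bool) : nat :=
  if u is b :: u' then b * 2 ^ size u' + bits_val u' else 0.

Lemma bits_val_lt u : bits_val u < 2 ^ size u.
Proof. by elim: u => //= b u IH; rewrite expnS; case: b; lia. Qed.

Lemma bits_lt_val u v : size u = size v -> bits_val u < bits_val v -> bits_lt u v.
Proof.
elim: u v => [|b u IH] [|c v] //= sz lt; apply/bits_ltP.
have {}sz : size u = size v by case: sz.
have [e|ne] := eqVneq b c.
  have /bits_ltP[i [iu pre ui vi]] : bits_lt u v.
    by apply: IH => //; move: lt; rewrite e sz ltn_add2l.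
  by exists i.+1; split=> // -[|j] //=; exact: pre.
case: b c ne lt => [] [] //= _ lt; last by exists 0.
by have := bits_val_lt v; rewrite -sz; move: lt; lia.
Qed.

Lemma bits_val_rcons u b : bits_val (rcons u b) = b + (bits_val u).*2.
Proof.
elim: u => [|c u IH] /=; first by rewrite muln1 addn0.
by rewrite IH size_rcons expnS; case: c; lia.
Qed.

Lemma bits_val_enc_nat n : bits_val (rev (enc_nat n)) = n.
Proof.
elim/ltn_ind: n => n IH; rewrite -{1}(odd_double_half n) enc_nat_double.
case: ifP => [/andP[/eqP e /negbTE o]|nz].
  by rewrite -(odd_double_half n) e o.
rewrite rev_cons bits_val_rcons IH ?odd_double_half //.
rewrite -{2}(odd_double_half n); move: nz.
by case: (n./2) => [|k]; [case: (odd n) | move=> _; case: (odd n); rewrite /= ?doubleS; lia].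
Qed.

Lemma bits_val_pad k u : bits_val (nseq k false ++ u) = bits_val u.
Proof. by elim: k => //= k ->; rewrite mul0n. Qed.

(** Complementing the bits reverses the order, which turns minimization into maximization. *)
Lemma bits_lt_negb u v : size u = size v -> bits_lt u v -> bits_lt (map negb v) (map negb u).
Proof.
move=> sz /bits_ltP[i [iu pre ui vi]]; apply/bits_ltP; exists i; rewrite size_map -sz; split=> //.
- move=> j ji; rewrite !(nth_map false) -?sz ?(ltn_trans ji) //.
  by rewrite pre.
- by rewrite (nth_map false) -?sz // vi.
- by rewrite (nth_map false) // ui.
Qed.

(** [lsb_bits] strips leading zeros and reverses, so besides printing numbers it can remove the
    padding of a solution. *)
Lemma lsb_bits_pad k r : lsb_bits (nseq k false ++ true :: r) = rev (true :: r).
Proof.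
have H acc : ~~ nilp acc ->
    foldl (fun acc b => if nilp acc && ~~ b then [::] else b :: acc) acc r = catrev r acc.
  by elim: r acc => //= b r IH acc nz; rewrite (negbTE nz) IH.
by rewrite /lsb_bits; elim: k => [|k IH] //=; exact: H.
Qed.

(** * The reduction *)

Section Reduction.

Variable P : local_search.

Definition pair_str (X s : seq bool) : seq bool := enc_seq [:: X; s].

Lemma size_pair_str X s : size (pair_str X s) = 2 * size X + 2 * size s + 2.
Proof. by rewrite /pair_str /enc_seq /= cats0 size_cat !size_enc_str; lia. Qed.

Section Solutions.

Variables (cs ks cq kq : nat) (Ff Fi Fp Fn : seq bool -> seq bool).
Hypotheses (pFf : Poly Ff) (pFi : Poly Fi) (pFp : Poly Fp) (pFn : Poly Fn).
Variables (init : instance P -> seq bool) (nbrs : instance P * seq bool -> seq (seq bool)).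
Hypothesis solution_size : forall (x : instance P) s,
  feasible x s -> size s <= cs * size (enc_instance x) ^ ks + cs.
Hypothesis payoff_size : forall (x : instance P) s, feasible x s ->
  size (enc_nat (payoff x s)) <= cq * size (enc_instance x) ^ kq + cq.
Hypothesis FfE : forall (x : instance P) s, Ff (pair_str (enc_instance x) s) = [:: feasible x s].
Hypothesis init_feasible : forall x, feasible x (init x).
Hypothesis FiE : forall x : instance P, Fi (enc_instance x) = init x.
Hypothesis FpE : forall (x : instance P) s, feasible x s ->
  Fp (pair_str (enc_instance x) s) = enc_nat (payoff x s).
Hypothesis nbrsE : forall x s, feasible x s -> nbrs (x, s) =i neighbor x s.
Hypothesis FnE : forall (x : instance P) s, feasible x s ->
  Fn (pair_str (enc_instance x) s) = enc_seq (nbrs (x, s)).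

Definition sol_len (X : seq bool) : nat := cs * size X ^ ks + cs.
Definition val_len (X : seq bool) : nat := cq * size X ^ kq + cq.
Definition reg_len (X : seq bool) : nat := val_len X + (sol_len X).+1.

Definition val_bits (X s : seq bool) : seq bool :=
  let b := Fp (pair_str X s) in
  let u := nseq (val_len X - size b) false ++ rev b in
  if maximize P then u else map negb u.

(** The bit [true] marks the end of the solution, whose own last bits may be [false]. Solutions of
    different lengths thus fit one register length. *)
Definition pad (X s : seq bool) : seq bool := s ++ true :: nseq (sol_len X - size s) false.
Definition unpad (w : seq bool) : seq bool := rev (behead (rev (lsb_bits (rev w)))).

Lemma padK X s : unpad (pad X s) = s.
Proof.
rewrite /unpad /pad rev_cat rev_cons rev_nseq cat_rcons lsb_bits_pad revK /=.
by rewrite revK.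
Qed.

(* A register holds the value of a solution, followed by the padded solution. *)
Definition enc_sol (X s : seq bool) : seq bool := val_bits X s ++ pad X s.
Definition dec_sol (X A : seq bool) : seq bool := unpad (drop (val_len X) A).

(** Feasibility alone would let a register claim a false value; equality with the canonical encoding
    makes the value part trustworthy and fixes the length. *)
Definition sol_valid (X A : seq bool) : bool :=
  (Ff (pair_str X (dec_sol X A)) == [:: true]) && (A == enc_sol X (dec_sol X A)).

Definition sol_better (X A : seq bool) : seq (seq bool) :=
  [seq s' <- dec_seq (Fn (pair_str X (dec_sol X A)))
  | bits_lt (val_bits X (dec_sol X A)) (val_bits X s')].

(** Invalid registers are left unchanged, so a register of the right length always yields an output
    of the right length, as the circuit requires. *)
Definition sol_next (X A : seq bool) : seq bool :=
  if sol_valid X A && ~~ nilp (sol_better X A)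
  then enc_sol X (head [::] (sol_better X A)) else A.

Definition step_fun (w : seq bool) : seq bool :=
  sol_valid (nth [::] (dec_seq w) 0) (nth [::] (dec_seq w) 1) ::
  sol_next (nth [::] (dec_seq w) 0) (nth [::] (dec_seq w) 1).

Lemma Poly_pair_str X (EX : Enc X) (f g : X -> seq bool) :
  Poly f -> Poly g -> Poly (fun x => pair_str (f x) (g x)).
Proof. by move=> pf pg; have pe := Poly_enc_seq; rewrite /pair_str; poly. Qed.

Lemma Poly_val_bits X (EX : Enc X) (f g : X -> seq bool) :
  Poly f -> Poly g -> Poly (fun x => val_bits (f x) (g x)).
Proof.
move=> pf pg; have pp := Poly_pair_str pf pg; have pq := Poly_comp pp pFp.
by rewrite /val_bits /val_len; case: (maximize P); poly.
Qed.

Lemma Poly_enc_sol X (EX : Enc X) (f g : X -> seq bool) :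
  Poly f -> Poly g -> Poly (fun x => enc_sol (f x) (g x)).
Proof.
by move=> pf pg; have pp := Poly_val_bits pf pg; rewrite /enc_sol /pad /sol_len; poly.
Qed.

Lemma Poly_dec_sol X (EX : Enc X) (f g : X -> seq bool) :
  Poly f -> Poly g -> Poly (fun x => dec_sol (f x) (g x)).
Proof.
by move=> pf pg; have pl := Poly_lsb_bits; rewrite /dec_sol /unpad /val_len; poly.
Qed.

Lemma Poly_step_fun : Poly step_fun.
Proof.
have pd := Poly_dec_seq.
have p0 : Poly (fun w : seq bool => nth [::] (dec_seq w) 0) by poly.
have p1 : Poly (fun w : seq bool => nth [::] (dec_seq w) 1) by poly.
have ps := Poly_dec_sol p0 p1; have pe := Poly_enc_sol p0 ps; have pp := Poly_pair_str p0 ps.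
have pb : Poly (fun w => sol_better (nth [::] (dec_seq w) 0) (nth [::] (dec_seq w) 1)).
  apply: Poly_filter; last by poly.
  have pv1 := Poly_on_fst (A := seq bool) (EA := Enc_list Enc_bool) (Poly_val_bits p0 ps).
  have pv2 : Poly (fun p : seq bool * seq bool => val_bits (nth [::] (dec_seq p.1) 0) p.2).
    by apply: Poly_val_bits; poly.
  exact: Poly_bits_lt.
have ph : Poly (fun w => head [::] (sol_better (nth [::] (dec_seq w) 0) (nth [::] (dec_seq w) 1))).
  exact: Poly_head.
have pn := Poly_enc_sol p0 ph.
by rewrite /step_fun /sol_valid /sol_next; poly.
Qed.

Section Instance.

Variable x : instance P.
Local Notation X := (enc_instance x).

Lemma size_val_bits s : feasible x s -> size (val_bits X s) = val_len X.
Proof.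
move=> fs; have := payoff_size fs; rewrite /val_bits FpE // -/(val_len X) => le.
by case: (maximize P); [|rewrite size_map]; rewrite size_cat size_nseq size_rev subnK.
Qed.

Lemma size_pad s : feasible x s -> size (pad X s) = (sol_len X).+1.
Proof.
move=> /solution_size le; rewrite /pad size_cat /= size_nseq addnS subnKC //.
Qed.

Lemma size_enc_sol s : feasible x s -> size (enc_sol X s) = reg_len X.
Proof. by move=> fs; rewrite size_cat size_val_bits // size_pad. Qed.

Lemma enc_solK s : feasible x s -> dec_sol X (enc_sol X s) = s.
Proof. by move=> fs; rewrite /dec_sol /enc_sol drop_size_cat ?size_val_bits // padK. Qed.

Lemma enc_sol_valid s : feasible x s -> sol_valid X (enc_sol X s).
Proof. by move=> fs; rewrite /sol_valid enc_solK // FfE fs !eqxx. Qed.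

Lemma sol_validP A : sol_valid X A ->
  feasible x (dec_sol X A) /\ A = enc_sol X (dec_sol X A).
Proof. by rewrite /sol_valid FfE => /andP[/eqP[->] /eqP]. Qed.

Lemma sol_betterP A s' : sol_valid X A -> s' \in sol_better X A ->
  feasible x s' /\ bits_lt (val_bits X (dec_sol X A)) (val_bits X s').
Proof.
move=> /sol_validP[fs _]; rewrite mem_filter FnE // dec_seqK nbrsE // => /andP[-> nb].
by split=> //; exact: neighbor_feasible nb.
Qed.

Lemma head_sol_better A : ~~ nilp (sol_better X A) ->
  head [::] (sol_better X A) \in sol_better X A.
Proof. by case: (sol_better X A) => //= a l _; rewrite mem_head. Qed.

Lemma sol_next_valid A : sol_valid X A -> sol_valid X (sol_next X A).
Proof.
move=> vA; rewrite /sol_next vA; case: ifP => // /head_sol_better h.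
by apply: enc_sol_valid; have [] := sol_betterP vA h.
Qed.

Lemma sol_valid_size A : sol_valid X A -> size A = reg_len X.
Proof. by move=> /sol_validP[fs ->]; exact: size_enc_sol. Qed.

Lemma sol_next_better A : sol_valid X A -> sol_next X A = A \/
  exists i, [/\ i < reg_len X, forall j, j < i -> nth false A j = nth false (sol_next X A) j,
    nth false A i = false & nth false (sol_next X A) i = true].
Proof.
move=> vA; rewrite /sol_next vA /=; case: ifP => [/head_sol_better h|_]; last by left.
have [fs' /bits_ltP[i [iu pre ui vi]]] := sol_betterP vA h.
have [fs eA] := sol_validP vA; have su := size_val_bits fs; have sv := size_val_bits fs'.
rewrite su in iu.
have nA j : j < val_len X -> nth false A j = nth false (val_bits X (dec_sol X A)) j.
  by move=> jl; rewrite {1}eA /enc_sol nth_cat su jl.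
right; exists i; split.
- by rewrite /reg_len (leq_trans iu) ?leq_addr.
- by move=> j ji; have jl := ltn_trans ji iu; rewrite nA // nth_cat sv jl; exact: pre.
- by rewrite nA.
- by rewrite nth_cat sv iu.
Qed.

Lemma better_bits_lt s s' : feasible x s -> feasible x s' -> better x s' s ->
  bits_lt (val_bits X s) (val_bits X s').
Proof.
move=> fs fs'; have := size_val_bits fs; have := size_val_bits fs'.
rewrite /better /val_bits !FpE //; case: ifP => _ s1 s2 lt.
  by apply: bits_lt_val; rewrite ?s1 // !bits_val_pad !bits_val_enc_nat.
apply: bits_lt_negb; first by move: s1 s2; rewrite !size_map => -> ->.
apply: bits_lt_val; last by rewrite !bits_val_pad !bits_val_enc_nat.
by move: s1 s2; rewrite !size_map => -> ->.
Qed.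

(** If a better neighbor had been chosen, decoding the unchanged register would return that
    neighbor, and its value would be strictly larger than itself. *)
Lemma sol_next_fixed A : sol_valid X A -> sol_next X A = A ->
  local_optimum x (dec_sol X A).
Proof.
move=> vA; have [fs eA] := sol_validP vA; rewrite /sol_next vA /=.
case: ifP => [/head_sol_better h e|/negbFE/nilP nl _]; last first.
  split=> // s' nb; apply/negP => bt.
  have fs' : feasible x s' by exact: neighbor_feasible nb.
  have : s' \in sol_better X A.
    by rewrite mem_filter FnE // dec_seqK nbrsE // better_bits_lt.
  by rewrite nl.
have [fs' lt] := sol_betterP vA h.
have : dec_sol X (enc_sol X (head [::] (sol_better X A))) = dec_sol X A by rewrite e.
rewrite enc_solK // => e2; move: lt; rewrite e2 => /bits_ltP[i [_ _ -> //]].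
Qed.

End Instance.

Section Machine.

Variables (M : turing_machine) (c e : nat).
Hypothesis machine : forall w, computes_within M (c * size w ^ e + c) w (step_fun w).

Definition time_of (X : seq bool) : nat := c * (2 * size X + 2 * reg_len X + 2) ^ e + c.

(** The machine reads [pair_str X A] with [A] still unknown: [enc_str] writes [true] before every
    bit and [false] at the end, so constants alternate with references to the register. *)
Definition source (X : seq bool) : seq (bool * nat) :=
  [seq (false, if b then 1 else 0) | b <- enc_str X] ++
  flatten [seq [:: (false, 1); (true, j)] | j <- iota 0 (reg_len X)] ++ [:: (false, 0)].

Definition circ (X : seq bool) (inp base : nat) : seq gate :=
  circuit M (time_of X) (reg_len X) (source X) inp base.

Local Notation ov X base i := (out_var M (time_of X) (reg_len X) base i).
Local Notation baseA X := (3 + reg_len X + reg_len X + reg_len X).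
Local Notation baseB X := (3 + reg_len X + reg_len X + reg_len X + size (circ X 2 (baseA X))).

(** Output 0 of a circuit is the validity bit, so the successor starts at output 1; consecutive
    outputs are one Shannon expansion apart. *)
Definition reduction (X : seq bool) : cnf :=
  formula (reg_len X) (enc_sol X (Fi X))
    (circ X 2 (baseA X)) (circ X (2 + reg_len X) (baseB X))
    (ov X (baseA X) 0) (ov X (baseB X) 0) (ov X (baseA X) 1) (shan_size (4 * #|cell M|)).

Definition back (w : seq bool) : seq bool :=
  dec_sol (nth [::] (dec_seq w) 0)
    [seq nth false (nth [::] (dec_seq w) 1) (2 + j) | j <- iota 0 (reg_len (nth [::] (dec_seq w) 0))].

Lemma Poly_reg_len Y (EY : Enc Y) (f : Y -> seq bool) : Poly f -> Poly (fun y => reg_len (f y)).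
Proof. by move=> pf; rewrite /reg_len /val_len /sol_len; poly. Qed.

Lemma Poly_reduction : Poly reduction.
Proof.
have pm : Poly reg_len by exact: Poly_reg_len (@Poly_id _ _).
have pT : Poly time_of by rewrite /time_of; poly.
have pe := Poly_enc_str.
have ps : Poly source by rewrite /source; poly.
have pA : Poly (fun X => circ X 2 (baseA X)) by apply: Poly_circuit; poly.
have pB : Poly (fun X => circ X (2 + reg_len X) (baseB X)) by apply: Poly_circuit; poly.
apply: Poly_formula => //; try by rewrite /out_var /out_base /tab_width; poly.
by apply: Poly_enc_sol => //; exact: Poly_id.
Qed.

Lemma Poly_back : Poly back.
Proof.
have pd := Poly_dec_seq.
have p0 : Poly (fun w : seq bool => nth [::] (dec_seq w) 0) by poly.
have pm := Poly_reg_len p0.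
by apply: Poly_dec_sol => //; poly.
Qed.

Lemma source_val X s inp : [seq src_val inp s p | p <- source X] =
  pair_str X (read (reg_len X) s inp).
Proof.
rewrite /source !map_cat -map_comp /pair_str /enc_seq /= cats0; congr (_ ++ _).
  by rewrite -[RHS]map_id; apply: eq_map => -[].
rewrite /enc_str /read -cats1; congr (_ ++ _).
rewrite map_flatten -!map_comp; congr flatten; exact: eq_map.
Qed.

Lemma source_range X : all (fun p => p.1 ==> (p.2 < reg_len X)) (source X).
Proof.
rewrite /source !all_cat /= andbT all_map; apply/andP; split; first by apply/allP.
apply/allP => p /flattenP[S /mapP[j]]; rewrite mem_iota add0n => /andP[_ jm] ->.
by rewrite !inE => /orP[]/eqP->.
Qed.

Lemma reg_len_gt0 X : 0 < reg_len X.
Proof. by rewrite /reg_len addnS. Qed.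

Lemma ov_range X inp base i : i <= reg_len X -> base <= ov X base i < base + size (circ X inp base).
Proof.
move=> im; rewrite size_circuit /out_var /out_base.
set Z := shan_size _; have Z0 : 0 < Z := shan_size_gt0 _.
have : i.+1 * Z <= (reg_len X).+1 * Z by rewrite leq_mul2r ltnS im orbT.
by rewrite mulSn; set a := _.+1 * (_ * _); set b := _.+1 * Z; move: (i * Z) a b => d a b; lia.
Qed.

Lemma circ_sem (x : instance P) s inp base :
  let X := enc_instance x in let A := read (reg_len X) s inp in
  gates_ok s (circ X inp base) -> s (ov X base 0) = sol_valid X A /\
  forall j, j < reg_len X -> s (ov X base 1 + j * shan_size (4 * #|cell M|)) =
    nth false (sol_next X A) j.
Proof.
move=> X A ok; have [_ out] := machine (pair_str X A).
have szA : size A = reg_len X by rewrite size_mkseq.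
rewrite size_pair_str szA -/(time_of X) -source_val in out.
have szo : size (step_fun [seq src_val inp s p | p <- source X]) = (reg_len X).+1.
  rewrite source_val /step_fun /pair_str dec_seqK /=; congr _.+1.
  rewrite -/X -/A /sol_next; case: ifP => // /andP[vA /head_sol_better h].
  by rewrite size_enc_sol //; have [] := sol_betterP vA h.
have okc i : i <= reg_len X -> s (ov X base i) = nth false (sol_valid X A :: sol_next X A) i.
  move=> im; rewrite (circuit_ok ok) ?out // source_val /step_fun /pair_str dec_seqK.
  by [].
split=> [|j jm]; first exact: okc.
have -> : ov X base 1 + j * shan_size (4 * #|cell M|) = ov X base j.+1.
  by rewrite /out_var mul1n mulSn; lia.
exact: (okc j.+1 jm).
Qed.

Lemma reduction_correct (x : instance P) s :
  let X := enc_instance x in size s = nvars (reduction X) ->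
  (forall s', flip_neighbor 1 s s' ->
     ~~ (lex_payoff (reduction X) s < lex_payoff (reduction X) s')) ->
  local_optimum x (back (pair_str X s)).
Proof.
move=> X sz opt; have st := local_opt_stable sz opt.
have m0 := reg_len_gt0 X; have fi : feasible x (Fi X) by rewrite FiE.
have wfA := circuit_wf M (time_of X) 2 (baseA X) m0 (source_range X).
have wfB := circuit_wf M (time_of X) (2 + reg_len X) (baseB X) m0 (source_range X).
have vs A : sol_valid X A -> size A = reg_len X by exact: sol_valid_size.
have [v nx] : sol_valid X (read (reg_len X) (nth false s) 2) /\
    sol_next X (read (reg_len X) (nth false s) 2) = read (reg_len X) (nth false s) 2.
  apply: (stable_formula wfA wfB _ _ _ _ _ _ _ _ _ _ st).
  - exact: ov_range.
  - exact: ov_range.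
  - move=> j jm; have := @ov_range X 2 (baseA X) j.+1 jm.
    congr (_ <= _ < _); rewrite /out_var mul1n mulSn; lia.
  - by move=> s' ok; exact: circ_sem ok.
  - by move=> s' ok; have [] := circ_sem ok.
  - exact: size_enc_sol.
  - exact: enc_sol_valid.
  - by move=> A _ vA; apply: vs; exact: sol_next_valid.
  - by move=> A _; exact: sol_next_valid.
  - by move=> A _; exact: sol_next_better.
have := sol_next_fixed v nx; rewrite /back /pair_str dec_seqK /=.
by [].
Qed.

End Machine.
End Solutions.
End Reduction.

Lemma sat_flip_PLS_hard (P : local_search) : in_PLS P -> PLS_reducible P (sat_flip 4 1).
Proof.
case=> _ [cs [ks solution_size]] /polytime_Poly[Ff pFf FfE] [init init_feasible].
move=> /polytime_Poly[Fi pFi FiE] /polytime_Poly[Fp pFp FpE] [nbrs nbrsE].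
move=> /polytime_Poly[Fn pFn FnE].
(* The payoff is printed in polynomial time, which bounds the number of its digits; the bound on the
   length of solutions turns this into a bound in terms of the instance alone. *)
have [cq [kq payoff_size]] : exists cq kq, forall (x : instance P) s, feasible x s ->
    size (enc_nat (payoff x s)) <= cq * size (enc_instance x) ^ kq + cq.
  have [U [pU mU HU]] := Poly_size pFp.
  have [cq [kq H]] : poly_le (fun n => U (4 * (2 * n + 2 * (cs * n ^ ks + cs) + 2) + 1)).
    by apply: poly_le_comp => //; polyle.
  exists cq, kq => x s fs; apply: leq_trans (H _).
  rewrite -(FpE (x, s)) //; apply: leq_trans (leq_trans (HU (enc_pair (x, s))) (mU _ _ _)).
    by have /andP[] := size_enc_bits (Fp (enc_pair (x, s))); lia.
  have /andP[_ h] := size_enc_bits (enc_pair (x, s)); apply: leq_trans h _.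
  by rewrite leq_add2r leq_mul2l (size_pair_str (enc_instance x) s) leq_add2r leq_add2l
     leq_mul2l solution_size.
have FfE' (x : instance P) s : Ff (pair_str (enc_instance x) s) = [:: feasible x s].
  exact: (FfE (x, s) I).
have FpE' (x : instance P) s : feasible x s ->
    Fp (pair_str (enc_instance x) s) = enc_nat (payoff x s) by exact: (FpE (x, s)).
have FnE' (x : instance P) s : feasible x s ->
    Fn (pair_str (enc_instance x) s) = enc_seq (nbrs (x, s)) by exact: (FnE (x, s)).
have FiE' (x : instance P) : Fi (enc_instance x) = init x by exact: FiE.
have pstep := Poly_step_fun P cs ks cq kq pFf pFp pFn.
(* The step function, assembled from the given machines, is compiled back into a single machine, and
   the circuits for all instances are made from its transition table. *)
have [M [c [e machine]]] :=
  @Poly_polytime _ _ id id (fun=> True) _ _ pstep (fun w _ => erefl).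
pose red X := reduction P cs ks cq kq Fi Fp M c e X.
exists (fun x => Sub (red (enc_instance x)) (kcnf_formula4 _ _ _ _ _ _ _ _)).
exists (fun xs => back cs ks cq kq (enc_pair xs)); split.
- have pr := Poly_reduction P cs ks cq kq pFi pFp M c e; have pe := Poly_enc_cnf.
  by apply: (@Poly_polytime _ _ _ _ _ _ _ (Poly_comp pr pe)).
- exact: (@Poly_polytime _ _ _ _ _ _ _ (Poly_back cs ks cq kq)).
move=> x s [/eqP sz opt].
by apply: (reduction_correct (M := M) (c := c) (e := e) solution_size payoff_size FfE'
  init_feasible FiE' FpE' nbrsE FnE') => // w; exact: machine.
Qed.

Theorem theorem3 : PLS_complete (sat_flip 4 1).
Proof. by split; [exact: sat_flip_in_PLS | exact: sat_flip_PLS_hard]. Qed.
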